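(* Consider the linear model $y=X\beta^*+\varepsilon$ with random sub-Gaussian design, Gaussian noise $\varepsilon\sim N(0,\sigma_\varepsilon^2I_N)$ independent of $X$ with $\sigma_\varepsilon$ known, and $\beta^*\in\mathcal{S}(k,s_1,s_2)$. Assume that $X$ is a row-wise $(\sigma_x,\Sigma_x)$-sub-Gaussian random matrix whose covariance $\Sigma_x$ has all eigenvalues in $[c,c']$ for constants $0<c\le c'$ not depending on the dimensions, and that $\Theta_x=\Sigma_x^{-1}$ satisfies $\max_i\sum_j|(\Theta_x)_{ij}|\le M_n$, where $M_n$ is allowed to grow with $n$. Let $\lambda\asymp\sigma_\varepsilon\sqrt{\frac{\log n}{N}}$, $\lambda_g=\lambda\sqrt{\nu/(2d)^{k+1}}$ where $0\le\nu<1$ and $d$ is the maximum degree of the underlying graph, $\mu\asymp\sqrt{\frac{\log n}{N}}$, and assume $s_2/s_1\ge\nu$. Let $\tilde\beta$ be the one-step estimator built from the $k$-th order Graph-Piecewise-Polynomial-Lasso $\hat\beta$ (with tuning parameters $\lambda,\lambda_g$) and the CLIME matrix $\widehat\Theta$ (with tuning parameter $\mu$). If $\frac{s_2\log n}{\sqrt N}\to0$ and $M_n\sqrt{\frac{\log n}{N}}\to0$, then for $j\in[n]$, $$\frac{\sqrt N(\tilde\beta_j-\beta_j^* )}{\sigma_\varepsilon\sqrt{e_j^T\widehat\Theta\Sigma_N\widehat\Theta^Te_j}}\to N(0,1)$$ in distribution.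
   Context: Graph: $\mathcal{G}=(\mathcal{V},\mathcal{E})$ is a known undirected graph with $n$ nodes labelled $1,\dots,n$, $p$ edges, and maximum degree $d$. Its oriented incidence matrix $F\in\{-1,0,1\}^{p\times n}$ has, for the row corresponding to the edge $(i,j)$ with $i<j$, entry $-1$ in position $i$, $+1$ in position $j$, and $0$ elsewhere. The Laplacian is $L=F^TF$. Graph difference operators: $\Delta^{(1)}=F$, and for $k\ge1$, $\Delta^{(k+1)}=F^T\Delta^{(k)}=L^{(k+1)/2}$ if $k$ is odd, $\Delta^{(k+1)}=F\Delta^{(k)}=FL^{k/2}$ if $k$ is even. $k\ge0$ is a fixed integer. Parameter space: $\mathcal{S}(k,s_1,s_2)=\{\beta\in\mathbb{R}^n:\|\Delta^{(k+1)}\beta\|_0\le s_1,\ \|\beta\|_0\le s_2\}$, where $s_1,s_2>0$ and $\|\cdot\|_0$ counts nonzero entries. Design: a random variable $Z$ is $\sigma$-sub-Gaussian if $\mathbb{E}Z=0$ and $\mathbb{E}e^{tZ}\le e^{\sigma^2t^2/2}$ for all $t\in\mathbb{R}$; a random vector $Z$ is $\sigma$-sub-Gaussian if $\mathbb{E}Z=0$ and $u^TZ$ is $\sigma$-sub-Gaussian for every unit vector $u$. $X\in\mathbb{R}^{N\times n}$ is a row-wise $(\sigma_x,\Sigma_x)$-sub-Gaussian random matrix if its rows are i.i.d. from a $\sigma_x$-sub-Gaussian distribution with covariance matrix $\Sigma_x$. Estimators: for $\lambda>0,\lambda_g\ge0$, the $k$-th order Graph-Piecewise-Polynomial-Lasso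 is $$\hat\beta\in\arg\min_{\beta\in\mathbb{R}^n}\ \frac1{2N}\|y-X\beta\|_2^2+\lambda_g\|\Delta^{(k+1)}\beta\|_1+\lambda\|\beta\|_1 .$$ Let $\Sigma_N=\frac1NX^TX$. The CLIME matrix $\widehat\Theta\in\mathbb{R}^{n\times n}$ is a solution of: minimize $\|\Theta\|_{1,1}=\sum_{i,j}|\Theta_{ij}|$ over $\Theta\in\mathbb{R}^{n\times n}$ subject to $\|\Theta\Sigma_N-I_n\|_\infty\le\mu$ (entrywise maximum). The one-step estimator is $\tilde\beta=\hat\beta+\frac1N\widehat\Theta X^T(y-X\hat\beta)$. $e_j$ is the $j$-th column of $I_n$; $[n]=\{1,\dots,n\}$. Asymptotics: $N,n,p,s_1,s_2$ are allowed to increase to $\infty$ (the graph changing accordingly); $k,\nu,\sigma_\varepsilon,\sigma_x$ and the eigenvalue bounds are fixed. $f\asymp g$ means equality of order up to positive constants; the choices $\lambda\asymp g$, $\mu\asymp h$ mean that $\lambda,\mu$ are taken to be $g,h$ times suitable positive constants. *)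

(* Defs.v *)
From HB Require Import structures.
From mathcomp Require Import all_boot all_order all_algebra.
From mathcomp Require Import all_classical all_reals all_analysis.

Set Implicit Arguments.
Unset Strict Implicit.
Unset Printing Implicit Defensive.

Import Order.TTheory GRing.Theory Num.Theory.
Import numFieldNormedType.Exports.

Local Open Scope classical_set_scope.
Local Open Scope ring_scope.

Section matrix_measurable.
Variables (R : realType) (m n : nat).

(* The product sigma-algebra on R^(m x n), generated by the entries. *)
Definition mx_measurable : set (set 'M[R]_(m, n)) :=
  <<s [set A | exists i j (B : set R),
                 measurable B /\ A = [set x : 'M[R]_(m, n) | B (x i j)]] >>.

Let mx_measurable0 : mx_measurable set0.
Proof. exact: sigma_algebra0. Qed.

Let mx_measurableC A : mx_measurable A -> mx_measurable (~` A).
Proof. exact: sigma_algebraC. Qed.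

Let mx_measurable_bigcup (F : (set 'M[R]_(m, n))^nat) :
  (forall i, mx_measurable (F i)) -> mx_measurable (\bigcup_i F i).
Proof. exact: sigma_algebra_bigcup. Qed.

HB.instance Definition _ := @isMeasurable.Build default_measure_display
  'M[R]_(m, n) mx_measurable mx_measurable0 mx_measurableC mx_measurable_bigcup.

End matrix_measurable.

Section graph.

Record sgraph (n : nat) := SGraph {
  adj :> rel 'I_n;
  adj_sym : symmetric adj;
  adj_irr : irreflexive adj }.

Variables (R : realType) (n : nat) (G : sgraph n).

(* Each undirected edge is represented once, as the pair (i, j) with i < j. *)
Definition edges : {set 'I_n * 'I_n} :=
  [set e : 'I_n * 'I_n | (e.1 < e.2)%N && G e.1 e.2].

Definition max_degree : nat := (\max_(i : 'I_n) #|[set j | G i j]|)%N.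

Definition incidence : 'M[R]_(#|edges|, n) :=
  \matrix_(r, v) if v == (enum_val r).1 then -1
                 else if v == (enum_val r).2 then 1 else 0.

(* [graph_diff k] is the difference operator of order k + 1, namely F if k = 0,
   F^T times the operator of order k if k is odd, and F times it if k > 0 is
   even; its number of rows depends on the parity of k. *)
Definition diff_dim (k : nat) : nat := if odd k then n else #|edges|.

Fixpoint graph_diff (k : nat) : 'M[R]_(diff_dim k, n) :=
  match k return 'M[R]_(diff_dim k, n) with
  | 0 => incidence
  | k'.+1 =>
    (if odd k' as b return 'M[R]_(if b then n else #|edges|, n) ->
                           'M[R]_(if ~~ b then n else #|edges|, n)
     then fun D => incidence *m D else fun D => incidence^T *m D)
    (graph_diff k')
  end.

End graph.

Section estimators.
Variable R : realType.

Definition norm0 (q : nat) (v : 'cV[R]_q) : nat := #|[set i | v i 0 != 0]|.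
Definition norm1 (q : nat) (v : 'cV[R]_q) : R := \sum_i `|v i 0|.
Definition sqnorm2 (q : nat) (v : 'cV[R]_q) : R := \sum_i v i 0 ^+ 2.

Definition param_space (n : nat) (G : sgraph n) (k : nat) (s1 s2 : R) :
    set 'cV[R]_n :=
  [set b | (norm0 (graph_diff R G k *m b))%:R <= s1 /\ (norm0 b)%:R <= s2].

Definition is_argmin (U : Type) (D : set U) (f : U -> R) (x : U) : Prop :=
  D x /\ forall z, D z -> f x <= f z.

Definition lasso_objective (N n : nat) (G : sgraph n) (k : nat)
    (lambda_g lambda : R) (y : 'cV[R]_N) (X : 'M[R]_(N, n)) (b : 'cV[R]_n) : R :=
  (2 * N%:R)^-1 * sqnorm2 (y - X *m b)
  + lambda_g * norm1 (graph_diff R G k *m b) + lambda * norm1 b.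

Definition gram (N n : nat) (X : 'M[R]_(N, n)) : 'M[R]_n :=
  N%:R^-1 *: (X^T *m X).

Definition clime_feasible (N n : nat) (mu : R) (X : 'M[R]_(N, n)) :
    set 'M[R]_n :=
  [set Th | forall i l, `|(Th *m gram X - 1%:M) i l| <= mu].

(* The CLIME matrix is a function of the design alone.  The constraint set may
   be empty (e.g. for X = 0 and mu < 1); no condition is imposed on the value
   taken there. *)
Definition is_clime (N n : nat) (mu : R)
    (Theta : 'M[R]_(N, n) -> 'M[R]_n) : Prop :=
  forall X, clime_feasible mu X !=set0 ->
    is_argmin (clime_feasible mu X)
      (fun Th : 'M[R]_n => \sum_i \sum_l `|Th i l|) (Theta X).

Definition one_step (N n : nat) (y : 'cV[R]_N) (X : 'M[R]_(N, n))
    (b : 'cV[R]_n) (Th : 'M[R]_n) : 'cV[R]_n :=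
  b + N%:R^-1 *: (Th *m X^T *m (y - X *m b)).

End estimators.

Section probability_notions.
Context d (T : measurableType d) (R : realType) (P : probability T R).
Local Open Scope ereal_scope.

Definition independent_rv d1 d2 (U1 : measurableType d1) (U2 : measurableType d2)
    (Y1 : T -> U1) (Y2 : T -> U2) : Prop :=
  forall A B, measurable A -> measurable B ->
    P (Y1 @^-1` A `&` Y2 @^-1` B) = P (Y1 @^-1` A) * P (Y2 @^-1` B).

Definition mutually_independent (I : finType) d1 (U : measurableType d1)
    (Y : I -> T -> U) : Prop :=
  forall (J : {set I}) (A : I -> set U), (forall i, measurable (A i)) ->
    P (\bigcap_(i in [set` J]) (Y i @^-1` A i)) =
    \prod_(i in J) P (Y i @^-1` A i).

Definition identically_distributed (I : Type) d1 (U : measurableType d1)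
    (Y : I -> T -> U) : Prop :=
  forall i i' A, measurable A -> P (Y i @^-1` A) = P (Y i' @^-1` A).

Definition sub_gaussian (sigma : R) (Z : T -> R) : Prop :=
  'E_P[Z] = 0 /\
  forall t : R, 'M_P Z t <= (expR (sigma ^+ 2 * t ^+ 2 / 2))%:E.

Definition sub_gaussian_vector (n : nat) (sigma : R) (Z : T -> 'rV[R]_n) : Prop :=
  (forall l, 'E_P[fun w => Z w 0%R l] = 0) /\
  forall u : 'rV[R]_n, (\sum_l u 0 l ^+ 2 = 1)%R ->
    sub_gaussian sigma (fun w => (\sum_l u 0 l * Z w 0 l)%R).

Definition has_covariance (n : nat) (Z : T -> 'rV[R]_n) (Sigma : 'M[R]_n) : Prop :=
  forall l l',
    covariance P (fun w => Z w 0%R l) (fun w => Z w 0%R l') = (Sigma l l')%:E.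

Definition rowwise_sub_gaussian (N n : nat) (sigma : R) (Sigma : 'M[R]_n)
    (X : T -> 'M[R]_(N, n)) : Prop :=
  let Y := fun i w => row i (X w) in
  [/\ mutually_independent Y, identically_distributed Y &
      forall i, sub_gaussian_vector sigma (Y i) /\ has_covariance (Y i) Sigma].

(* N(0, sigma^2 I_N): independent coordinates with law N(0, sigma^2); the second
   parameter of [normal_prob] is the standard deviation. *)
Definition isotropic_gaussian (N : nat) (sigma : R) (eps : T -> 'cV[R]_N) : Prop :=
  mutually_independent (fun i w => eps w i 0%R) /\
  forall i (A : set R), measurable A ->
    P ((fun w => eps w i 0%R) @^-1` A) = normal_prob 0 sigma A.

End probability_notions.

(* The m-th variable lives on its own probability space. *)
Definition cvg_in_distribution (R : realType) (d : nat -> measure_display)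
    (T : forall m, measurableType (d m)) (P : forall m, probability (T m) R)
    (Z : forall m, T m -> R) (mu : probability (measurableTypeR R) R) : Prop :=
  forall t : R, {for t, continuous (fun x : R => mu `]-oo, x]%classic)} ->
    P m (Z m @^-1` `]-oo, t]%classic) @[m --> \oo] --> mu `]-oo, t]%classic.

(* Main.v *)
Require Import Defs.
From HB Require Import structures.
From mathcomp Require Import all_boot all_order all_algebra.
From mathcomp Require Import all_classical all_reals all_analysis.
From mathcomp Require Import measurable_realfun.
From mathcomp Require Import ring lra.

Set Implicit Arguments.
Unset Strict Implicit.
Unset Printing Implicit Defensive.

Import Order.TTheory GRing.Theory Num.Theory.
Import numFieldNormedType.Exports.

Local Open Scope classical_set_scope.
Local Open Scope ring_scope.

(** Write S = X^T X / N, let h be the error of the Lasso, th the j-th row of the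
    CLIME matrix Theta and D = th^T S th its variance estimate.  Inserting
    y = X beta + eps in the definition of the one-step estimator gives

      sqrt N (betatilde_j - beta_j) =
        sqrt N (th^T X^T eps / N) - sqrt N ((Theta S - I) h)_j.

    Divided by sigma sqrt D, the first term is the pairing of eps / sigma with
    the unit vector in the direction of X th.  Theta is a function of X, and X
    is independent of eps, so this pairing is N(0, 1) conditionally on X, hence
    exactly N(0, 1) ([conditional_gaussian], [law_studentized]).  The second
    term is at most sqrt N mu |h|_1 by the CLIME constraint, and D is bounded
    below: Cauchy-Schwarz for the form S, applied to th and e_j, gives
    (1 - mu)^2 <= D S_jj ([variance_estimate_lower], [remainder_bound]).  As the
    normal density is bounded, the distribution functions differ by at most the
    probability of an exceptional event plus a multiple of the bound on the
    remainder ([cdf_near_gaussian]).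

    It remains to bound |h|_1.  The operator Delta of order k + 1 satisfies
    |Delta b|^2 <= (2 d)^(k+1) |b|^2, because (b_j - b_i)^2 <= 2 (b_i^2 + b_j^2)
    and every vertex lies on at most d edges.  With the chosen lambda_g and
    nu s1 <= s2, the graph penalty therefore contributes to the basic inequality
    of the Lasso no more than the sparsity of beta does ([lasso_cone]).  If the
    entries of S - Sigma are O(a), where a = sqrt (log n / N), then S inherits
    from Sigma a restricted eigenvalue bound, and |h|_1 = O(lambda s2)
    ([lasso_l1_sparse]).  The remainder is then O(s2 log n / sqrt N).

    The exceptional events concern S and the noise.  The value of the form S at
    b is an average of independent squares of sub-Gaussian variables, which
    satisfy a Bernstein inequality ([bernstein_two_sided]); by polarization this
    controls the entries of S - Sigma and of Sigma^-1 (S - Sigma), so that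
    Sigma^-1 is feasible for CLIME.  For the noise, every column of X paired
    with eps is, after normalization, exactly Gaussian.

    With levels that are fixed multiples of a, these events have probability
    O(1 / n), which is small only for large n, whereas n may stay bounded while
    N grows.  Given a tolerance e, a level K is chosen for the deviations of S,
    and for small n also for the noise, so that each event has probability at
    most e / 4 for every n > 1 ([uniform_deviation_level]).  For n >= n0(e) the
    argument above applies ([sparse_cdf_bound]).  For n < n0(e), S itself is invertible
    as soon as a is small, so that S^-1 is feasible for CLIME, and without any
    use of sparsity |h|_1 is at most a constant depending on n0 and K times
    lambda; the remainder is O(a) ([dense_cdf_bound]).  In both regimes a tends
    to 0, since the rows of Sigma^-1 have l1 norms bounded away from 0
    ([precision_row_lower]). *)

(** * Gaussian integrals *)

Section density.
Local Open Scope ereal_scope.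
Context d (T : measurableType d) (R : realType).
Variables (mu nu : {measure set T -> \bar R}) (g : T -> R).
Hypotheses (mg : measurable_fun [set: T] g) (g0 : forall x, (0 <= g x)%R).
Hypothesis nuE : forall A, measurable A -> nu A = \int[mu]_(x in A) (g x)%:E.
Import HBNNSimple.

Let sfun_density (h : {nnsfun T >-> R}) :
  \int[nu]_x (h x)%:E = \int[mu]_x (h x * g x)%:E.
Proof.
rewrite integral_nnsfun//= patch_setT sintegralE.
transitivity (\int[mu]_x
    (\sum_(r \in range h) (r * \1_(h @^-1` [set r]) x)%:E * (g x)%:E)).
  rewrite ge0_integral_fsum//; last 2 first.
  - by move=> r; apply/measurable_EFinP; do 2 apply: measurable_funM => //.
  - move=> r x _; rewrite mule_ge0// ?lee_fin//; have := nnfun_muleindic_ge0 h r x.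
    by rewrite -EFinM lee_fin.
  apply: eq_fsbigr => r _; under eq_integral do rewrite EFinM -muleA.
  have [r0|r0] := leP 0%R r; last first.
    rewrite (preimage_nnfun0 h r0) measure0 mule0 integral0_eq// => x _.
    by rewrite indic0 mul0e mule0.
  rewrite ge0_integralZl_EFin//; last 2 first.
  - by move=> x _; rewrite mule_ge0// lee_fin.
  - by apply/measurable_EFinP; apply: measurable_funM.
  congr (_ * _); rewrite nuE// integral_mkcond; apply: eq_integral => x _.
  by rewrite patchE indicE; case: ifP => _; rewrite ?mul1e ?mul0e.
apply: eq_integral => x _; rewrite -ge0_mule_fsuml; last first.
  by move=> r; rewrite EFinM nnfun_muleindic_ge0.
by rewrite [in RHS]fimfunE EFinM -fsumEFin.
Qed.

(** Both sides are monotone limits of their values on simple functions. *)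
Lemma ge0_integral_density (f : T -> \bar R) : measurable_fun [set: T] f ->
  (forall x, 0 <= f x) -> \int[nu]_x f x = \int[mu]_x (f x * (g x)%:E).
Proof.
move=> mf f0; pose f_ := nnsfun_approx measurableT mf.
transitivity (limn (fun n => \int[nu]_x (f_ n x)%:E)).
  rewrite -monotone_convergence//=.
  - by apply: eq_integral => x _; apply/esym/cvg_lim => //=; exact: cvg_nnsfun_approx.
  - by move=> n; exact/measurable_EFinP.
  - by move=> n x _; rewrite lee_fin.
  - by move=> x _ a b ab; rewrite lee_fin//; exact/lefP/nd_nnsfun_approx.
under eq_fun do rewrite sfun_density.
rewrite -monotone_convergence//=.
- apply: eq_integral => x _; apply/cvg_lim => //.
  under eq_fun do rewrite EFinM.
  by apply: cvgeZr => //; exact: cvg_nnsfun_approx.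
- by move=> n; apply/measurable_EFinP; apply: measurable_funM.
- by move=> n x _; rewrite lee_fin mulr_ge0.
- move=> x _ a b ab; rewrite lee_fin ler_wpM2r//; exact/lefP/nd_nnsfun_approx.
Qed.

End density.

Section affine_change.
Local Open Scope ereal_scope.
Context (R : realType).
Notation mu := (@lebesgue_measure R).

(** Lebesgue measure equals |a| times its image under x |-> a x + m: both give
    intervals the same length. *)
Lemma integral_affine (a m : R) (f : R -> \bar R) : a != 0%R ->
  measurable_fun [set: R] f -> (forall x, 0 <= f x) ->
  \int[mu]_x f x = `|a|%:E * \int[mu]_x f (a * x + m)%R.
Proof.
move=> a0 mf f0.
pose h (x : measurableTypeR R) : measurableTypeR R := (a * x + m)%R.
have mh : measurable_fun [set: measurableTypeR R] h.
  by apply: measurable_funD => //; exact: measurable_funM.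
pose k := NngNum (normr_ge0 a).
pose nu : {measure set (measurableTypeR R) -> \bar R} :=
  mscale k (measure_function_pushforward__canonical__measure_function_Measure mu mh).
have nuE A : measurable A -> mu A = nu A.
  apply: lebesgue_measure_unique => X [[u v] _ <-]/=.
  rewrite /nu /mscale/= /pushforward.
  move: a0; rewrite neq_lt => /orP[a0|a0].
    have -> : h @^-1` `]u, v]%classic =
        `[((v - m) / a)%R, ((u - m) / a)%R[%classic :> set R.
      apply/seteqP; split => x /=; rewrite !in_itv/= /h => /andP[].
        by rewrite ltr_ndivlMr// ler_ndivrMr// ltrBlDr lerBrDr mulrC => -> ->.
      by rewrite ltr_ndivlMr// ler_ndivrMr// ltrBlDr lerBrDr mulrC => -> ->.
    rewrite !lebesgue_measure_itv/= !lte_fin ltr_nM2r ?invr_lt0// ltrD2r.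
    case: ifP => _; last by rewrite mule0.
    rewrite ltr0_norm// -!EFinB -EFinM; congr EFin; field.
    by rewrite lt_eqF.
  have -> : h @^-1` `]u, v]%classic =
      `]((u - m) / a)%R, ((v - m) / a)%R]%classic :> set R.
    apply/seteqP; split => x /=; rewrite !in_itv/= /h => /andP[].
      by rewrite ltr_pdivrMr// ler_pdivlMr// ltrBlDr lerBrDr mulrC => -> ->.
    by rewrite ltr_pdivrMr// ler_pdivlMr// ltrBlDr lerBrDr mulrC => -> ->.
  rewrite !lebesgue_measure_itv/= !lte_fin ltr_pM2r ?invr_gt0// ltrD2r.
  case: ifP => _; last by rewrite mule0.
  rewrite gtr0_norm// -!EFinB -EFinM; congr EFin; field.
  by rewrite gt_eqF.
rewrite (eq_measure_integral nu); last by move=> A mA _; exact: nuE.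
by rewrite ge0_integral_mscale//= ge0_integral_pushforward.
Qed.

End affine_change.

Section gaussian.
Local Open Scope ereal_scope.
Context (R : realType).
Notation mu := (@lebesgue_measure R).
Notation gamma := (@normal_prob R 0 1).
Implicit Types (f : R -> \bar R) (a b c m s x y z : R).

Lemma ge0_integral_normal m s f : measurable_fun [set: R] f ->
  (forall x, 0 <= f x) ->
  \int[normal_prob m s]_x f x = \int[mu]_x (f x * (normal_pdf m s x)%:E).
Proof.
move=> mf f0; apply: ge0_integral_density => //.
- exact: measurable_normal_pdf.
- exact: normal_pdf_ge0.
Qed.

Lemma normal_peakE s : normal_peak s = (normal_peak 1 / `|s|)%R.
Proof.
rewrite /normal_peak -mulrnAr sqrtrM ?sqr_ge0// sqrtr_sqr.
by rewrite expr1n mul1r invfM mulrC.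
Qed.

Lemma normal_pdf_affine m s x : s != 0%R ->
  (`|s| * normal_pdf m s (s * x + m) = normal_pdf 0 1 x)%R.
Proof.
move=> s0; rewrite !normal_pdfE ?oner_neq0//= normal_peakE mulrA.
rewrite [(`|s| * _)%R]mulrC mulfVK ?normr_eq0//; congr (_ * expR _)%R.
by field.
Qed.

(** Change of variables; s may be negative because the normal law is symmetric. *)
Lemma integral_normal_affine m s f : s != 0%R -> measurable_fun [set: R] f ->
  (forall x, 0 <= f x) ->
  \int[normal_prob m s]_x f x = \int[gamma]_x f (s * x + m)%R.
Proof.
move=> s0 mf f0; have mh : measurable_fun [set: R] (fun x => s * x + m)%R.
  by apply: measurable_funD => //; exact: measurable_funM.
have mfh := measurableT_comp mf mh.
rewrite (ge0_integral_normal m s mf f0) (ge0_integral_normal 0 1 mfh (fun=> f0 _)).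
rewrite (@integral_affine _ s m)//; last 2 first.
- by apply: emeasurable_funM => //; apply/measurable_EFinP; exact: measurable_normal_pdf.
- by move=> x; rewrite mule_ge0// lee_fin normal_pdf_ge0.
rewrite -ge0_integralZl_EFin//; last 2 first.
- by move=> x _; rewrite mule_ge0// lee_fin normal_pdf_ge0.
- apply: emeasurable_funM; first exact: (measurableT_comp mf mh).
  by apply/measurable_EFinP; exact: (measurableT_comp (measurable_normal_pdf _ _) mh).
by apply: eq_integral => x _; rewrite muleCA -EFinM normal_pdf_affine.
Qed.

(** Completing the square: for independent standard normal X and Y, the joint
    density of a X + b Y and Y is the density of a X + b Y times the conditional
    density of Y. *)
Lemma normal_pdf_convolution a b y z : a != 0%R ->
  let c := Num.sqrt (a ^+ 2 + b ^+ 2) in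
  (normal_pdf (b * y) a z * normal_pdf 0 1 y =
   normal_pdf 0 c z * normal_pdf (b * z / c ^+ 2) (a / c) y)%R.
Proof.
move=> a0 c.
have c2 : (c ^+ 2 = a ^+ 2 + b ^+ 2)%R by rewrite sqr_sqrtr// addr_ge0// sqr_ge0.
have c20 : (a ^+ 2 + b ^+ 2 != 0)%R.
  by rewrite gt_eqF// ltr_pwDl// ?sqr_ge0// exprn_even_gt0.
have c0 : c != 0%R by rewrite -sqrf_eq0 c2.
rewrite !normal_pdfE ?mulf_neq0 ?invr_eq0//= !(normal_peakE a, normal_peakE c, normal_peakE (a / c)).
rewrite /normal_fun mulrACA [RHS]mulrACA -!expRD; congr (_ * expR _)%R.
  by rewrite normrM normfV; field; rewrite !normr_eq0 a0 c0.
rewrite expr_div_n c2 subr0 expr1n; field.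
by rewrite a0 c20.
Qed.

Lemma integral_gamma_cst (y : \bar R) : \int[gamma]_x y = y.
Proof. by rewrite integral_cst//= probability_setT mule1. Qed.

(** The law of a X + b Y for independent standard normal X and Y.  When a = 0
    there is no conditional density of a X + b Y given Y, and the claim is the
    symmetry of the normal law. *)
Lemma gaussian_convolution a b f : measurable_fun [set: R] f ->
  (forall x, 0 <= f x) ->
  \int[gamma]_x \int[gamma]_y f (a * x + b * y)%R =
  \int[gamma]_z f (Num.sqrt (a ^+ 2 + b ^+ 2) * z)%R.
Proof.
move=> mf f0.
have [->|a0] := eqVneq a 0%R.
  transitivity (\int[gamma]_x \int[gamma]_y f (b * y)%R).
    by apply: eq_integral => x _; apply: eq_integral => y _; rewrite mul0r add0r.
  rewrite integral_gamma_cst expr0n/= add0r sqrtr_sqr.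
  have [->|b0] := eqVneq b 0%R; first by rewrite normr0.
  have scaleE r : r != 0%R ->
      \int[gamma]_x f (r * x)%R = \int[normal_prob 0 r]_x f x.
    move=> r0; rewrite (integral_normal_affine 0 r0)//.
    by apply: eq_integral => x _; rewrite addr0.
  rewrite (scaleE b b0) (scaleE `|b|%R); last by rewrite normr_eq0.
  rewrite (ge0_integral_normal 0 b mf f0) (ge0_integral_normal 0 `|b| mf f0).
  apply: eq_integral => x _.
  by rewrite !normal_pdfE ?normr_eq0// normal_peakE [normal_peak `|b|]normal_peakE normr_id
    /normal_fun real_normK// num_real.
set c := Num.sqrt _.
have c0 : c != 0%R.
  by rewrite gt_eqF// sqrtr_gt0 ltr_pwDl// ?sqr_ge0// exprn_even_gt0.
pose R2 : Type := (measurableTypeR R * measurableTypeR R)%type.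
have mlin : measurable_fun [set: measurableTypeR R * measurableTypeR R]
    (fun z : R2 => a * z.1 + b * z.2 : measurableTypeR R)%R.
  by apply: measurable_funD; apply: measurable_funM => //.
have mfl : measurable_fun [set: measurableTypeR R * measurableTypeR R]
    (fun z : R2 => f (a * z.1 + b * z.2)%R).
  exact: (measurableT_comp mf mlin).
have fl0 (z : R2) : 0 <= f (a * z.1 + b * z.2)%R by [].
transitivity (\int[gamma]_y \int[gamma]_x f (a * x + b * y)%R).
  exact: (fubini_tonelli (fun z : R2 => f (a * z.1 + b * z.2)%R)).
rewrite (ge0_integral_normal 0 1); last 2 first.
- exact: (measurable_fun_fubini_tonelli_G _ mfl fl0).
- by move=> y; exact: integral_ge0.
have mpdf : measurable_fun [set: measurableTypeR R * measurableTypeR R]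
    (fun z : R2 => normal_pdf (b * z.1) a z.2).
  rewrite [X in measurable_fun _ X](_ : _ = (fun z : R2 =>
    normal_peak a * expR (- (z.2 - b * z.1) ^+ 2 / (a ^+ 2 *+ 2)))%R); last first.
    by apply/funext => z; rewrite normal_pdfE.
  apply: measurable_funM => //; apply: measurableT_comp => //.
  apply: measurable_funM => //; apply: measurableT_comp => //.
  apply: measurable_funX; apply: measurable_funB => //.
  exact: measurable_funM.
transitivity (\int[mu]_y \int[mu]_z (f z *
    (normal_pdf (b * y) a z * normal_pdf 0 1 y)%:E)).
  apply: eq_integral => y _.
  have := @integral_normal_affine (b * y)%R a f a0 mf f0 => <-.
  rewrite ge0_integral_normal// -ge0_integralZr//; last 3 first.
  - apply: emeasurable_funM => //; apply/measurable_EFinP.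
    exact: measurable_normal_pdf.
  - by move=> z _; rewrite mule_ge0// lee_fin normal_pdf_ge0.
  - by rewrite lee_fin normal_pdf_ge0.
  by apply: eq_integral => z _; rewrite EFinM muleA.
rewrite (fubini_tonelli (fun z : R2 => f z.2 *
    (normal_pdf (b * z.1) a z.2 * normal_pdf 0 1 z.1)%:E))/=; last 2 first.
- apply: emeasurable_funM; first exact: measurableT_comp.
  apply/measurable_EFinP; apply: measurable_funM => //.
  exact: (measurableT_comp (measurable_normal_pdf _ _)).
- by move=> z; rewrite mule_ge0// lee_fin mulr_ge0// normal_pdf_ge0.
transitivity (\int[normal_prob 0 c]_z f z); last first.
  rewrite (integral_normal_affine 0 c0)//.
  by apply: eq_integral => z _; rewrite addr0.
rewrite ge0_integral_normal//; apply: eq_integral => z _.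
under eq_integral do rewrite normal_pdf_convolution// EFinM muleA.
rewrite ge0_integralZl//; last 3 first.
- by apply/measurable_EFinP; exact: measurable_normal_pdf.
- by move=> y _; rewrite lee_fin normal_pdf_ge0.
- by rewrite mule_ge0// lee_fin normal_pdf_ge0.
by rewrite integral_normal_pdf mule1.
Qed.

Lemma measurable_expRM s : measurable_fun [set: R] (fun x => (expR (s * x))%:E).
Proof.
by apply/measurable_EFinP; apply: measurableT_comp => //; exact: measurable_funM.
Qed.

(** The factor exp(s x) moves the center of the normal density to s. *)
Lemma gaussian_mgf s : \int[gamma]_x (expR (s * x))%:E = (expR (s ^+ 2 / 2))%:E.
Proof.
rewrite (ge0_integral_normal 0 1 (measurable_expRM s)); last first.
  by move=> x; rewrite lee_fin expR_ge0.
transitivity (\int[mu]_x ((expR (s ^+ 2 / 2))%:E * (normal_pdf s 1 x)%:E)).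
  apply: eq_integral => x _; rewrite -!EFinM; congr EFin.
  rewrite !normal_pdfE ?oner_neq0//= mulrCA [RHS]mulrCA; congr (_ * _)%R.
  by rewrite /normal_fun -!expRD; congr expR; field.
rewrite ge0_integralZl_EFin//; last 2 first.
- by move=> x _; rewrite lee_fin normal_pdf_ge0.
- by apply/measurable_EFinP; exact: measurable_normal_pdf.
by rewrite integral_normal_pdf mule1.
Qed.

(** The factor exp(3 x^2 / 8) turns the exponent - x^2 / 2 into - x^2 / 8, that
    of N(0, 2^2), whose density has half the peak. *)
Lemma gaussian_exp_square : \int[gamma]_x (expR (3 / 8 * x ^+ 2))%:E = 2%:E.
Proof.
have mexp : measurable_fun [set: R] (fun x => (expR (3 / 8 * x ^+ 2))%:E).
  apply/measurable_EFinP; apply: measurableT_comp => //.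
  by apply: measurable_funM => //; exact: measurable_funX.
rewrite (ge0_integral_normal 0 1 mexp); last first.
  by move=> x; rewrite lee_fin expR_ge0.
transitivity (\int[mu]_x (2%:E * (normal_pdf 0 2 x)%:E)).
  apply: eq_integral => x _; rewrite -!EFinM; congr EFin.
  rewrite !normal_pdfE ?oner_neq0 ?pnatr_eq0//=.
  have -> : normal_peak 1 = (2 * normal_peak 2)%R :> R.
    by rewrite [normal_peak 2]normal_peakE ger0_norm// mulrC divfK ?pnatr_eq0.
  rewrite -(mulrA 2%R) mulrCA; congr (2 * _)%R; rewrite mulrCA; congr (_ * _)%R.
  by rewrite /normal_fun -!expRD; congr expR; field.
rewrite ge0_integralZl_EFin//; last 2 first.
- by move=> x _; rewrite lee_fin normal_pdf_ge0.
- by apply/measurable_EFinP; exact: measurable_normal_pdf.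
by rewrite integral_normal_pdf mule1.
Qed.

(** Chernoff bound: the indicator of s < |x| is at most
    exp(- s^2) (exp(s x) + exp(- s x)). *)
Lemma gaussian_tail s : (0 <= s)%R ->
  gamma [set x | s < `|x| ]%R <= (2 * expR (- (s ^+ 2 / 2)))%:E.
Proof.
move=> s0; set A := [set x | _].
have mA : measurable A.
  have ms : measurable_fun [set: R] (fun x => s < `|x|)%R.
    by apply: measurable_fun_ltr => //; exact: normr_measurable.
  by have := ms measurableT [set true] I; rewrite setTI.
have -> : gamma A = \int[gamma]_x (\1_A x)%:E by rewrite integral_indic// setIT.
pose g r x := (expR (- s ^+ 2) * expR (r * x))%:E.
have mg r : measurable_fun [set: R] (g r).
  apply/measurable_EFinP; apply: measurable_funM => //.
  by apply: measurableT_comp => //; exact: measurable_funM.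
have g0 r x : 0 <= g r x by rewrite lee_fin mulr_ge0// expR_ge0.
have gE r : (r ^+ 2 = s ^+ 2)%R -> \int[gamma]_x g r x = (expR (- (s ^+ 2 / 2)))%:E.
  move=> rs.
  transitivity (\int[gamma]_x ((expR (- s ^+ 2))%:E * (expR (r * x))%:E)).
    by apply: eq_integral => x _; rewrite /g EFinM.
  rewrite ge0_integralZl_EFin ?expR_ge0//; last exact: measurable_expRM.
  by rewrite gaussian_mgf -EFinM rs -expRD; congr (expR _)%:E; field.
apply: (@le_trans _ _ (\int[gamma]_x (g s x + g (- s)%R x))).
  have mI : measurable_fun [set: R] (fun x => (\1_A x : R)%:E).
    by apply/measurable_EFinP; exact: measurable_indic.
  have mgg : measurable_fun [set: R] (g s \+ g (- s)%R) by exact: emeasurable_funD.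
  apply: ge0_le_integral => //=.
  - move=> x _; rewrite indicE; case: (boolP (x \in A)) => [|_]; last first.
      by rewrite adde_ge0.
    rewrite inE /A/= => sx; rewrite /g -EFinD lee_fin -!expRD.
    have [x0|x0] := leP 0%R x.
      rewrite ger0_norm// in sx.
      apply: (@le_trans _ _ (expR (- s ^+ 2 + s * x))%R); last by rewrite lerDl expR_ge0.
      rewrite -expR0 ler_expR; nra.
    rewrite ltr0_norm// in sx.
    apply: (@le_trans _ _ (expR (- s ^+ 2 + - s * x))%R); last by rewrite lerDr expR_ge0.
    by rewrite -expR0 ler_expR; nra.
have -> : \int[gamma]_x (g s x + g (- s)%R x) =
    \int[gamma]_x g s x + \int[gamma]_x g (- s)%R x by rewrite ge0_integralD//; exact: mg.
by rewrite !gE// ?sqrrN// -EFinD lee_fin mulr2n mulrDl mul1r.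
Qed.

(** The normal density is at most its peak. *)
Lemma gaussian_anticoncentration t s : (0 <= s)%R ->
  gamma `]-oo, (t + s)%R] <= gamma `]-oo, t] + (normal_peak 1 * s)%:E.
Proof.
move=> s0.
have -> : `]-oo, (t + s)%R]%classic = `]-oo, t]%classic `|` `]t, (t + s)%R]%classic :> set R.
  by rewrite -itv_bndbnd_setU// bnd_simp lerDl.
rewrite (le_trans (measureU2 _ _ _))// leeD2l// /normal_prob.
apply: (@le_trans _ _ (\int[mu]_(x in `]t, (t + s)%R]) (normal_peak 1)%:E)).
  apply: ge0_le_integral => //=.
  - by move=> x _; rewrite lee_fin normal_pdf_ge0.
  - apply/measurable_EFinP; apply: measurable_funTS; exact: measurable_normal_pdf.
  - by move=> x _; rewrite lee_fin normal_pdf_ub// oner_neq0.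
rewrite integral_cst//= lebesgue_measure_itv/= lte_fin EFinM lee_wpmul2l//.
  by rewrite lee_fin normal_peak_ge0.
case: ifP => _; last by rewrite lee_fin.
by rewrite -EFinD lee_fin addrAC subrr add0r.
Qed.

End gaussian.

(** * Independent variables and their partial sums and products *)

Section matrix_measurability.
Context (R : realType) (m n : nat).

Lemma measurable_mx_entry i j :
  measurable_fun [set: 'M[R]_(m, n)] (fun x : 'M[R]_(m, n) => x i j).
Proof.
move=> _ B mB; rewrite setTI.
by apply: sub_sigma_algebra; exists i, j, B.
Qed.

End matrix_measurability.

Section independent_pair.
Local Open Scope ereal_scope.
Context d d1 d2 (T : measurableType d) (U1 : measurableType d1)
  (U2 : measurableType d2) (R : realType) (P : probability T R).
Variables (Y1 : {mfun T >-> U1}) (Y2 : {mfun T >-> U2}).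

Lemma measurable_fun_pairing : measurable_fun [set: T] (fun w => (Y1 w, Y2 w)).
Proof. exact: measurable_fun_pair. Qed.

Lemma integral_independent_pair (f : U1 * U2 -> \bar R) :
  independent_rv P Y1 Y2 ->
  measurable_fun [set: U1 * U2] f -> (forall z, 0 <= f z) ->
  \int[P]_w f (Y1 w, Y2 w) =
  \int[distribution P Y1]_x \int[distribution P Y2]_y f (x, y).
Proof.
move=> indep mf f0.
pose nu := measure_function_pushforward__canonical__measure_function_Measure
  P measurable_fun_pairing.
have nuE A : measurable A ->
    (distribution P Y1 \x distribution P Y2) A = nu A.
  by apply: product_measure_unique => B C mB mC; rewrite /nu/= /pushforward -indep.
transitivity (\int[nu]_z f z).
  rewrite ge0_integral_pushforward//; exact: measurable_fun_pairing.
rewrite -(eq_measure_integral nu (fun A mA _ => nuE A mA)).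
exact: fubini_tonelli1.
Qed.

(** Events of the form (Y1 in A) and (Y2 in B) form a pi-system, so
    independence of E from those extends to the sigma-algebra of the pair. *)
Lemma independent_pair_event (E : set T) : measurable E ->
  independent_rv P Y1 Y2 ->
  (forall A B, measurable A -> measurable B ->
    P (Y1 @^-1` A `&` Y2 @^-1` B `&` E) =
    P (Y1 @^-1` A) * P (Y2 @^-1` B) * P E) ->
  forall C, measurable C ->
    P ((fun w => (Y1 w, Y2 w)) @^-1` C `&` E) =
    P ((fun w => (Y1 w, Y2 w)) @^-1` C) * P E.
Proof.
move=> mE indep indepE C mC.
have PE0 : (0 <= fine (P E))%R by exact: fine_ge0.
pose k := NngNum PE0.
have kE : (k%:num)%:E = P E by rewrite /= fineK// fin_num_measure.
pose nu := measure_function_pushforward__canonical__measure_function_Measure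
  P measurable_fun_pairing.
pose nuE := measure_function_pushforward__canonical__measure_function_Measure
  (mrestr P mE) measurable_fun_pairing.
have H1 : (distribution P Y1 \x mscale k (distribution P Y2)) C = nuE C.
  apply: product_measure_unique => // A B mA mB.
  rewrite /nuE/= /pushforward /mrestr /mscale/= kE [P E * _]muleC muleA.
  by rewrite -indepE.
have H2 : (distribution P Y1 \x mscale k (distribution P Y2)) C = mscale k nu C.
  apply: product_measure_unique => // A B mA mB.
  by rewrite /nu/= /mscale/= /pushforward/= kE muleCA -indep.
move: H1; rewrite H2 /nuE /nu /mscale/= /pushforward /mrestr kE => <-.
by rewrite muleC.
Qed.

End independent_pair.

Section independent_family.
Context d (T : measurableType d) (R : realType) (P : probability T R)
  (I : finType).
Variables (op : R -> R -> R) (idx : R).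
Hypothesis mop : measurable_fun [set: R * R] (fun z : R * R => op z.1 z.2).
Variable V : I -> {mfun T >-> R}.
Hypothesis indepV : mutually_independent P V.
Local Open Scope ereal_scope.

Let S (s : seq I) w := \big[op/idx]_(i <- s) V i w.
Let cyl (K : {set I}) (A : I -> set R) := \bigcap_(i in [set` K]) (V i @^-1` A i).

Lemma measurable_fun_bigop s : measurable_fun [set: T] (S s).
Proof.
elim: s => [|a s IH].
  by rewrite [S _](_ : _ = cst idx)//; apply/funext => w; rewrite /S big_nil.
rewrite [S _](_ : _ = (fun z : R * R => op z.1 z.2) \o (fun w => (V a w, S s w))).
  by apply: measurableT_comp => //; exact: measurable_fun_pair.
by apply/funext => w; rewrite /S big_cons.
Qed.

Let cyl_measurable K A : (forall i, measurable (A i)) -> measurable (cyl K A).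
Proof.
move=> mA; apply: fin_bigcap_measurable => // i _.
by rewrite -[X in measurable X]setTI; exact: measurable_funP.
Qed.

(** Adding the variables of s one at a time: at each step the pair formed by
    the new variable and the previous partial result is independent of every
    event depending on the variables not yet used. *)
Lemma independent_bigop_cylinder s (K : {set I}) A B :
  uniq s -> (forall i, i \in s -> i \notin K) -> (forall i, measurable (A i)) -> measurable B ->
  P (S s @^-1` B `&` cyl K A) = P (S s @^-1` B) * P (cyl K A).
Proof.
elim: s K A B => [|a s IH] K A B.
  move=> _ _ mA mB; rewrite [S _](_ : _ = cst idx); last first.
    by apply/funext => w; rewrite /S big_nil.
  rewrite preimage_cst; case: ifP => _; first by rewrite setTI probability_setT mul1e.
  by rewrite set0I measure0 mul0e.
move=> /= /andP[as_ us] saK mA mB.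
have aK : a \notin K by apply: saK; rewrite inE eqxx.
have sK i : i \in s -> i \notin K by move=> si; apply: saK; rewrite inE si orbT.
pose Ss : {mfun T >-> R} := mfun_Sub (mem_set (measurable_fun_bigop s)).
have sa i : i \in s -> i \notin [set a]%SET.
  by move=> si; rewrite inE; apply: contraNneq as_ => <-.
have cyl1 C : cyl [set a]%SET (fun=> C) = V a @^-1` C.
  apply/seteqP; split => w; first by apply; rewrite /= inE.
  by move=> wC i /=; rewrite inE => /eqP ->.
have indepaS : independent_rv P (V a) Ss.
  move=> C D mC mD; rewrite setIC muleC -!cyl1.
  exact: IH.
pose A' C i := if i == a then C else A i.
have mA' C : measurable C -> forall i, measurable (A' C i).
  by move=> mC i; rewrite /A'; case: ifP.
have cylU C : cyl (a |: K)%SET (A' C) = V a @^-1` C `&` cyl K A.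
  apply/seteqP; split => w.
    move=> Hw; split; first by have := Hw a; rewrite /= /A' eqxx setU11; exact.
    move=> i /= iK; have := Hw i; rewrite /= /A' in_setU1 iK orbT.
    case: eqP => [ia|_]; last exact.
    by rewrite -ia iK in aK.
  move=> [wa wK] i /=; rewrite in_setU1 /A'; case: eqP => [->//|_ /=]; exact: wK.
have cylM C : measurable C -> P (V a @^-1` C `&` cyl K A) = P (V a @^-1` C) * P (cyl K A).
  move=> mC; rewrite -cylU !(indepV)//; last exact: mA'.
  rewrite big_setU1//=; congr (P _ * _); first by rewrite /A' eqxx.
  apply: eq_bigr => i iK; rewrite /A'; case: eqP => // ia.
  by rewrite -ia iK in aK.
have := @independent_pair_event _ _ _ _ _ _ _ P (V a) Ss (cyl K A)
  (cyl_measurable K mA) indepaS.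
pose C := (fun z : R * R => op z.1 z.2) @^-1` B.
move=> /(_ _ C).
have -> : (fun w => (V a w, Ss w)) @^-1` C = S (a :: s) @^-1` B.
  by apply/seteqP; split => w; rewrite /C /S/= big_cons.
apply; last by rewrite -[X in measurable X]setTI; exact: mop.
move=> C' D mC' mD.
rewrite -setIA setICA -cylU.
rewrite (IH (a |: K)%SET (A' C'))//; last 2 first.
- by move=> i si; rewrite in_setU1 negb_or sK// andbT; apply: contraNneq as_ => <-.
- exact: mA'.
by rewrite cylU cylM// muleCA muleA.
Qed.

Lemma independent_bigop a s (Ss : {mfun T >-> R}) :
  (forall w, Ss w = \big[op/idx]_(i <- s) V i w) ->
  uniq (a :: s) -> independent_rv P (V a) Ss.
Proof.
move=> SsE /= /andP[as_ us] C D mC mD.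
have cyl1 : cyl [set a]%SET (fun=> C) = V a @^-1` C.
  apply/seteqP; split => w; first by apply; rewrite /= inE.
  by move=> wC i /=; rewrite inE => /eqP ->.
have -> : Ss = S s :> (_ -> _) by apply/funext => w; rewrite SsE.
rewrite setIC muleC -cyl1; apply: independent_bigop_cylinder => //.
by move=> i si; rewrite inE; apply: contraNneq as_ => <-.
Qed.

End independent_family.

Section expectation_of_product.
Context d (T : measurableType d) (R : realType) (P : probability T R)
  (I : finType).
Variable V : I -> {mfun T >-> R}.
Hypothesis indepV : mutually_independent P V.
Local Open Scope ereal_scope.

Lemma measurable_mulR : measurable_fun [set: R * R] (fun z : R * R => z.1 * z.2)%R.
Proof. exact: measurable_funM. Qed.

Lemma measurable_addR : measurable_fun [set: R * R] (fun z : R * R => z.1 + z.2)%R.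
Proof. exact: measurable_funD. Qed.

Lemma expectation_prod (s : seq I) : uniq s -> (forall i w, (0 <= V i w)%R) ->
  \int[P]_w (\prod_(i <- s) V i w)%:E = \prod_(i <- s) \int[P]_w (V i w)%:E.
Proof.
move=> us V0; elim: s us => [|a s IH] us.
  rewrite big_nil; under eq_integral do rewrite big_nil.
  by rewrite integral_cst//= probability_setT mule1.
pose S : {mfun T >-> R} :=
  mfun_Sub (mem_set (measurable_fun_bigop 1 measurable_mulR V s)).
have S0 w : (0 <= S w)%R by rewrite /S/=; apply: prodr_ge0.
have indep : independent_rv P (V a) S.
  exact: (independent_bigop (idx := 1%R) measurable_mulR indepV).
have mabs : measurable_fun [set: R] (fun x : R => `|x|%:E).
  by apply/measurable_EFinP; exact: normr_measurable.
pose g (z : R * R) : \bar R := (`|z.1| * `|z.2|)%:E.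
have mg : measurable_fun [set: R * R] g.
  by apply/measurable_EFinP; apply: measurable_funM; apply: measurableT_comp.
transitivity (\int[P]_w g (V a w, S w)).
  apply: eq_integral => w _; rewrite /g big_cons/= [`|V a w|%R]ger0_norm//.
  by congr (_ * _)%:E; apply/esym/ger0_norm; exact: (S0 w).
have g0 z : 0 <= g z by rewrite lee_fin mulr_ge0.
rewrite (integral_independent_pair indep mg g0).
transitivity (\int[distribution P (V a)]_x
    (`|x|%:E * \int[distribution P S]_y `|y|%:E)).
  apply: eq_integral => x _ /=; rewrite -ge0_integralZl_EFin//.
rewrite ge0_integralZr//; last exact: integral_ge0.
rewrite !ge0_integral_distribution// big_cons; congr (_ * _).
  by apply: eq_integral => w _ /=; rewrite ger0_norm.
rewrite -IH; last by move: us => /= /andP[].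
by apply: eq_integral => w _ /=; rewrite ger0_norm//; exact: S0.
Qed.

End expectation_of_product.

(** * Linear combinations of isotropic Gaussian noise *)

Section gaussian_combination.
Context d (T : measurableType d) (R : realType) (P : probability T R).
Notation gamma := (@normal_prob R 0 1).
Local Open Scope ereal_scope.

Lemma integral_normal_rv (W : {mfun T >-> R}) (sigma : R) (f : R -> \bar R) :
  sigma != 0%R ->
  (forall A, measurable A -> P (W @^-1` A) = normal_prob 0 sigma A) ->
  measurable_fun [set: R] f -> (forall x, 0 <= f x) ->
  \int[P]_w f (W w) = \int[gamma]_x f (sigma * x)%R.
Proof.
move=> s0 WE mf f0.
pose w : T -> measurableTypeR R := W.
have mW : measurable_fun [set: T] w.
  by move=> _ A mA; rewrite setTI; exact: (measurable_funPTI W).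
pose W' : {mfun T >-> measurableTypeR R} := mfun_Sub (mem_set mW).
transitivity (\int[distribution P W']_x f x).
  by rewrite ge0_integral_distribution.
transitivity (\int[normal_prob 0 sigma]_x f x).
  pose Q : probability (measurableTypeR R) R := normal_prob 0 sigma.
  have E : \int[distribution P W']_x f x = \int[Q]_x f x.
    by apply: (eq_measure_integral Q) => A mA _; rewrite /= -WE.
  exact: E.
rewrite (integral_normal_affine 0 s0 mf f0).
by apply: eq_integral => x _; rewrite addr0.
Qed.

Variables (N : nat) (eps : {mfun T >-> 'cV[R]_N}) (sigma : R).
Hypothesis sigma0 : (0 < sigma)%R.
Hypothesis eps_gauss : isotropic_gaussian P sigma eps.

Lemma measurable_scaled_coordinate (u : 'I_N -> R) i :
  measurable_fun [set: T] (fun w => u i * eps w i 0)%R.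
Proof.
apply: measurable_funM => //.
exact: (measurableT_comp (measurable_mx_entry i (0%R : 'I_1)) (@measurable_funP _ _ _ _ setT eps)).
Qed.

(** Coordinates are added one at a time; each is independent of the sum of the
    previous ones, and the two Gaussian integrals merge by convolution. *)
Lemma integral_isotropic_sum (u : 'I_N -> R) (s : seq 'I_N) (f : R -> \bar R) :
  uniq s -> measurable_fun [set: R] f -> (forall x, 0 <= f x) ->
  \int[P]_w f (\sum_(i <- s) u i * eps w i 0)%R =
  \int[gamma]_x f (sigma * Num.sqrt (\sum_(i <- s) u i ^+ 2) * x)%R.
Proof.
have [indep law] := eps_gauss.
pose V i : {mfun T >-> R} := mfun_Sub (mem_set (measurable_scaled_coordinate u i)).
have indepV : mutually_independent P V.
  move=> J A mA.
  have mh i : measurable_fun [set: R] (fun x : R => u i * x)%R.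
    exact: measurable_funM.
  apply: (indep J (fun i => (fun x => u i * x)%R @^-1` A i)) => i.
  by rewrite -[X in measurable X]setTI; exact: mh.
elim: s f => [|a s IH] f us mf f0.
  transitivity (\int[P]_w f 0%R).
    by apply: eq_integral => w _; rewrite big_nil.
  transitivity (\int[gamma]_w f 0%R).
    by rewrite integral_gamma_cst integral_cst//= probability_setT mule1.
  by apply: eq_integral => w _; rewrite big_nil sqrtr0 mulr0 mul0r.
have us' : uniq s by move: us => /= /andP[].
pose S : {mfun T >-> R} :=
  mfun_Sub (mem_set (measurable_fun_bigop 0 (@measurable_addR R) V s)).
have indepS : independent_rv P (V a) S.
  exact: (independent_bigop (idx := 0%R) (@measurable_addR R) indepV).
have mfD : measurable_fun [set: R * R] (fun z : R * R => f (z.1 + z.2)%R).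
  exact: (measurableT_comp mf (@measurable_addR R)).
pose g2 (z : R * R) : \bar R := f (z.1 + z.2)%R.
transitivity (\int[P]_w g2 (V a w, S w)).
  by apply: eq_integral => w _; rewrite big_cons.
rewrite (integral_independent_pair indepS mfD (fun=> f0 _)).
pose c := (sigma * Num.sqrt (\sum_(i <- s) u i ^+ 2))%R.
transitivity (\int[distribution P (V a)]_x \int[gamma]_y f (x + c * y)%R).
  apply: eq_integral => x _.
  have mfx : measurable_fun [set: R] (fun y => f (x + y)%R).
    by apply: (measurableT_comp mf); exact: measurable_funD.
  by rewrite ge0_integral_distribution//; exact: IH us' mfx (fun=> f0 _).
pose R2 : Type := (measurableTypeR R * measurableTypeR R)%type.
have mg : measurable_fun [set: R] (fun x => \int[gamma]_y f (x + c * y)%R).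
  have mf2 : measurable_fun [set: measurableTypeR R * measurableTypeR R]
      (fun z : R2 => f (z.1 + c * z.2)%R).
    apply: (measurableT_comp mf); apply: measurable_funD => //.
    exact: measurable_funM.
  exact: (measurable_fun_fubini_tonelli_F _ mf2 (fun=> f0 _)).
have g0 x : 0 <= \int[gamma]_y f (x + c * y)%R by exact: integral_ge0.
rewrite ge0_integral_distribution//.
pose E : {mfun T >-> R} := mfun_Sub (mem_set
  (measurableT_comp (measurable_mx_entry a (0%R : 'I_1)) (@measurable_funP _ _ _ _ setT eps))).
pose g x := \int[gamma]_y f (u a * x + c * y)%R.
have mg' : measurable_fun [set: R] g.
  by apply: (measurableT_comp mg); exact: measurable_funM.
have lawE A : measurable A -> P (E @^-1` A) = normal_prob 0 sigma A.
  by move=> mA; rewrite -(law a A mA).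
transitivity (\int[P]_w g (E w)); first by [].
have sigma_neq0 : (sigma != 0)%R by rewrite gt_eqF.
rewrite (integral_normal_rv sigma_neq0 lawE mg' (fun=> g0 _)).
transitivity (\int[gamma]_x \int[gamma]_y f (u a * sigma * x + c * y)%R).
  by apply: eq_integral => x _; apply: eq_integral => y _; rewrite mulrA.
rewrite gaussian_convolution//.
have cE : ((u a * sigma) ^+ 2 + c ^+ 2 =
    sigma ^+ 2 * \sum_(i <- a :: s) u i ^+ 2)%R.
  rewrite /c !exprMn sqr_sqrtr; last by apply: sumr_ge0 => i _; exact: sqr_ge0.
  by rewrite big_cons mulrDr mulrC.
rewrite cE sqrtrM ?sqr_ge0// sqrtr_sqr.
by rewrite gtr0_norm.
Qed.

End gaussian_combination.

Section conditional_gaussian.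
Context d d1 (T : measurableType d) (U1 : measurableType d1) (R : realType)
  (P : probability T R).
Notation gamma := (@normal_prob R 0 1).
Local Open Scope ereal_scope.

(** Conditionally on X the weights are constants, so the conditional law of the
    combination is N(0, 1) whatever the value of X. *)
Lemma conditional_gaussian (N : nat) (sigma : R) (X : {mfun T >-> U1})
    (eps : {mfun T >-> 'cV[R]_N}) (u : 'I_N -> U1 -> R) (A : set R) :
  (0 < sigma)%R -> isotropic_gaussian P sigma eps -> independent_rv P X eps ->
  (forall i, measurable_fun [set: U1] (u i)) ->
  (forall x, (\sum_i u i x ^+ 2 = 1)%R) -> measurable A ->
  P ((fun w => sigma^-1 * \sum_i u i (X w) * eps w i 0)%R @^-1` A) = gamma A.
Proof.
move=> s0 gau indep mu u1 mA.
pose g (z : U1 * 'cV[R]_N) : R := (sigma^-1 * \sum_i u i z.1 * z.2 i 0)%R.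
have mg : measurable_fun [set: U1 * 'cV[R]_N] g.
  apply: measurable_funM => //; apply: measurable_sum => i.
  apply: measurable_funM; first exact: (measurableT_comp (mu i)).
  exact: (measurableT_comp (measurable_mx_entry i (0%R : 'I_1))).
have mI : measurable_fun [set: R] (\1_A : R -> R) by exact: measurable_indic.
have mAg : measurable_fun [set: U1 * 'cV[R]_N] (fun z => (\1_A (g z) : R)%:E).
  by apply/measurable_EFinP; apply: (measurableT_comp mI mg).
have mAR : measurable_fun [set: R] (fun x => (\1_A x : R)%:E).
  by apply/measurable_EFinP; exact: measurable_indic.
have mgw : measurable_fun [set: T] (fun w => g (X w, eps w)).
  exact: (measurableT_comp mg (measurable_fun_pairing X eps)).
have -> : (fun w => sigma^-1 * \sum_i u i (X w) * eps w i 0)%R @^-1` A =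
  (fun w => g (X w, eps w)) @^-1` A by [].
set B := _ @^-1` A.
have mB : measurable B by rewrite -[B]setTI; exact: mgw.
have -> : P B = \int[P]_w (\1_B w)%:E by rewrite integral_indic// setIT.
transitivity (\int[P]_w (\1_A (g (X w, eps w)) : R)%:E); first exact: eq_integral.
rewrite (@integral_independent_pair _ _ _ _ _ _ _ P X eps
  (fun z => (\1_A (g z))%:E))//.
transitivity (\int[distribution P X]_x gamma A); last first.
  by rewrite integral_cst//= probability_setT mule1.
apply: eq_integral => x _.
have mAgx : measurable_fun [set: 'cV[R]_N] (fun y => (\1_A (g (x, y)) : R)%:E).
  apply/measurable_EFinP; apply: (measurableT_comp mI).
  apply: measurable_funM => //; apply: measurable_sum => i.
  by apply: measurable_funM => //=; apply: (measurable_mx_entry i (0%R : 'I_1)).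
rewrite ge0_integral_distribution//=.
pose f y := (\1_A (sigma^-1 * y)%R : R)%:E.
have mf : measurable_fun [set: R] f.
  by apply: (measurableT_comp mAR); exact: measurable_funM.
transitivity (\int[P]_w f (\sum_(i <- index_enum 'I_N) u i x * eps w i 0)%R).
  by [].
rewrite (integral_isotropic_sum _ gau)//; last 2 first.
- exact: index_enum_uniq.
- by move=> y; rewrite lee_fin.
rewrite u1 sqrtr1 mulr1.
have -> : gamma A = \int[gamma]_x (\1_A x)%:E by rewrite integral_indic// setIT.
by apply: eq_integral => y _; rewrite /f mulKf ?gt_eqF.
Qed.

End conditional_gaussian.

(** * Squares of sub-Gaussian variables *)

Section subgaussian_square.
Context d (T : measurableType d) (R : realType) (P : probability T R).
Notation gamma := (@normal_prob R 0 1).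

(** The factor exp |x| makes the second order remainder valid for all x, which
    is what unbounded variables require. *)
Lemma expR_taylor1 (x : R) : expR x <= 1 + x + x ^+ 2 * expR `|x|.
Proof.
have [x0|x0] := leP 0 x.
  have e1 : expR x - 1 <= x * expR x.
    have := expR_ge1Dx (- x); rewrite expRN.
    have ex : 0 < expR x := expR_gt0 x.
    rewrite -(ler_pM2r ex) mulVf ?gt_eqF// => H; lra.
  rewrite ger0_norm//.
  have e2 : x * (expR x - 1) <= x * (x * expR x) by exact: ler_wpM2l.
  rewrite expr2; lra.
rewrite ltr0_norm//; have y0 : 0 < - x by lra.
have y1 : 0 < 1 - x by lra.
have e1 : expR x <= (1 - x)^-1.
  rewrite -[x]opprK expRN opprK lef_pV2 ?posrE ?expR_gt0//; first exact: expR_ge1Dx.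
have e2 : (1 - x)^-1 <= 1 + x + x ^+ 2.
  rewrite -(ler_pM2r y1) mulVf ?gt_eqF//.
  have -> : (1 + x + x ^+ 2) * (1 - x) = 1 - x ^+ 3 by ring.
  rewrite lerBrDr gerDl; have -> : x ^+ 3 = - ((- x) ^+ 3) by ring.
  by rewrite oppr_le0 exprn_ge0// ltW.
apply: (le_trans e1); apply: (le_trans e2); rewrite lerD2l ler_peMr ?sqr_ge0//.
by rewrite -expR0 ler_expR ltW.
Qed.

Lemma sqr_le_expR (x : R) : 0 <= x -> x ^+ 2 <= 8 * expR (x / 2).
Proof.
move=> x0; have x20 : 0 <= x / 2 by rewrite divr_ge0.
have := expR_ge1Dxn 1 x20; rewrite expr_div_n (_ : 2`! = 2%N)// => e.
lra.
Qed.

Variables (W : {mfun T >-> R}) (tau : R).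
Hypothesis tau0 : 0 < tau.
Hypothesis mgfW : forall t : R,
  (\int[P]_w (expR (t * W w))%:E <= (expR (tau ^+ 2 * t ^+ 2 / 2))%:E)%E.
Let t0 := 3 / (8 * tau ^+ 2).

Let t0_gt0 : 0 < t0.
Proof. by rewrite /t0 divr_gt0// mulr_gt0// exprn_gt0. Qed.

Let mW2 : measurable_fun [set: T] (fun w => W w ^+ 2).
Proof. exact: measurable_funX. Qed.

Let mexpW2 : measurable_fun [set: T] (fun w => expR (t0 * W w ^+ 2)).
Proof. by apply: measurableT_comp => //; exact: measurable_funM. Qed.

(** Gaussian linearization: exp(t0 W^2) is the expectation of exp(s g W) for a
    standard normal g and s^2 = 2 t0, and the integration over P comes first. *)
Lemma exp_square_subgaussian :
  (\int[P]_w (expR (t0 * W w ^+ 2))%:E <= 2%:E)%E.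
Proof.
pose s := Num.sqrt (2 * t0).
have s2 : s ^+ 2 = 2 * t0 by rewrite sqr_sqrtr// mulr_ge0// ltW.
pose f (z : T * measurableTypeR R) : \bar R := (expR (s * z.2 * W z.1))%:E.
have mf : measurable_fun [set: T * measurableTypeR R] f.
  apply/measurable_EFinP; apply: measurableT_comp => //.
  apply: measurable_funM; first exact: measurable_funM.
  exact: (measurableT_comp (@measurable_funP _ _ _ _ setT W)).
have f0 z : (0 <= f z)%E by rewrite lee_fin expR_ge0.
have -> : (\int[P]_w (expR (t0 * W w ^+ 2))%:E =
    \int[P]_w \int[gamma]_x f (w, x))%E.
  apply: eq_integral => w _.
  transitivity (\int[gamma]_x (expR ((s * W w) * x))%:E)%E.
    by rewrite gaussian_mgf exprMn s2; congr (expR _)%:E; field.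
  by apply: eq_integral => x _; rewrite /f/= mulrAC.
have -> : (\int[P]_w \int[gamma]_x f (w, x) =
    \int[gamma]_x \int[P]_w f (w, x))%E by exact: fubini_tonelli.
rewrite -(gaussian_exp_square R); apply: ge0_le_integral => //=.
- by move=> x _; exact: integral_ge0.
- exact: (measurable_fun_fubini_tonelli_G _ mf f0).
- apply/measurable_EFinP; apply: measurableT_comp => //.
  by apply: measurable_funM => //; exact: measurable_funX.
- move=> x _; apply: (le_trans (mgfW (s * x))).
  rewrite lee_fin exprMn s2 /t0 ler_expR le_eqVlt; apply/orP; left; apply/eqP.
  by field; rewrite gt_eqF.
Qed.

Lemma integrable_exp_square : P.-integrable setT (fun w => (expR (t0 * W w ^+ 2))%:E).
Proof.
apply/integrableP; split; first exact/measurable_EFinP.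
under eq_integral do rewrite gee0_abs ?lee_fin ?expR_ge0//.
by apply: le_lt_trans exp_square_subgaussian _; rewrite ltry.
Qed.

Variable v : R.
Hypothesis vE : (\int[P]_w (W w ^+ 2)%:E)%E = v%:E.

Lemma subgaussian_variance_ge0 : 0 <= v.
Proof. by rewrite -lee_fin -vE integral_ge0// => w _; rewrite lee_fin sqr_ge0. Qed.

(** From 1 + t0 W^2 <= exp(t0 W^2), whose expectation is at most 2. *)
Lemma subgaussian_variance_le : t0 * v <= 1.
Proof.
rewrite -lee_fin EFinM -vE -ge0_integralZl_EFin//; last 3 first.
- by move=> w _; rewrite lee_fin sqr_ge0.
- exact/measurable_EFinP.
- exact: ltW.
rewrite -(@leeD2lE _ 1%:E)//.
have -> : (1%:E + 1%:E = 2%:E :> \bar R)%E by rewrite -EFinD.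
apply: le_trans exp_square_subgaussian.
have {1}-> : (1%:E = \int[P]_w (cst 1%:E w) :> \bar R)%E.
  by rewrite integral_cst//= probability_setT mule1.
rewrite -ge0_integralD//; [|
  by move=> w _; rewrite -EFinM lee_fin mulr_ge0 ?sqr_ge0// ltW|
  by apply/measurable_EFinP; exact: measurable_funM].
apply: ge0_le_integral => //.
- by move=> w _; rewrite /= -EFinM -EFinD lee_fin addr_ge0// mulr_ge0 ?sqr_ge0// ltW.
- by apply/measurable_EFinP; apply: measurable_funD => //; exact: measurable_funM.
- exact/measurable_EFinP.
- by move=> w _; rewrite /= -EFinM -EFinD lee_fin expR_ge1Dx.
Qed.

Let A := 16 * expR 1 : R.

(** The linear term of the expansion of the exponential has mean zero, and the
    quadratic one is absorbed by exp(t0 W^2), of bounded expectation. *)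
Lemma mgf_centered_square (t : R) : `|t| <= t0 / 2 ->
  (\int[P]_w (expR (t * (W w ^+ 2 - v)))%:E <=
   (expR (A * (t / t0) ^+ 2))%:E)%E.
Proof.
move=> tt0.
have v0 := subgaussian_variance_ge0; have v1 := subgaussian_variance_le.
pose c := 8 * expR 1 * (t / t0) ^+ 2.
have c0 : 0 <= c by rewrite mulr_ge0 ?sqr_ge0// mulr_ge0// expR_ge0.
have ptw w : expR (t * (W w ^+ 2 - v)) <=
    1 + t * (W w ^+ 2 - v) + c * expR (t0 * W w ^+ 2).
  apply: (le_trans (expR_taylor1 _)); rewrite lerD2l normrM.
  set z := W w ^+ 2 - v.
  have z0 : 0 <= t0 * `|z| by rewrite mulr_ge0// ltW.
  have tz : `|t| * `|z| <= (t0 * `|z|) / 2.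
    by rewrite mulrAC ler_wpM2r.
  have zW : t0 * `|z| <= t0 * W w ^+ 2 + 1.
    have : `|z| <= W w ^+ 2 + v.
      by rewrite ler_norml /z; have := sqr_ge0 (W w); lra.
    rewrite -(ler_pM2l t0_gt0); lra.
  have -> : (t * z) ^+ 2 = (t / t0) ^+ 2 * (t0 * `|z|) ^+ 2.
    rewrite exprMn [(t / t0) ^+ 2]exprMn [(t0 * `|z|) ^+ 2]exprMn exprVn real_normK ?num_real//.
    by rewrite [RHS]mulrA divfK ?expf_neq0 ?gt_eqF.
  (* half of t0 |z| in the exponent pays for |t z|, the other half for the
     polynomial factor *)
  have H : (t0 * `|z|) ^+ 2 * expR (`|t| * `|z|) <=
      8 * expR 1 * expR (t0 * W w ^+ 2).
    apply: (@le_trans _ _ (8 * expR (t0 * `|z| / 2) * expR (t0 * `|z| / 2))).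
      apply: ler_pM; rewrite ?sqr_ge0 ?expR_ge0//; first exact: sqr_le_expR.
      by rewrite ler_expR.
    rewrite -[leLHS]mulrA -expRD -splitr -[leRHS]mulrA -expRD.
    by rewrite ler_pM2l// ler_expR addrC.
  have -> : c * expR (t0 * W w ^+ 2) =
      (t / t0) ^+ 2 * (8 * expR 1 * expR (t0 * W w ^+ 2)).
    by rewrite /c [8 * _ * _]mulrC mulrA.
  by rewrite -mulrA ler_wpM2l ?sqr_ge0.
have iW2 : P.-integrable setT (fun w => (W w ^+ 2)%:E).
  apply/integrableP; split; first exact/measurable_EFinP.
  by rewrite integral_fin_num_abs// vE.
have iexp := integrable_exp_square.
have i1 : P.-integrable setT (fun w => (1 - t * v)%:E).
  exact: finite_measure_integrable_cst.
have i2 : P.-integrable setT (fun w => t%:E * (W w ^+ 2)%:E)%E.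
  exact: integrableZl.
have i3 : P.-integrable setT (fun w => c%:E * (expR (t0 * W w ^+ 2))%:E)%E.
  exact: integrableZl.
apply: (@le_trans _ _ (\int[P]_w ((1 - t * v)%:E +
    (t%:E * (W w ^+ 2)%:E + c%:E * (expR (t0 * W w ^+ 2))%:E)))%E).
  apply: ge0_le_integral => //.
  - apply/measurable_EFinP; apply: measurableT_comp => //.
    by apply: measurable_funM => //; exact: measurable_funB.
  - apply/measurable_EFinP; apply: measurable_funD => //.
    by apply: measurable_funD; apply: measurable_funM.
  - move=> w _; rewrite -!EFinM -!EFinD lee_fin (le_trans (ptw w))//.
    by rewrite le_eqVlt; apply/orP; left; apply/eqP; ring.
rewrite integralD//; last exact: integrableD.
rewrite integralD// integral_cst//= probability_setT mule1 !integralZl// vE.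
apply: (@le_trans _ _ ((1 - t * v)%:E + (t%:E * v%:E + c%:E * 2%:E))%E).
  by rewrite leeD2l// leeD2l// lee_pmul// ?exp_square_subgaussian//
    integral_ge0// => w _; rewrite lee_fin expR_ge0.
rewrite -!EFinM -!EFinD lee_fin.
apply: le_trans (expR_ge1Dx _).
by rewrite /c /A le_eqVlt; apply/orP; left; apply/eqP; ring.
Qed.

End subgaussian_square.

Section bernstein.
Context d (T : measurableType d) (R : realType) (P : probability T R) (N : nat).
Variables (V : 'I_N -> {mfun T >-> R}) (tau v : R).
Hypothesis tau0 : 0 < tau.
Hypothesis indepV : mutually_independent P V.
Hypothesis mgfV : forall i (t : R),
  (\int[P]_w (expR (t * V i w))%:E <= (expR (tau ^+ 2 * t ^+ 2 / 2))%:E)%E.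
Hypothesis vE : forall i, (\int[P]_w (V i w ^+ 2)%:E)%E = v%:E.
Variables t0 A : R.
Hypothesis t0E : t0 = 3 / (8 * tau ^+ 2).
Hypothesis AE : A = 16 * expR 1.

Let t0_gt0 : 0 < t0.
Proof. by rewrite t0E divr_gt0// mulr_gt0// exprn_gt0. Qed.

Let A_gt0 : 0 < A.
Proof. by rewrite AE mulr_gt0// expR_gt0. Qed.

Let mcsq i : measurable_fun [set: T] (fun w => V i w ^+ 2 - v).
Proof. by apply: measurable_funB => //; exact: measurable_funX. Qed.

Let msum (e : R) : measurable_fun [set: T] (fun w => e * \sum_i (V i w ^+ 2 - v)).
Proof. by apply: measurable_funM => //; exact: measurable_sum. Qed.

(** Chernoff bound at the minimizer t = s t0^2 / (2 A) of A (t / t0)^2 - t s; the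
    bound on s keeps t in the range where the moment generating function is
    controlled.  The sign e gives both tails. *)
Lemma bernstein_one_sided (e s : R) : `|e| = 1 -> 0 < s -> s <= A / t0 ->
  (P [set w | (s * N%:R <= e * \sum_i (V i w ^+ 2 - v))%R] <=
   (expR (- (N%:R * (s ^+ 2 * t0 ^+ 2 / (4 * A)))))%:E)%E.
Proof.
move=> e1 s0 sA.
pose t := s * t0 ^+ 2 / (2 * A).
have t_gt0 : 0 < t by rewrite /t divr_gt0 ?mulr_gt0 ?exprn_gt0.
have tt0 : `|t * e| <= t0 / 2.
  rewrite normrM e1 mulr1 gtr0_norm// /t.
  rewrite ler_pdivrMr ?mulr_gt0//.
  have -> : t0 / 2 * (2 * A) = (A / t0) * t0 ^+ 2.
    by field; rewrite gt_eqF.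
  by rewrite ler_wpM2r// exprn_ge0// ltW.
pose D : {mfun T >-> R} := mfun_Sub (mem_set (msum e)).
apply: (le_trans (@chernoff _ _ _ P D t (s * N%:R) t_gt0)).
rewrite /mmt_gen_fun unlock.
have mexp i : measurable_fun [set: T] (fun w => expR (t * e * (V i w ^+ 2 - v))).
  by apply: measurableT_comp => //; exact: measurable_funM.
pose E i : {mfun T >-> R} := mfun_Sub (mem_set (mexp i)).
have indepE : mutually_independent P E.
  move=> J B mB.
  have mh : measurable_fun [set: R] (fun x : R => expR (t * e * (x ^+ 2 - v))).
    apply: measurableT_comp => //; apply: measurable_funM => //.
    by apply: measurable_funB => //; exact: measurable_funX.
  apply: (@indepV J (fun i => (fun x : R => expR (t * e * (x ^+ 2 - v))) @^-1` B i)) => i.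
  by rewrite -[X in measurable X]setTI; exact: mh.
have -> : (\int[P]_w ((expR \o t \o* D) w)%:E =
    \int[P]_w (\prod_(i <- index_enum 'I_N) E i w)%:E)%E.
  apply: eq_integral => w _ /=; congr EFin.
  by rewrite -expR_sum; congr expR; rewrite mulrC mulrA mulr_sumr.
rewrite (expectation_prod indepE)//; [|exact: index_enum_uniq|by move=> i w; exact: expR_ge0].
apply: (@le_trans _ _ ((\prod_(i < N) (expR (A * (t * e / t0) ^+ 2))%:E)
    * (expR (- (t * (s * N%:R))))%:E)%E).
  rewrite lee_pmul2r// ?lte_fin ?expR_gt0//.
  suff [] : (0 <= \prod_(i < N) \int[P]_w (E i w)%:E /\
      \prod_(i < N) \int[P]_w (E i w)%:E <=
      \prod_(i < N) (expR (A * (t * e / t0) ^+ 2))%:E)%E by [].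
  apply: (big_ind2 (fun x y : \bar R => 0 <= x /\ x <= y)%E) => //.
    by move=> a b a' b' [a0 ab] [a'0 ab']; split; [exact: mule_ge0|exact: lee_pmul].
  move=> i _; split; first by rewrite integral_ge0//= => w _; rewrite lee_fin expR_ge0.
  rewrite AE t0E; apply: (mgf_centered_square tau0 (mgfV i) (vE i)).
  by rewrite -t0E.
rewrite prodEFin -EFinM lee_fin prodr_const card_ord -expRM_natl -expRD ler_expR.
have -> : (t * e / t0) ^+ 2 = t ^+ 2 / t0 ^+ 2.
  have e2 : e ^+ 2 = 1 by rewrite -real_normK ?num_real// e1 expr1n.
  by rewrite exprMn [(t * e) ^+ 2]exprMn e2 mulr1 exprVn.
rewrite le_eqVlt; apply/orP; left; apply/eqP.
by rewrite /t; field; rewrite !gt_eqF.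
Qed.

(** Union of the two tails. *)
Lemma bernstein_two_sided (s : R) : (0 < N)%N -> 0 < s -> s <= A / t0 ->
  (P [set w | (s < `|N%:R^-1 * \sum_i V i w ^+ 2 - v|)%R] <=
   (2 * expR (- (N%:R * (s ^+ 2 * t0 ^+ 2 / (4 * A)))))%:E)%E.
Proof.
move=> N0 s0 sA; have NR : 0 < N%:R :> R by rewrite ltr0n.
pose B (e : R) := [set w | (s * N%:R <= e * \sum_i (V i w ^+ 2 - v))%R].
have mB e : measurable (B e).
  have mle : measurable_fun [set: T] (fun w => s * N%:R <= e * \sum_i (V i w ^+ 2 - v)).
    exact: measurable_fun_ler.
  by have := mle measurableT [set true] I; rewrite setTI.
have msq : measurable_fun [set: T] (fun w => N%:R^-1 * \sum_i V i w ^+ 2 - v).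
  apply: measurable_funB => //; apply: measurable_funM => //.
  by apply: measurable_sum => i; exact: measurable_funX.
apply: (@le_trans _ _ (P (B 1 `|` B (-1)))).
  apply: le_measure; rewrite ?inE.
  - have mlt : measurable_fun [set: T] (fun w => s < `|N%:R^-1 * \sum_i V i w ^+ 2 - v|).
      by apply: measurable_fun_ltr => //; exact: measurableT_comp.
    by have := mlt measurableT [set true] I; rewrite setTI.
  - exact: measurableU.
  - move=> w /=; rewrite /B/= sumrB sumr_const card_ord -[v *+ N]mulr_natl => H.
    have : s * N%:R < `|\sum_i V i w ^+ 2 - N%:R * v|.
      have -> : \sum_i V i w ^+ 2 - N%:R * v = (N%:R^-1 * \sum_i V i w ^+ 2 - v) * N%:R.
        by field; rewrite gt_eqF.
      by rewrite normrM [`|N%:R|]gtr0_norm// ltr_pM2r.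
    by move=> /ltW; rewrite ler_normr => /orP[|]; [left; rewrite mul1r|right; rewrite mulN1r].
apply: (le_trans (measureU2 _ _ _)) => //.
rewrite mulr2n mulrDl mul1r EFinD; apply: leeD.
  by apply: bernstein_one_sided => //; rewrite normr1.
by apply: bernstein_one_sided => //; rewrite normrN1.
Qed.

End bernstein.

(** * Deviations of the sample covariance *)

Definition bform (R : realType) (n : nat) (M : 'M[R]_n) (a b : 'cV[R]_n) : R :=
  (a^T *m M *m b) 0 0.

Section bform_theory.
Context (R : realType) (n : nat).
Implicit Types (M : 'M[R]_n) (a b : 'cV[R]_n).

Lemma bformE M a b : bform M a b = \sum_l \sum_l' a l 0 * b l' 0 * M l l'.
Proof.
rewrite /bform -mulmxA mxE; apply: eq_bigr => l _.
rewrite mxE mxE mulr_sumr; apply: eq_bigr => l' _.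
by rewrite mulrA mulrAC.
Qed.

Lemma bform_gram N (X : 'M[R]_(N, n)) a b :
  bform (gram X) a b = N%:R^-1 * \sum_i (X *m a) i 0 * (X *m b) i 0.
Proof.
rewrite /bform /gram -scalemxAr -scalemxAl mxE; congr (_ * _).
rewrite !mulmxA -trmx_mul -mulmxA mxE.
by apply: eq_bigr => i _; rewrite mxE.
Qed.

End bform_theory.

Section design.
Context d (T : measurableType d) (R : realType) (P : probability T R).
Variables (N n : nat) (sigma : R) (Sigma : 'M[R]_n).
Variables (X : {RV P >-> 'M[R]_(N, n)}).
Hypothesis sigma0 : 0 < sigma.
Hypothesis HX : rowwise_sub_gaussian P sigma Sigma X.

Lemma measurable_design_entry i l : measurable_fun [set: T] (fun w => X w i l).
Proof.
exact: (measurableT_comp (measurable_mx_entry i l) (@measurable_funP _ _ _ _ setT X)).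
Qed.

Lemma measurable_design_apply (b : 'cV[R]_n) i :
  measurable_fun [set: T] (fun w => (X w *m b) i 0).
Proof.
under eq_fun do rewrite mxE.
apply: measurable_sum => l; apply: measurable_funM => //.
exact: measurable_design_entry.
Qed.

Let V b i : {mfun T >-> R} := mfun_Sub (mem_set (measurable_design_apply b i)).

Let indepV b : mutually_independent P (V b).
Proof.
have [indep _ _] := HX => J A mA.
have mh : measurable_fun [set: 'rV[R]_n] (fun x : 'rV[R]_n => \sum_l x 0 l * b l 0).
  by apply: measurable_sum => l; apply: measurable_funM => //; exact: measurable_mx_entry.
pose A' i := (fun x : 'rV[R]_n => \sum_l x 0 l * b l 0) @^-1` A i.
have mA' i : measurable (A' i).
  by rewrite -[X in measurable X]setTI; exact: mh.
have E i : V b i @^-1` A i = (fun w => row i (X w)) @^-1` A' i.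
  have VE w : V b i w = \sum_l row i (X w) 0 l * b l 0.
    transitivity ((X w *m b) i 0); first by [].
    by rewrite mxE; apply: eq_bigr => l _; rewrite mxE.
  by apply/seteqP; split => w; rewrite /A' /preimage /mkset VE.
under eq_bigcapr do rewrite E.
under [in RHS]eq_bigr do rewrite E.
exact: (indep J A').
Qed.

(* The bound is uniform over the ball of radius B; at b = 0 there is no unit
   direction and the variable vanishes. *)
Let mgfV b B i t : 0 < B -> sqnorm2 b <= B ^+ 2 ->
  (\int[P]_w (expR (t * V b i w))%:E <=
   (expR ((sigma * B) ^+ 2 * t ^+ 2 / 2))%:E)%E.
Proof.
move=> B0 bB; have [_ _ /(_ i)[[_ sub] _]] := HX.
pose r := Num.sqrt (sqnorm2 b).
have q0 : 0 <= sqnorm2 b by apply: sumr_ge0 => l _; exact: sqr_ge0.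
have r2 : r ^+ 2 = sqnorm2 b by rewrite sqr_sqrtr.
have [r0|r0] := eqVneq r 0.
  have b0 l : b l 0 = 0.
    have /eqP : sqnorm2 b = 0 by rewrite -r2 r0 expr0n.
    rewrite psumr_eq0 => [/allP/(_ l)|j _]; last exact: sqr_ge0.
    by rewrite mem_index_enum sqrf_eq0 => /(_ isT)/eqP.
  under eq_integral => w _.
    have -> : V b i w = (X w *m b) i 0 by [].
    rewrite mxE big1 ?mulr0 => [|l _]; last by rewrite b0 mulr0.
    over.
  rewrite integral_cst//= probability_setT mule1 lee_fin ler_expR.
  by rewrite mulr_ge0// mulr_ge0 ?sqr_ge0.
pose u : 'rV[R]_n := \row_l (b l 0 / r).
have u1 : \sum_l u 0 l ^+ 2 = 1.
  under eq_bigr do rewrite mxE expr_div_n.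
  by rewrite -mulr_suml -/(sqnorm2 b) -r2 divff// expf_neq0.
have [_ /(_ (t * r))] := sub u u1.
rewrite /mmt_gen_fun unlock => H.
apply: (@le_trans _ _ (expR (sigma ^+ 2 * (t * r) ^+ 2 / 2))%:E).
  apply: le_trans H; rewrite le_eqVlt; apply/orP; left; apply/eqP.
  apply: eq_integral => w _ /=; congr (expR _)%:E.
  rewrite mxE mulrC [RHS]mulrC -mulrA [LHS]mulrC; congr (_ * _).
  rewrite mulr_sumr; apply: eq_bigr => l _; rewrite !mxE.
  by rewrite mulrA [r * _]mulrC divfK// mulrC.
rewrite lee_fin ler_expR ler_pM2r ?invr_gt0// !exprMn r2 [t ^+ 2 * _]mulrC mulrA.
by rewrite ler_wpM2r ?sqr_ge0// ler_wpM2l ?sqr_ge0.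
Qed.

Lemma design_moment i l l' :
  P.-integrable setT (fun w => (X w i l * X w i l')%:E) /\
  (\int[P]_w (X w i l * X w i l')%:E = (Sigma l l')%:E)%E.
Proof.
have [_ _ /(_ i)[[E0 _] /(_ l l')]] := HX.
rewrite unlock !E0 /= => H.
have HE : (\int[P]_w (X w i l * X w i l')%:E = (Sigma l l')%:E)%E.
  rewrite -H unlock; apply: eq_integral => w _ /=.
  by rewrite mulrfctE /= !mxE !subr0.
split => //; have mXX : measurable_fun [set: T] (fun w => X w i l * X w i l').
  by apply: measurable_funM; exact: measurable_design_entry.
apply/integrableP; split; first exact/measurable_EFinP.
by rewrite integral_fin_num_abs// HE.
Qed.

Lemma design_second_moment b i :
  (\int[P]_w ((X w *m b) i 0 ^+ 2)%:E = (bform Sigma b b)%:E)%E.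
Proof.
transitivity (\int[P]_w \sum_l \sum_l'
    ((b l 0 * b l' 0)%:E * (X w i l * X w i l')%:E))%E.
  apply: eq_integral => w _.
  under eq_bigr do rewrite sumEFin.
  rewrite sumEFin; congr EFin; rewrite mxE expr2 mulr_suml.
  apply: eq_bigr => l _; rewrite mulr_sumr; apply: eq_bigr => l' _.
  by rewrite mulrACA mulrC.
have I1 l l' : P.-integrable setT
    (fun w => (b l 0 * b l' 0)%:E * (X w i l * X w i l')%:E)%E.
  by apply: integrableZl => //; exact: (design_moment i l l').1.
rewrite integral_sum//; last by move=> l; apply: integrable_sum => // l' _; exact: I1.
rewrite bformE -sumEFin; apply: eq_bigr => l _.
rewrite integral_sum// -sumEFin; apply: eq_bigr => l' _.
have [i1 i2] := design_moment i l l'.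
by rewrite integralZl// i2.
Qed.

Lemma design_variance_le b B (i0 : 'I_N) : 0 < B -> sqnorm2 b <= B ^+ 2 ->
  3 / (8 * (sigma * B) ^+ 2) * bform Sigma b b <= 1.
Proof.
move=> B0 bB.
exact: (subgaussian_variance_le (mulr_gt0 sigma0 B0)
  (fun t => mgfV i0 t B0 bB) (design_second_moment b i0)).
Qed.

(** The rows of X applied to b are independent sub-Gaussian variables with
    parameter sigma |b| and second moment the value of the form Sigma at b. *)
Lemma design_concentration b B t0 A s : 0 < B -> sqnorm2 b <= B ^+ 2 ->
  t0 = 3 / (8 * (sigma * B) ^+ 2) -> A = 16 * expR 1 ->
  (0 < N)%N -> 0 < s -> s <= A / t0 ->
  (P [set w | (s < `|bform (gram (X w)) b b - bform Sigma b b|)%R] <=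
   (2 * expR (- (N%:R * (s ^+ 2 * t0 ^+ 2 / (4 * A)))))%:E)%E.
Proof.
move=> B0 bB t0E AE N0 s0 sA.
have := bernstein_two_sided (mulr_gt0 sigma0 B0) (indepV b)
  (fun i t => mgfV i t B0 bB) (design_second_moment b) t0E AE N0 s0 sA.
apply: le_trans; rewrite le_eqVlt; apply/orP; left; apply/eqP; congr (P _).
have E w : bform (gram (X w)) b b = N%:R^-1 * \sum_i V b i w ^+ 2.
  by rewrite bform_gram; congr (_ * _); apply: eq_bigr => i _; rewrite expr2.
by apply: eq_set => w; rewrite E.
Qed.

End design.

(** * Norms and the graph difference operator *)

Section vectors.
Context (R : realType).

Definition dot (q : nat) (a b : 'cV[R]_q) : R := \sum_i a i 0 * b i 0.

Variable q : nat.
Implicit Types (a b x h : 'cV[R]_q).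

Lemma dotC a b : dot a b = dot b a.
Proof. by apply: eq_bigr => i _; rewrite mulrC. Qed.

Lemma dotaa a : dot a a = sqnorm2 a.
Proof. by apply: eq_bigr => i _; rewrite expr2. Qed.

Lemma sqnorm2_ge0 a : 0 <= sqnorm2 a.
Proof. by apply: sumr_ge0 => i _; exact: sqr_ge0. Qed.

Lemma sqnorm2_eq0 a i : sqnorm2 a = 0 -> a i 0 = 0.
Proof.
move=> /eqP; rewrite psumr_eq0 => [/allP/(_ i)|j _]; last exact: sqr_ge0.
by rewrite mem_index_enum sqrf_eq0 => /(_ isT)/eqP.
Qed.

Lemma sqnorm2B a b : sqnorm2 (a - b) = sqnorm2 a - 2 * dot a b + sqnorm2 b.
Proof.
rewrite /sqnorm2 /dot mulr_sumr -sumrB -big_split; apply: eq_bigr => i _ /=.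
by rewrite !mxE; ring.
Qed.

Lemma sqnorm2Z (r : R) a : sqnorm2 (r *: a) = r ^+ 2 * sqnorm2 a.
Proof. by rewrite mulr_sumr; apply: eq_bigr => i _; rewrite mxE exprMn. Qed.

Lemma dotZZ (r s : R) a b : dot (r *: a) (s *: b) = r * s * dot a b.
Proof. by rewrite mulr_sumr; apply: eq_bigr => i _; rewrite !mxE mulrACA. Qed.

(** Expand the square of |b|^2 a - <a, b> b. *)
Lemma cauchy_schwarz a b : dot a b ^+ 2 <= sqnorm2 a * sqnorm2 b.
Proof.
have [b0|b0] := eqVneq (sqnorm2 b) 0.
  have -> : dot a b = 0.
    by rewrite /dot big1// => i _; rewrite (sqnorm2_eq0 i b0) mulr0.
  by rewrite b0 mulr0 expr0n.
have bp : 0 < sqnorm2 b by rewrite lt_def b0 sqnorm2_ge0.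
have := sqnorm2_ge0 (sqnorm2 b *: a - dot a b *: b).
rewrite sqnorm2B !sqnorm2Z dotZZ => H.
have : 0 <= sqnorm2 b * (sqnorm2 a * sqnorm2 b - dot a b ^+ 2).
  by apply: le_trans H _; rewrite le_eqVlt; apply/orP; left; apply/eqP; ring.
by rewrite pmulr_rge0// subr_ge0.
Qed.

Lemma sum_abs_le_sqrt (S : {set 'I_q}) (m : R) h : #|S|%:R <= m ->
  \sum_(i in S) `|h i 0| <= Num.sqrt (m * sqnorm2 h).
Proof.
move=> Sm; have s0 : 0 <= \sum_(i in S) `|h i 0| by exact: sumr_ge0.
rewrite -[leLHS]ger0_norm// -sqrtr_sqr ler_sqrt; last first.
  by rewrite mulr_ge0 ?sqnorm2_ge0// (le_trans _ Sm).
pose a : 'cV[R]_q := \col_i (i \in S)%:R.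
pose b : 'cV[R]_q := \col_i `|h i 0|.
have -> : \sum_(i in S) `|h i 0| = dot a b.
  rewrite big_mkcond; apply: eq_bigr => i _; rewrite !mxE.
  by case: (i \in S); rewrite ?mul1r ?mul0r.
apply: (le_trans (cauchy_schwarz a b)).
have -> : sqnorm2 b = sqnorm2 h.
  by apply: eq_bigr => i _; rewrite mxE real_normK ?num_real.
rewrite ler_wpM2r ?sqnorm2_ge0//; apply: le_trans Sm.
rewrite /sqnorm2 -sum1_card natr_sum [leRHS]big_mkcond/=.
apply: ler_sum => i _; rewrite mxE.
by case: (i \in S); rewrite ?expr1n ?expr0n.
Qed.

Lemma norm1_ge0 a : 0 <= norm1 a.
Proof. exact: sumr_ge0. Qed.

Lemma norm1_le_sqrt a : norm1 a <= Num.sqrt (q%:R * sqnorm2 a).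
Proof.
rewrite /norm1 (eq_bigl (fun i => i \in [set: 'I_q]%SET)); last by move=> i; rewrite inE.
by apply: sum_abs_le_sqrt; rewrite cardsT card_ord.
Qed.

Lemma dot_le_norm1 (t : R) a b : (forall i, `|a i 0| <= t) -> `|dot a b| <= t * norm1 b.
Proof.
move=> at_; apply: (le_trans (ler_norm_sum _ _ _)).
by rewrite mulr_sumr; apply: ler_sum => i _; rewrite normrM ler_wpM2r.
Qed.

Lemma norm1_sub_le x h : norm1 x - norm1 (x + h) <= norm1 h.
Proof.
rewrite lerBlDr /norm1 -big_split/=; apply: ler_sum => i _; rewrite mxE.
have := ler_normB (x i 0 + h i 0) (h i 0); rewrite addrK; lra.
Qed.

(** Off the support of x the perturbed vector is h itself, so passing from x to
    x + h adds all of |h| there and loses at most |h| on the support. *)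
Lemma norm1_sub_sparse x h : norm1 x - norm1 (x + h) <=
  2 * \sum_(i in [set i | x i 0 != 0]%SET) `|h i 0| - norm1 h.
Proof.
rewrite /norm1 [X in 2 * X]big_mkcond mulr_sumr -!sumrB; apply: ler_sum => i _.
rewrite mxE inE; have [->|x0] := eqVneq (x i 0) 0 => /=.
  by rewrite add0r normr0; lra.
have := ler_normB (x i 0 + h i 0) (h i 0); rewrite addrK; lra.
Qed.

End vectors.

Section matrices.
Context (R : realType).

Lemma dot_mulmx (p q : nat) (A : 'M[R]_(p, q)) (z : 'cV[R]_p) (b : 'cV[R]_q) :
  dot z (A *m b) = dot (A^T *m z) b.
Proof.
rewrite /dot; under eq_bigr do rewrite mxE mulr_sumr.
rewrite exchange_big/=; apply: eq_bigr => j _; rewrite mxE mulr_suml.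
by apply: eq_bigr => i _; rewrite mxE mulrA [z i 0 * _]mulrC.
Qed.

(** If y = A^T z then |y|^4 = <z, A y>^2 <= |z|^2 |A y|^2. *)
Lemma opnorm_tr (p q : nat) (A : 'M[R]_(p, q)) (c : R) : 0 <= c ->
  (forall b, sqnorm2 (A *m b) <= c * sqnorm2 b) ->
  forall z, sqnorm2 (A^T *m z) <= c * sqnorm2 z.
Proof.
move=> c0 H z; set y := A^T *m z.
have [->|y0] := eqVneq (sqnorm2 y) 0; first by rewrite mulr_ge0 ?sqnorm2_ge0.
have yp : 0 < sqnorm2 y by rewrite lt_def y0 sqnorm2_ge0.
rewrite -(ler_pM2r yp) -expr2 -{1}dotaa {1}/y -dot_mulmx.
apply: (le_trans (cauchy_schwarz _ _)).
by rewrite mulrAC mulrC ler_wpM2r ?sqnorm2_ge0.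
Qed.

End matrices.

Lemma card_mkset (I : finType) (Q : pred I) :
  #|[set i | Q i]%classic| = #|[set i | Q i]%SET|.
Proof.
by apply: eq_card => i; rewrite inE; apply/idP/idP => [/set_mem|Qi]//; exact: mem_set.
Qed.

Section graph_operator.
Context (R : realType) (n : nat) (G : sgraph n).

Lemma incidence_apply (b : 'cV[R]_n) r :
  (incidence R G *m b) r 0 = b (enum_val r).2 0 - b (enum_val r).1 0.
Proof.
have : enum_val r \in edges G by exact: enum_valP.
rewrite inE => /andP[lt12 _].
have ne : (enum_val r).2 != (enum_val r).1 by rewrite eq_sym -val_eqE/= ltn_eqF.
rewrite mxE (bigD1 (enum_val r).1)//= (bigD1 (enum_val r).2)//=.
have incE v : incidence R G r v = if v == (enum_val r).1 then -1
                 else if v == (enum_val r).2 then 1 else 0 by rewrite mxE.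
rewrite big1 => [|v /andP[v1 v2]]; last first.
  by rewrite incE (negbTE v1) (negbTE v2) mul0r.
by rewrite !incE !eqxx (negbTE ne) mulN1r mul1r addr0 addrC.
Qed.

(** (b_j - b_i)^2 <= 2 (b_i^2 + b_j^2), and vertex i occurs in deg(i) edges. *)
Lemma incidence_opnorm (b : 'cV[R]_n) :
  sqnorm2 (incidence R G *m b) <= 2 * (max_degree G)%:R * sqnorm2 b.
Proof.
rewrite /sqnorm2; under eq_bigr do rewrite incidence_apply.
rewrite -(big_enum_val (fun e : 'I_n * 'I_n => (b e.2 0 - b e.1 0) ^+ 2))/=.
apply: (@le_trans _ _ (\sum_(e in edges G) (2 * (b e.1 0 ^+ 2 + b e.2 0 ^+ 2)))).
  apply: ler_sum => e _; move: (b e.1 0) (b e.2 0) => x y.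
  by rewrite -subr_ge0 (_ : _ - _ = (x + y) ^+ 2) ?sqr_ge0//; ring.
rewrite -mulr_sumr -mulrA ler_pM2l//.
have -> : \sum_(e in edges G) (b e.1 0 ^+ 2 + b e.2 0 ^+ 2) =
    \sum_(i < n) \sum_(j < n | (i < j)%N && G i j) (b i 0 ^+ 2 + b j 0 ^+ 2).
  rewrite (eq_bigl (fun e : 'I_n * 'I_n => true && ((e.1 < e.2)%N && G e.1 e.2))).
    by rewrite -(pair_big_dep xpredT (fun i j : 'I_n => (i < j)%N && G i j)
      (fun i j => b i 0 ^+ 2 + b j 0 ^+ 2)).
  by move=> e; rewrite inE.
have -> : \sum_(i < n) \sum_(j < n | (i < j)%N && G i j) (b i 0 ^+ 2 + b j 0 ^+ 2) =
    \sum_(i < n) \sum_(j < n | (i < j)%N && G i j) b i 0 ^+ 2 +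
    \sum_(i < n) \sum_(j < n | (i < j)%N && G i j) b j 0 ^+ 2.
  by rewrite -big_split; apply: eq_bigr => i _; rewrite big_split.
rewrite [X in _ + X](exchange_big_dep xpredT)//= -big_split/= /sqnorm2.
rewrite mulr_sumr; apply: ler_sum => i _.
rewrite !sumr_const -mulrnDr -[leLHS]mulr_natl ler_wpM2r ?sqr_ge0// ler_nat.
apply: (@leq_trans #|[set j | G i j]%SET|); last first.
  rewrite -card_mkset.
  exact: (leq_bigmax (F := fun i : 'I_n => #|[set j | G i j]%classic|) i).
rewrite -cardUI [X in (_ + X)%N]eq_card0 ?addn0; last first.
  move=> j; rewrite !inE; apply/negbTE/negP => /andP[/andP[ij _] /andP[ji _]].
  by have := ltn_trans ij ji; rewrite ltnn.
apply: subset_leq_card; apply/fintype.subsetP => j; rewrite !inE.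
by move=> /orP[/andP[_ //]|/andP[_]]; rewrite adj_sym.
Qed.

(** Stated for an abstract parity and operator: the step of the recursion is a
    dependent match on the parity, which cannot be destructed in place. *)
Lemma graph_diff_step (odd_k : bool)
    (D : 'M[R]_(if odd_k then n else #|edges G|, n)) (b : 'cV[R]_n) :
  sqnorm2 ((if odd_k as o return 'M[R]_(if o then n else #|edges G|, n) ->
                                 'M[R]_(if ~~ o then n else #|edges G|, n)
            then fun D => incidence R G *m D
            else fun D => (incidence R G)^T *m D) D *m b) <=
  2 * (max_degree G)%:R * sqnorm2 (D *m b).
Proof.
case: odd_k D => D /=; rewrite -mulmxA; first exact: incidence_opnorm.
by apply: opnorm_tr incidence_opnorm _; rewrite mulr_ge0.
Qed.

Lemma graph_diff_opnorm k (b : 'cV[R]_n) :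
  sqnorm2 (graph_diff R G k *m b) <= (2 * (max_degree G)%:R) ^+ k.+1 * sqnorm2 b.
Proof.
elim: k => [|k IH]; first by rewrite expr1; exact: incidence_opnorm.
apply: (le_trans (graph_diff_step (graph_diff R G k) b)).
by rewrite exprS -[leRHS]mulrA ler_wpM2l// mulr_ge0.
Qed.

End graph_operator.

(** * Deterministic bounds for the Lasso error *)

Section lasso.
Context (R : realType) (N n k : nat) (G : sgraph n).
Variables (nu lambda lambda_g : R) (X : 'M[R]_(N, n)) (beta h : 'cV[R]_n)
  (eps : 'cV[R]_N).
Hypothesis N0 : (0 < N)%N.
Hypothesis nu0 : 0 <= nu.
Hypothesis lambda0 : 0 < lambda.
Hypothesis lambda_gE : lambda_g = lambda * Num.sqrt (nu / (2 * (max_degree G)%:R) ^+ k.+1).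
Hypothesis argminP : is_argmin setT
  (lasso_objective G k lambda_g lambda (X *m beta + eps) X) (beta + h).
Notation D := (graph_diff R G k).

Lemma bform_gram_sqnorm2 (b : 'cV[R]_n) :
  bform (gram X) b b = N%:R^-1 * sqnorm2 (X *m b).
Proof.
by rewrite bform_gram; congr (_ * _); apply: eq_bigr => i _; rewrite expr2.
Qed.

(** Compare the objective at its minimizer beta + h and at beta. *)
Lemma lasso_basic_inequality :
  2^-1 * bform (gram X) h h <= N%:R^-1 * dot (X^T *m eps) h +
    lambda_g * (norm1 (D *m beta) - norm1 (D *m beta + D *m h)) +
    lambda * (norm1 beta - norm1 (beta + h)).
Proof.
have [_ /(_ beta Logic.I)] := argminP.
have e1 : X *m beta + eps - X *m (beta + h) = eps - X *m h.
  by rewrite mulmxDr opprD addrACA subrr add0r.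
have e2 : X *m beta + eps - X *m beta = eps by rewrite addrAC subrr add0r.
rewrite /lasso_objective e1 e2 sqnorm2B mulmxDr.
rewrite bform_gram_sqnorm2 -dot_mulmx.
have NR : N%:R != 0 :> R by rewrite pnatr_eq0 -lt0n.
move: (sqnorm2 eps) (dot eps _) (sqnorm2 (X *m h)) (norm1 _) (norm1 _) (norm1 _) (norm1 _).
move=> a b q x1 x2 x3 x4 H.
have : (2 * N%:R)^-1 * (a - 2 * b + q) = (2 * N%:R)^-1 * a - N%:R^-1 * b + 2^-1 * (N%:R^-1 * q).
  by field.
move=> H'; rewrite H' in H; lra.
Qed.

(** The tuning of lambda_g compensates the operator norm of D. *)
Lemma graph_penalty_le (S : {set 'I_(diff_dim G k)}) (m : R) : #|S|%:R <= m ->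
  lambda_g * \sum_(i in S) `|(D *m h) i 0| <=
  lambda * Num.sqrt (m * nu * sqnorm2 h).
Proof.
move=> Sm; have m0 : 0 <= m by rewrite (le_trans _ Sm).
rewrite lambda_gE -mulrA ler_pM2l//.
set x := (2 * _) ^+ _.
have x0 : 0 <= x by rewrite exprn_ge0// mulr_ge0.
apply: (@le_trans _ _ (Num.sqrt (nu / x) * Num.sqrt (m * (x * sqnorm2 h)))).
  rewrite ler_wpM2l ?sqrtr_ge0//; apply: (le_trans (sum_abs_le_sqrt _ Sm)).
  by rewrite ler_wsqrtr// ler_wpM2l// graph_diff_opnorm.
rewrite -sqrtrM ?divr_ge0// ler_wsqrtr//.
have [->|xn0] := eqVneq x 0.
  by rewrite invr0 mulr0 mul0r mulr_ge0 ?sqnorm2_ge0// mulr_ge0.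
by rewrite le_eqVlt; apply/orP; left; apply/eqP; field.
Qed.

Lemma noise_le (t : R) : (forall l, `|(X^T *m eps) l 0| <= N%:R * t) ->
  N%:R^-1 * dot (X^T *m eps) h <= t * norm1 h.
Proof.
move=> Ht; have NR : 0 < N%:R :> R by rewrite ltr0n.
rewrite ler_pdivrMl// mulrA; apply: (le_trans (ler_norm _)).
exact: dot_le_norm1.
Qed.

(** When the noise is at most lambda / 2, half of the term lambda |h|_1 survives
    on the left; both penalties lose at most 2 lambda sqrt(s2) |h|_2, the graph
    one because it sees at most s1 rows, and nu s1 <= s2. *)
Lemma lasso_cone (s1 s2 : R) : 0 < s1 -> 0 < s2 -> nu <= s2 / s1 ->
  param_space G k s1 s2 beta ->
  (forall l, `|(X^T *m eps) l 0| <= N%:R * (lambda / 2)) ->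
  bform (gram X) h h + lambda * norm1 h <=
  8 * (lambda * Num.sqrt (s2 * sqnorm2 h)).
Proof.
move=> s10 s20 nus [b1 b2] Ht.
have := lasso_basic_inequality; have := noise_le Ht.
set q := Num.sqrt _.
have P1 : lambda_g * (norm1 (D *m beta) - norm1 (D *m beta + D *m h)) <=
    2 * (lambda * q).
  have lg0 : 0 <= lambda_g by rewrite lambda_gE mulr_ge0 ?sqrtr_ge0// ltW.
  apply: (@le_trans _ _ (lambda_g *
    (2 * \sum_(i in [set i | (D *m beta) i 0 != 0]%SET) `|(D *m h) i 0|))).
    rewrite ler_wpM2l//; apply: (le_trans (norm1_sub_sparse _ _)).
    by rewrite gerBl norm1_ge0.
  rewrite mulrCA ler_pM2l//.
  have cS : #|[set i | (D *m beta) i 0 != 0]%SET|%:R <= s1.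
    by move: b1; rewrite /norm0 card_mkset.
  apply: (le_trans (graph_penalty_le cS)); rewrite ler_pM2l// ler_wsqrtr//.
  by rewrite ler_wpM2r ?sqnorm2_ge0// mulrC -ler_pdivlMr.
have P2 : lambda * (norm1 beta - norm1 (beta + h)) <=
    lambda * (2 * q - norm1 h).
  rewrite ler_pM2l//; apply: (le_trans (norm1_sub_sparse _ _)).
  rewrite lerD2r ler_pM2l//; apply: sum_abs_le_sqrt.
  by move: b2; rewrite /norm0 card_mkset.
move: P1 P2; lra.
Qed.

Variables (c tau : R) (Sigma : 'M[R]_n).
Hypothesis c0 : 0 < c.
Hypothesis Sigma_ge : forall b, c * sqnorm2 b <= bform Sigma b b.
Hypothesis gram_near : forall l l', `|gram X l l' - Sigma l l'| <= tau.

Lemma restricted_eigenvalue b :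
  c * sqnorm2 b - tau * norm1 b ^+ 2 <= bform (gram X) b b.
Proof.
have : `|bform (gram X) b b - bform Sigma b b| <= tau * norm1 b ^+ 2.
  rewrite !bformE -sumrB expr2 /norm1 mulr_suml mulr_sumr.
  apply: (le_trans (ler_norm_sum _ _ _)); apply: ler_sum => l _.
  rewrite -sumrB mulr_sumr mulr_sumr.
  apply: (le_trans (ler_norm_sum _ _ _)); apply: ler_sum => l' _.
  rewrite -mulrBr normrM normrM [leRHS]mulrC ler_wpM2l// mulr_ge0//.
by have := Sigma_ge b; rewrite ler_norml => ? /andP[? ?]; lra.
Qed.

Let r := Num.sqrt (sqnorm2 h).
Let r0 : 0 <= r. Proof. exact: sqrtr_ge0. Qed.
Let r2 : r ^+ 2 = sqnorm2 h. Proof. by rewrite sqr_sqrtr// sqnorm2_ge0. Qed.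

(** The cone bound gives |h|_1 <= 8 sqrt(s2) |h|_2, so that the defect
    tau |h|_1^2 of the restricted eigenvalue is at most half of c |h|_2^2. *)
Lemma lasso_l1_sparse (s1 s2 : R) : 0 < s1 -> 0 < s2 -> nu <= s2 / s1 ->
  param_space G k s1 s2 beta ->
  (forall l, `|(X^T *m eps) l 0| <= N%:R * (lambda / 2)) ->
  0 <= tau -> 128 * (s2 * tau) <= c ->
  norm1 h <= 128 / c * (lambda * s2).
Proof.
move=> s10 s20 nus bS Ht tau0 small.
have := lasso_cone s10 s20 nus bS Ht; rewrite sqrtrM; last exact: ltW.
rewrite -/r.
set q := Num.sqrt s2.
have q0 : 0 <= q by exact: sqrtr_ge0.
have q2 : q ^+ 2 = s2 by rewrite sqr_sqrtr// ltW.
have := restricted_eigenvalue h; rewrite -r2.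
set Q := bform _ _ _; set m := norm1 h => RE cone.
have m0 : 0 <= m by exact: norm1_ge0.
have Q0 : 0 <= Q.
  by rewrite /Q bform_gram_sqnorm2 mulr_ge0 ?sqnorm2_ge0// invr_ge0.
have mle : m <= 8 * (q * r).
  by rewrite -(ler_pM2l lambda0); lra.
have m2 : tau * m ^+ 2 <= c / 2 * r ^+ 2.
  apply: (@le_trans _ _ (tau * (8 * (q * r)) ^+ 2)).
    by rewrite ler_wpM2l// ler_sqr ?nnegrE ?mulr_ge0.
  have -> : tau * (8 * (q * r)) ^+ 2 = 64 * (s2 * tau) * r ^+ 2.
    by rewrite -q2; ring.
  by rewrite ler_wpM2r ?sqr_ge0//; lra.
have Qle : Q <= 8 * (lambda * (q * r)).
  have := mulr_ge0 (ltW lambda0) m0; lra.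
have rle : c * r <= 16 * (lambda * q).
  have [r00|rn0] := eqVneq r 0.
    by rewrite r00 mulr0 mulr_ge0// mulr_ge0// ltW.
  have rp : 0 < r by rewrite lt_def rn0 r0.
  rewrite -(ler_pM2r rp).
  have -> : c * r * r = c * r ^+ 2 by ring.
  have -> : 16 * (lambda * q) * r = 16 * (lambda * (q * r)) by ring.
  lra.
apply: (le_trans mle).
have -> : 128 / c * (lambda * s2) = (8 * q) * (16 * (lambda * q) / c).
  by rewrite -q2; field; rewrite gt_eqF.
rewrite [8 * (q * r)]mulrA ler_wpM2l ?mulr_ge0// ler_pdivlMr// mulrC//.
Qed.

(** A bound for noise of any level K lambda, where no term in |h|_1 survives on
    the left.  All n coordinates of h and all rows of the difference operator
    are counted; there are at most n^2 of the latter. *)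
Lemma lasso_l1_dense (K : R) : nu <= 1 -> 0 <= K -> (0 < n)%N ->
  (forall l, `|(X^T *m eps) l 0| <= N%:R * (K * lambda)) ->
  0 <= tau -> 2 * (n%:R * tau) <= c ->
  norm1 h <= 4 * (K + 2) / c * n%:R ^+ 2 * lambda.
Proof.
move=> nu1 K0 n0 Ht tau0 small.
have := lasso_basic_inequality; have := noise_le Ht.
have n1 : 1 <= n%:R :> R by rewrite ler1n.
have nge0 : 0 <= n%:R :> R by [].
have P1 : lambda_g * (norm1 (D *m beta) - norm1 (D *m beta + D *m h)) <=
    lambda * (n%:R * r).
  have lg0 : 0 <= lambda_g by rewrite lambda_gE mulr_ge0 ?sqrtr_ge0// ltW.
  apply: (@le_trans _ _ (lambda_g *
      \sum_(i in [set: 'I_(diff_dim G k)]%SET) `|(D *m h) i 0|)).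
    rewrite ler_wpM2l//; apply: (le_trans (norm1_sub_le _ _)).
    by rewrite /norm1 le_eqVlt; apply/orP; left; apply/eqP; apply: eq_bigl => i; rewrite inE.
  have cS : #|[set: 'I_(diff_dim G k)]%SET|%:R <= n%:R ^+ 2 :> R.
    rewrite cardsT card_ord -natrX ler_nat /diff_dim; case: ifP => _.
      by rewrite -mulnn leq_pmull.
    apply: (leq_trans (max_card _)); rewrite card_prod card_ord.
    by rewrite mulnn.
  apply: (le_trans (graph_penalty_le cS)); rewrite ler_pM2l//.
  have -> : n%:R * r = Num.sqrt (n%:R ^+ 2 * sqnorm2 h).
    by rewrite sqrtrM ?sqr_ge0// sqrtr_sqr ger0_norm.
  rewrite ler_wsqrtr// ler_wpM2r ?sqnorm2_ge0// ler_piMr ?sqr_ge0//.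
have P2 : lambda * (norm1 beta - norm1 (beta + h)) <= lambda * norm1 h.
  by rewrite ler_pM2l// norm1_sub_le.
have mle : norm1 h <= n%:R * r.
  apply: (le_trans (norm1_le_sqrt _)).
  have -> : n%:R * r = Num.sqrt (n%:R ^+ 2 * sqnorm2 h).
    by rewrite sqrtrM ?sqr_ge0// sqrtr_sqr ger0_norm.
  by rewrite ler_wsqrtr// ler_wpM2r ?sqnorm2_ge0// expr2 ler_peMr.
have m2le : norm1 h ^+ 2 <= n%:R * r ^+ 2.
  have := norm1_le_sqrt h; rewrite -ler_sqr ?nnegrE ?norm1_ge0 ?sqrtr_ge0//.
  by rewrite sqr_sqrtr ?mulr_ge0 ?sqnorm2_ge0// r2.
have := restricted_eigenvalue h; rewrite -r2.
move: P1 P2 mle m2le; set Q := bform _ _ _; set m := norm1 h.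
move=> P1 P2 mle m2le RE noise basic.
have m0 : 0 <= m by exact: norm1_ge0.
have Kl0 : 0 <= K * lambda by rewrite mulr_ge0// ltW.
have Qle : Q <= 2 * (K + 2) * (lambda * (n%:R * r)).
  have e1 : K * lambda * m <= K * lambda * (n%:R * r) by rewrite ler_wpM2l.
  have e2 : lambda * m <= lambda * (n%:R * r) by rewrite ler_pM2l.
  have -> : 2 * (K + 2) * (lambda * (n%:R * r)) =
     2 * (K * lambda * (n%:R * r)) + 4 * (lambda * (n%:R * r)) by ring.
  lra.
have m2 : tau * m ^+ 2 <= c / 2 * r ^+ 2.
  apply: (@le_trans _ _ (tau * (n%:R * r ^+ 2))); first by rewrite ler_wpM2l.
  by rewrite mulrA ler_wpM2r ?sqr_ge0// mulrC; lra.
have rle : c * r <= 4 * (K + 2) * (lambda * n%:R).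
  have [r00|rn0] := eqVneq r 0.
    by rewrite r00 mulr0 mulr_ge0// ?mulr_ge0// ?ltW// ltr_wpDl.
  have rp : 0 < r by rewrite lt_def rn0 r0.
  rewrite -(ler_pM2r rp).
  have -> : c * r * r = c * r ^+ 2 by ring.
  have -> : 4 * (K + 2) * (lambda * n%:R) * r = 2 * (2 * (K + 2) * (lambda * (n%:R * r))) by ring.
  lra.
apply: (le_trans mle).
have -> : 4 * (K + 2) / c * n%:R ^+ 2 * lambda = n%:R * (4 * (K + 2) * (lambda * n%:R) / c).
  by field; rewrite gt_eqF.
by rewrite ler_wpM2l// ler_pdivlMr// mulrC.
Qed.

End lasso.

(** * Coercive forms and the precision matrix *)

Section bilinear.
Context (R : realType) (n : nat).
Implicit Types (M : 'M[R]_n) (a b : 'cV[R]_n).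

Lemma bform_sym M a b : M^T = M -> bform M a b = bform M b a.
Proof.
move=> Ms; rewrite !bformE exchange_big/=; apply: eq_bigr => l _.
by apply: eq_bigr => l' _; rewrite -{1}Ms mxE [b l 0 * _]mulrC.
Qed.

Lemma bformDl M a a' b : bform M (a + a') b = bform M a b + bform M a' b.
Proof. by rewrite /bform linearD/= !mulmxDl mxE. Qed.

Lemma bformDr M a b b' : bform M a (b + b') = bform M a b + bform M a b'.
Proof. by rewrite /bform mulmxDr mxE. Qed.

Lemma bformZl M (r : R) a b : bform M (r *: a) b = r * bform M a b.
Proof. by rewrite /bform linearZ/= -!scalemxAl mxE. Qed.

Lemma bformZr M (r : R) a b : bform M a (r *: b) = r * bform M a b.
Proof. by rewrite /bform -scalemxAr mxE. Qed.

Lemma bformNl M a b : bform M (- a) b = - bform M a b.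
Proof. by rewrite -scaleN1r bformZl mulN1r. Qed.

Lemma bformNr M a b : bform M a (- b) = - bform M a b.
Proof. by rewrite -scaleN1r bformZr mulN1r. Qed.

Lemma bformBm M M' a b : bform (M - M') a b = bform M a b - bform M' a b.
Proof. by rewrite /bform mulmxBr mulmxBl !mxE. Qed.

Lemma bform_scalar (r : R) a b : bform r%:M a b = r * dot a b.
Proof.
rewrite /bform -[in LHS]scalemx1 -scalemxAr mulmx1 -scalemxAl mxE; congr (_ * _).
by rewrite mxE; apply: eq_bigr => i _; rewrite mxE.
Qed.

Lemma bform_dot M a b : bform M a b = dot a (M *m b).
Proof. by rewrite /bform -mulmxA mxE; apply: eq_bigr => i _; rewrite mxE. Qed.

Lemma polarization_bound M a b (s : R) : M^T = M ->
  `|bform M (a + b) (a + b)| <= s -> `|bform M (a - b) (a - b)| <= s ->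
  `|bform M a b| <= s.
Proof.
move=> Ms; rewrite !(bformDl, bformDr, bformNl, bformNr) (bform_sym b a Ms).
by rewrite !ler_norml => /andP[? ?] /andP[? ?]; apply/andP; split; lra.
Qed.

Definition unitvec (l : 'I_n) : 'cV[R]_n := delta_mx l 0.

Lemma dot_unitvec a l : dot a (unitvec l) = a l 0.
Proof.
rewrite /dot (bigD1 l)//= !mxE !eqxx mulr1 big1 ?addr0// => i il.
by rewrite mxE (negbTE il) mulr0.
Qed.

Lemma mulmx_unitvec (p : nat) (A : 'M[R]_(p, n)) l i : (A *m unitvec l) i 0 = A i l.
Proof.
rewrite mxE (bigD1 l)//= !mxE !eqxx mulr1 big1 ?addr0// => k kl.
by rewrite mxE (negbTE kl) mulr0.
Qed.

Lemma bform_unitvec M l l' : bform M (unitvec l) (unitvec l') = M l l'.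
Proof. by rewrite bform_dot dotC dot_unitvec mulmx_unitvec. Qed.

Lemma sqnorm2_unitvec l : sqnorm2 (unitvec l) = 1.
Proof. by rewrite -dotaa dot_unitvec mxE !eqxx. Qed.

Lemma sqnorm2D_le a b : sqnorm2 (a + b) <= 2 * (sqnorm2 a + sqnorm2 b).
Proof.
rewrite -big_split/= mulr_sumr; apply: ler_sum => i _; rewrite mxE.
move: (a i 0) (b i 0) => x y.
by rewrite -subr_ge0 (_ : _ - _ = (x - y) ^+ 2) ?sqr_ge0//; ring.
Qed.

Lemma sqnorm2N a : sqnorm2 (- a) = sqnorm2 a.
Proof. by apply: eq_bigr => i _; rewrite mxE sqrrN. Qed.

Lemma sqr_entry_le a i : a i 0 ^+ 2 <= sqnorm2 a.
Proof. by rewrite /sqnorm2 (bigD1 i)//= lerDl sumr_ge0// => j _; exact: sqr_ge0. Qed.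

Lemma bform_le_abs_sum M a :
  `|bform M a a| <= (\sum_l \sum_l' `|M l l'|) * sqnorm2 a.
Proof.
rewrite bformE mulr_suml; apply: (le_trans (ler_norm_sum _ _ _)).
apply: ler_sum => l _; rewrite mulr_suml; apply: (le_trans (ler_norm_sum _ _ _)).
apply: ler_sum => l' _; rewrite normrM mulrC ler_wpM2l//.
have := sqr_entry_le a l; have := sqr_entry_le a l'.
rewrite normrM -[a l 0 ^+ 2]real_normK ?num_real// -[a l' 0 ^+ 2]real_normK ?num_real//.
move: `|a l 0| `|a l' 0| => x y H1 H2.
have := sqr_ge0 (x - y); rewrite sqrrB; lra.
Qed.

Lemma sqnorm2_mulmx_le (A : 'M[R]_n) b :
  sqnorm2 (A *m b) <= (\sum_i \sum_j A i j ^+ 2) * sqnorm2 b.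
Proof.
rewrite {1}/sqnorm2 mulr_suml; apply: ler_sum => i _.
have -> : (A *m b) i 0 = dot (row i A)^T b.
  by rewrite mxE; apply: eq_bigr => j _; rewrite !mxE.
apply: (le_trans (cauchy_schwarz _ _)); rewrite le_eqVlt; apply/orP; left; apply/eqP.
by congr (_ * _); apply: eq_bigr => j _; rewrite !mxE.
Qed.

End bilinear.

Section rayleigh.
Context (R : realType) (n : nat) (M : 'M[R]_n).
Hypothesis Msym : M^T = M.

Lemma eigenvalue_unitmx (a : R) : M - a%:M \notin unitmx -> eigenvalue M a.
Proof.
by rewrite /eigenvalue /eigenspace kermx_eq0 row_free_unit.
Qed.

(** For a positive semidefinite B, moving b by a small multiple of - B b keeps
    the form nonnegative, so |B b|^2 is controlled by the form at b.  If B is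
    invertible the form is then bounded below on the unit sphere. *)
Lemma psd_unitmx_coercive (B : 'M[R]_n) : B^T = B ->
  (forall b, 0 <= bform B b b) -> B \in unitmx ->
  exists2 kappa : R, 0 < kappa & forall b, kappa * sqnorm2 b <= bform B b b.
Proof.
move=> Bs Bpsd Bu.
pose K1 := 1 + \sum_l \sum_l' `|B l l'|.
pose K2 := 1 + \sum_i \sum_j (invmx B) i j ^+ 2.
have K1p : 0 < K1.
  by rewrite ltr_pwDl// sumr_ge0// => l _; rewrite sumr_ge0.
have K2p : 0 < K2.
  by rewrite ltr_pwDl// sumr_ge0// => l _; rewrite sumr_ge0// => j _; exact: sqr_ge0.
have K1b a : bform B a a <= K1 * sqnorm2 a.
  apply: (le_trans (ler_norm _)); apply: (le_trans (bform_le_abs_sum _ _)).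
  by rewrite ler_wpM2r ?sqnorm2_ge0// lerDr.
have K2b b : sqnorm2 b <= K2 * sqnorm2 (B *m b).
  rewrite -{1}[b](mulKmx Bu); apply: (le_trans (sqnorm2_mulmx_le _ _)).
  by rewrite ler_wpM2r ?sqnorm2_ge0// lerDr.
exists ((K1 * K2)^-1); first by rewrite invr_gt0 mulr_gt0.
move=> b; rewrite ler_pdivrMl ?mulr_gt0// -mulrA mulrCA.
apply: (le_trans (K2b b)); rewrite ler_pM2l//.
set y := B *m b.
have yb : bform B y b = sqnorm2 y by rewrite bform_dot dotaa.
have := Bpsd (b - K1^-1 *: y).
rewrite !(bformDl, bformDr, bformNl, bformNr, bformZl, bformZr) (bform_sym b y Bs) yb.
move=> H.
have := K1b y; move: H; set u := bform B y y; set v := bform B b b; set s := sqnorm2 y.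
move=> H us.
have e : K1^-1 * (K1^-1 * u) <= K1^-1 * s.
  by rewrite ler_pM2l ?invr_gt0// ler_pdivrMl.
have : K1^-1 * s <= v by lra.
by rewrite ler_pdivrMl.
Qed.

(** Let m be the infimum of the form on the unit sphere.  The form M - m is
    nonnegative and not coercive, so it is not invertible: m is an eigenvalue. *)
Lemma rayleigh_lower_bound (c : R) : (0 < n)%N ->
  (forall a, eigenvalue M a -> c <= a) ->
  forall b, c * sqnorm2 b <= bform M b b.
Proof.
move=> n0 Hc.
pose E := [set bform M b b | b in [set b : 'cV[R]_n | sqnorm2 b = 1]].
have E0 : E !=set0.
  by exists (bform M (unitvec R (Ordinal n0)) (unitvec R (Ordinal n0)));
    exists (unitvec R (Ordinal n0)) => //=; exact: sqnorm2_unitvec.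
have Elb : has_lbound E.
  exists (- \sum_l \sum_l' `|M l l'|) => _ [b /= b1 <-].
  have := bform_le_abs_sum M b; rewrite b1 mulr1 ler_norml.
  by move=> /andP[].
pose m := inf E.
have mle b : m * sqnorm2 b <= bform M b b.
  have [b0|b0] := eqVneq (sqnorm2 b) 0.
    have -> : b = 0.
      by apply/colP => i; rewrite [RHS]mxE; exact: sqnorm2_eq0.
    by rewrite bform_dot mulmx0 -dotaa /dot !big1 ?mulr0// => i _; rewrite !mxE mulr0.
  have bp : 0 < sqnorm2 b by rewrite lt_def b0 sqnorm2_ge0.
  pose r := Num.sqrt (sqnorm2 b).
  have rp : 0 < r by rewrite sqrtr_gt0.
  have r2 : r ^+ 2 = sqnorm2 b by rewrite sqr_sqrtr// ltW.
  have : E (bform M (r^-1 *: b) (r^-1 *: b)).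
    by exists (r^-1 *: b) => //=; rewrite sqnorm2Z -r2 exprVn mulVf// expf_neq0// gt_eqF.
  move=> /(ge_inf Elb); rewrite bformZl bformZr mulrA -expr2 exprVn r2.
  by rewrite ler_pdivlMl// mulrC.
suff cm : c <= m.
  by move=> b; apply: le_trans (mle b); rewrite ler_wpM2r ?sqnorm2_ge0.
apply/Hc/eigenvalue_unitmx/negP => Bu.
have Bs : (M - m%:M)^T = M - m%:M by rewrite linearB/= Msym tr_scalar_mx.
have Bpsd b : 0 <= bform (M - m%:M) b b.
  by rewrite bformBm bform_scalar dotaa subr_ge0.
have [kap kap0 kapP] := psd_unitmx_coercive Bs Bpsd Bu.
have : m + kap <= m.
  apply: lb_le_inf => // _ [b /= b1 <-].
  by have := kapP b; rewrite bformBm bform_scalar dotaa b1; lra.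
by rewrite gerDl leNgt kap0.
Qed.

End rayleigh.

Section precision_matrix.
Context (R : realType) (n : nat) (Sigma : 'M[R]_n) (c : R).
Hypothesis c0 : 0 < c.
Hypothesis Ssym : Sigma^T = Sigma.
Hypothesis Sge : forall b, c * sqnorm2 b <= bform Sigma b b.

Lemma coercive_unitmx : Sigma \in unitmx.
Proof.
rewrite -row_free_unit -kermx_eq0; apply/eqP/row_matrixP => i; rewrite row0.
set u := row i _.
have uS : u *m Sigma = 0.
  by apply/sub_kermxP; rewrite row_sub.
have : sqnorm2 u^T = 0.
  apply/eqP; rewrite eq_le sqnorm2_ge0 andbT -(pmulr_rle0 _ c0).
  by apply: (le_trans (Sge _)); rewrite /bform trmxK uS mul0mx mxE.
by move=> u0; apply/rowP => j; have := sqnorm2_eq0 j u0; rewrite !mxE.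
Qed.

(** The row th of Sigma^-1 with index i satisfies Sigma th = e_i, hence
    c |th|^2 <= th_i <= |th|. *)
Lemma precision_row_norm i : sqnorm2 (row i (invmx Sigma))^T <= c ^- 2.
Proof.
set th := (row i _)^T.
have H : bform Sigma th th = th i 0.
  rewrite /bform trmxK -row_mul mulVmx ?coercive_unitmx// row1 mxE.
  rewrite (bigD1 i)//= mxE !eqxx mul1r big1 ?addr0// => j ji.
  by rewrite mxE eqxx (negbTE ji) mul0r.
have := Sge th; rewrite H; have := sqr_entry_le th i.
set s := sqnorm2 th; set x := th i 0 => H1 H2.
have s0 : 0 <= s by exact: sqnorm2_ge0.
have [->|sn0] := eqVneq s 0; first by rewrite invr_ge0 sqr_ge0.
have sp : 0 < s by rewrite lt_def sn0.
have cs0 : 0 <= c * s by rewrite mulr_ge0// ltW.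
have : (c * s) ^+ 2 <= s.
  by apply: le_trans H1; rewrite ler_sqr ?nnegrE// (le_trans cs0).
rewrite exprMn [s ^+ 2]expr2 mulrA -[leRHS]mul1r ler_pM2r//.
by rewrite -[X in _ -> _ <= X]mul1r ler_pdivlMr ?exprn_gt0// mulrC.
Qed.

End precision_matrix.

(** * Variables close to a Gaussian one *)

Section measurability_real.
Context d (T : measurableType d) (R : realType).
Implicit Types f g : T -> R.

Lemma measurable_fun_invr f : (forall w, 0 <= f w) ->
  measurable_fun [set: T] f -> measurable_fun [set: T] (fun w => (f w)^-1).
Proof.
move=> f0 mf; under eq_fun do rewrite -powR_inv1//.
exact: (measurableT_comp (measurable_powR _) mf).
Qed.

Lemma measurable_fun_sqrtr f :
  measurable_fun [set: T] f -> measurable_fun [set: T] (fun w => Num.sqrt (f w)).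
Proof.
by apply: measurableT_comp; apply: continuous_measurable_fun; exact: sqrt_continuous.
Qed.

Lemma measurable_set_lt f g : measurable_fun [set: T] f ->
  measurable_fun [set: T] g -> measurable [set w | f w < g w].
Proof.
move=> mf mg; have H := measurable_fun_ltr mf mg.
by have := H measurableT [set true] Logic.I; rewrite setTI.
Qed.

End measurability_real.

Section union_bound.
Context d (T : measurableType d) (R : realType) (P : probability T R).
Local Open Scope ereal_scope.

Lemma union_bound (Q : finType) (F : Q -> set T) (b : R) :
  (forall q, measurable (F q)) -> (forall q, P (F q) <= b%:E) ->
  P (\big[setU/set0]_q F q) <= (#|Q|%:R * b)%:E.
Proof.
move=> mF PF.
have -> : (#|Q|%:R * b = \sum_(q : Q) b)%R by rewrite sumr_const mulr_natl.
pose K (x : set T) (y : R) := measurable x /\ P x <= y%:E.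
suff [] : K (\big[setU/set0]_q F q) (\sum_(q : Q) b)%R by [].
apply: big_ind2 => //; first by split; rewrite ?measure0.
move=> A x B y [mA PA] [mB PB]; split; first exact: measurableU.
by rewrite EFinD; apply: (le_trans (measureU2 _ _ _)) => //; exact: leeD.
Qed.

Lemma bigsetU_exists (Q : finType) (F : Q -> set T) w q :
  F q w -> (\big[setU/set0]_q F q) w.
Proof. by move=> Fw; rewrite (bigD1 q)//=; left. Qed.

End union_bound.

Section slutsky.
Context d (T : measurableType d) (R : realType) (P : probability T R).
Notation gamma := (@normal_prob R 0 1).
Variables (Z W : T -> R) (bad : set T) (eta delta t : R).
Hypotheses (mZ : measurable_fun [set: T] Z) (mW : measurable_fun [set: T] W).
Hypotheses (mbad : measurable bad) (Pbad : (P bad <= delta%:E)%E).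
Hypothesis lawW : forall A, measurable A -> P (W @^-1` A) = gamma A.
Hypothesis eta0 : 0 <= eta.
Hypothesis near : forall w, ~ bad w -> `|Z w - W w| <= eta.

Let mpre (V : T -> R) (A : set R) : measurable_fun [set: T] V -> measurable A ->
  measurable (V @^-1` A).
Proof. by move=> mV mA; rewrite -[X in measurable X]setTI; exact: mV. Qed.

(** Off the bad event, Z <= t implies W <= t + eta and is implied by
    W <= t - eta. *)
Lemma cdf_near_gaussian :
  `|fine (gamma `]-oo, t]) - fine (P (Z @^-1` `]-oo, t]))| <=
  delta + normal_peak 1 * eta.
Proof.
have mI s : measurable (`]-oo, s]%classic : set R) by exact: measurable_itv.
have fing s : gamma `]-oo, s] \is a fin_num by exact: fin_num_measure.
have finP A : measurable A -> P A \is a fin_num by exact: fin_num_measure.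
have up : (P (Z @^-1` `]-oo, t]) <= gamma `]-oo, (t + eta)%R] + delta%:E)%E.
  rewrite -lawW//.
  apply: (@le_trans _ _ (P ((W @^-1` `]-oo, (t + eta)%R]) `|` bad))).
    apply: le_measure; rewrite ?inE; [exact: mpre| |].
      by apply: measurableU => //; exact: mpre.
    move=> w /=; rewrite !in_itv/= => Zt.
    have [wb|/near wZ] := pselect (bad w); first by right.
    by left; move: wZ; rewrite ler_norml; lra.
  apply: (le_trans (measureU2 _ _ _)) => //; first exact: mpre.
  exact: leeD.
have lo : (gamma `]-oo, (t - eta)%R] <= P (Z @^-1` `]-oo, t]) + delta%:E)%E.
  rewrite -lawW//.
  apply: (@le_trans _ _ (P ((Z @^-1` `]-oo, t]) `|` bad))).
    apply: le_measure; rewrite ?inE; [exact: mpre| |].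
      by apply: measurableU => //; exact: mpre.
    move=> w /=; rewrite !in_itv/= => Wt.
    have [wb|/near wZ] := pselect (bad w); first by right.
    by left; move: wZ; rewrite ler_norml; lra.
  apply: (le_trans (measureU2 _ _ _)) => //; first exact: mpre.
  exact: leeD.
have ac1 := gaussian_anticoncentration t eta0.
have := gaussian_anticoncentration (t - eta) eta0; rewrite subrK => ac2.
have mZt : P (Z @^-1` `]-oo, t]) \is a fin_num by apply: finP; exact: mpre.
move: up lo ac1 ac2.
rewrite -(fineK mZt) -(fineK (fing t)) -(fineK (fing (t + eta))) -(fineK (fing (t - eta))).
rewrite -!EFinD !lee_fin ler_norml => u l a1 a2; apply/andP; split; lra.
Qed.

End slutsky.

Section gaussian_direction.
Context d d1 (T : measurableType d) (U : measurableType d1) (R : realType)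
  (P : probability T R).
Notation gamma := (@normal_prob R 0 1).
Variables (N : nat) (sigma : R) (X : {mfun T >-> U}) (eps : {mfun T >-> 'cV[R]_N}).
Hypothesis N0 : (0 < N)%N.
Hypothesis sigma0 : 0 < sigma.
Hypothesis gauss : isotropic_gaussian P sigma eps.
Hypothesis indep : independent_rv P X eps.

(** The default at v = 0 keeps the direction a unit vector for every v, so that
    pairing it with the noise has the same law whatever v is. *)
Definition direction (v : 'cV[R]_N) (i : 'I_N) : R :=
  if sqnorm2 v == 0 then (i == Ordinal N0)%:R else v i 0 / Num.sqrt (sqnorm2 v).

Lemma sum_sqr_direction v : \sum_i direction v i ^+ 2 = 1.
Proof.
rewrite /direction; case: eqP => [_|/eqP v0].
  rewrite (bigD1 (Ordinal N0)) //= big1 => [|i /negbTE ->]; last by rewrite expr0n.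
  by rewrite ?eqxx ?eqnn addr0 expr1n.
under eq_bigr do rewrite expr_div_n.
by rewrite -mulr_suml sqr_sqrtr ?sqnorm2_ge0// divff.
Qed.

Lemma measurable_sqnorm2 d' (S : measurableType d') (f : S -> 'cV[R]_N) :
  (forall i, measurable_fun [set: S] (fun x => f x i 0)) ->
  measurable_fun [set: S] (fun x => sqnorm2 (f x)).
Proof. by move=> mf; apply: measurable_sum => i; exact: measurable_funX. Qed.

Lemma measurable_direction d' (S : measurableType d') (f : S -> 'cV[R]_N) i :
  (forall i, measurable_fun [set: S] (fun x => f x i 0)) ->
  measurable_fun [set: S] (fun x => direction (f x) i).
Proof.
move=> mf; have msq := measurable_sqnorm2 mf.
apply: measurable_fun_ifT => //.
  exact: measurable_fun_eqr.
apply: measurable_funM => //; apply: measurable_fun_invr.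
  by move=> w; exact: sqrtr_ge0.
exact: measurable_fun_sqrtr.
Qed.

Definition studentized (f : U -> 'cV[R]_N) (w : T) : R :=
  sigma^-1 * \sum_i direction (f (X w)) i * eps w i 0.

Variable f : U -> 'cV[R]_N.
Hypothesis mf : forall i, measurable_fun [set: U] (fun x => f x i 0).

Lemma law_studentized A : measurable A -> P (studentized f @^-1` A) = gamma A.
Proof.
move=> mA; apply: (conditional_gaussian (u := fun i x => direction (f x) i)) => //.
  by move=> i; exact: measurable_direction.
by move=> x; exact: sum_sqr_direction.
Qed.

Lemma measurable_studentized : measurable_fun [set: T] (studentized f).
Proof.
apply: measurable_funM => //; apply: measurable_sum => i; apply: measurable_funM.
  apply: (measurableT_comp (f := fun x => direction (f x) i)) => //.
  exact: measurable_direction.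
exact: (measurableT_comp (measurable_mx_entry i (0%R : 'I_1)) (@measurable_funP _ _ _ _ setT eps)).
Qed.

Lemma studentizedE w :
  dot (f (X w)) (eps w) = sigma * Num.sqrt (sqnorm2 (f (X w))) * studentized f w.
Proof.
rewrite /studentized mulrAC mulrA divff ?gt_eqF// mul1r mulr_suml.
apply: eq_bigr => i _; rewrite /direction; case: eqP => [v0|/eqP v0].
  by rewrite v0 sqrtr0 mulr0 (sqnorm2_eq0 i v0) mul0r.
rewrite mulrAC divfK// sqrtr_eq0 -ltNge lt_def v0 sqnorm2_ge0//.
Qed.

Lemma studentized_tail t : 0 <= t ->
  (P [set w | (t < `|studentized f w|)%R] <= (2 * expR (- (t ^+ 2 / 2)))%:E)%E.
Proof.
move=> t0; apply: le_trans (gaussian_tail t0).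
rewrite -law_studentized//; apply: measurable_set_lt => //; exact: normr_measurable.
Qed.

End gaussian_direction.

(** * Error decomposition of the one-step estimator *)

Section remainder.
Context (R : realType) (N n : nat).
Variables (N0 : (0 < N)%N) (sigma mu V0 : R) (X : 'M[R]_(N, n))
  (beta h : 'cV[R]_n) (eps : 'cV[R]_N) (Th : 'M[R]_n) (j : 'I_n).
Hypothesis sigma0 : 0 < sigma.
Hypothesis feasible : forall i l, `|(Th *m gram X - 1%:M) i l| <= mu.
Hypothesis mu_half : mu <= 2^-1.
Hypothesis gram_jj : gram X j j <= V0.
Let th := (row j Th)^T.

(** The bias of the Lasso is removed up to the defect of Th as an inverse of the
    Gram matrix. *)
Lemma one_step_error :
  one_step (X *m beta + eps) X (beta + h) Th j 0 - beta j 0 =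
  N%:R^-1 * dot (X *m th) eps - ((Th *m gram X - 1%:M) *m h) j 0.
Proof.
have thE (v : 'cV[R]_n) : (Th *m v) j 0 = dot th v.
  by rewrite mxE; apply: eq_bigr => l _; rewrite !mxE.
have e1 : X *m beta + eps - X *m (beta + h) = eps - X *m h.
  by rewrite mulmxDr opprD addrACA subrr add0r.
rewrite /one_step e1 mulmxBr scalerBr mulmxBl mul1mx /gram.
rewrite -!scalemxAr -!scalemxAl -!mulmxA.
have -> : dot (X *m th) eps = (Th *m (X^T *m eps)) j 0.
  by rewrite thE dotC dot_mulmx dotC.
rewrite !mxE; ring.
Qed.

Lemma variance_estimateE : (Th *m gram X *m Th^T) j j = N%:R^-1 * sqnorm2 (X *m th).
Proof.
rewrite -bform_gram_sqnorm2 bform_dot -mulmxA mxE; apply: eq_bigr => l _.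
congr (_ * _); first by rewrite !mxE.
by rewrite mxE [RHS]mxE; apply: eq_bigr => l' _; rewrite !mxE.
Qed.

(** Cauchy-Schwarz for the Gram form, between the row th and the basis vector
    e_j, on which the constraint forces the value to be at least 1 - mu. *)
Lemma variance_estimate_lower : 1 <= 4 * V0 * (N%:R^-1 * sqnorm2 (X *m th)).
Proof.
have NR : 0 < N%:R :> R by rewrite ltr0n.
set D := N%:R^-1 * _.
have D0 : 0 <= D by rewrite mulr_ge0 ?sqnorm2_ge0// invr_ge0.
have gE : (Th *m gram X) j j = N%:R^-1 * dot (X *m th) (X *m unitvec R j).
  rewrite -[LHS](mulmx_unitvec (Th *m gram X) j j) -mulmxA mxE /dot.
  have -> : \sum_l Th j l * (gram X *m unitvec R j) l 0 = bform (gram X) th (unitvec R j).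
    by rewrite bform_dot; apply: eq_bigr => l _; rewrite !mxE.
  by rewrite bform_gram.
have gjj : gram X j j = N%:R^-1 * sqnorm2 (X *m unitvec R j).
  by rewrite -bform_gram_sqnorm2 bform_unitvec.
have : (Th *m gram X) j j ^+ 2 <= D * gram X j j.
  rewrite gE gjj exprMn [leRHS](_ : _ = N%:R^-1 ^+ 2 *
    (sqnorm2 (X *m th) * sqnorm2 (X *m unitvec R j))); last by rewrite /D; ring.
  by rewrite ler_wpM2l ?sqr_ge0// cauchy_schwarz.
have g2 : 4^-1 <= (Th *m gram X) j j ^+ 2.
  have dE : (Th *m gram X - 1%:M) j j = (Th *m gram X) j j - 1.
    by rewrite [LHS]mxE [X in _ + X]mxE [X in _ - X]mxE eqxx mulr1n.
  have := feasible j j; rewrite dE ler_norml.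
  move: ((Th *m gram X) j j) => g /andP[g1 _].
  have g12 : 2^-1 <= g by move: mu_half; lra.
  by have := ler_pM _ _ g12 g12; rewrite -expr2 invr_ge0 => /(_ (ler0n _ _) (ler0n _ _)); lra.
move=> H; have : D * gram X j j <= D * V0 by rewrite ler_wpM2l.
lra.
Qed.

(** The variance estimate is the squared norm of X th over N, so that after
    normalization the leading term only depends on the direction of X th. *)
Lemma remainder_bound :
  `|Num.sqrt N%:R * (one_step (X *m beta + eps) X (beta + h) Th j 0 - beta j 0)
      / (sigma * Num.sqrt ((Th *m gram X *m Th^T) j j))
    - sigma^-1 * \sum_i direction N0 (X *m th) i * eps i 0| <=
  Num.sqrt N%:R * (mu * norm1 h) * (2 * Num.sqrt V0) / sigma.
Proof.
have NR : 0 < N%:R :> R by rewrite ltr0n.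
rewrite one_step_error variance_estimateE.
have := variance_estimate_lower.
set q := sqnorm2 (X *m th); set rem := (_ *m h) j 0 => var.
have remle : `|rem| <= mu * norm1 h.
  have -> : rem = dot (row j (Th *m gram X - 1%:M))^T h.
    by rewrite /rem mxE; apply: eq_bigr => l _; rewrite !mxE.
  by apply: dot_le_norm1 => l; rewrite [X in `|X|]mxE [X in `|X|]mxE; exact: feasible.
have q0 : q != 0 by apply: contraTneq var => ->; rewrite !mulr0 -ltNge ltr01.
have qp : 0 < q by rewrite lt_def q0 sqnorm2_ge0.
set D := N%:R^-1 * q in var *.
have Dp : 0 < D by rewrite mulr_gt0 ?invr_gt0.
have sD : 0 < Num.sqrt D by rewrite sqrtr_gt0.
have sN : 0 < Num.sqrt N%:R :> R by rewrite sqrtr_gt0.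
have sq : 0 < Num.sqrt q by rewrite sqrtr_gt0.
have mainE : sigma^-1 * (\sum_i direction N0 (X *m th) i * eps i 0) =
    Num.sqrt N%:R * (N%:R^-1 * dot (X *m th) eps) / (sigma * Num.sqrt D).
  have -> : \sum_i direction N0 (X *m th) i * eps i 0 =
      (Num.sqrt q)^-1 * dot (X *m th) eps.
    rewrite mulr_sumr; apply: eq_bigr => i _.
    by rewrite /direction (negbTE q0) mulrA [_^-1 * _]mulrC.
  have -> : Num.sqrt D = Num.sqrt q / Num.sqrt N%:R.
    by rewrite /D mulrC sqrtrM ?ltW// sqrtrV// ltW.
  have NE : N%:R = Num.sqrt N%:R ^+ 2 :> R by rewrite sqr_sqrtr// ltW.
  rewrite {2}NE; field.
  by rewrite !gt_eqF.
rewrite mainE mulrBr mulrBl addrAC subrr add0r normrN !normrM normfV normrM.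
rewrite !(gtr0_norm sN, gtr0_norm sigma0, gtr0_norm sD).
have invle : (Num.sqrt D)^-1 <= 2 * Num.sqrt V0.
  have V0p : 0 <= V0.
    by rewrite leNgt; apply/negP => V0n; move: var; rewrite leNgt -mulrA; nra.
  rewrite -(ler_pM2l sD) divff ?gt_eqF//.
  rewrite mulrCA -sqrtrM ?(ltW Dp)//.
  have -> : 2 = Num.sqrt (4 : R) by rewrite (_ : 4 = 2 ^+ 2) ?sqrtr_sqr ?ger0_norm//; ring.
  rewrite -sqrtrM// -[leLHS]sqrtr1 ler_wsqrtr//.
  by rewrite [D * V0]mulrC mulrA.
have -> : Num.sqrt N%:R * `|rem| / (sigma * Num.sqrt D) =
    Num.sqrt N%:R * `|rem| * (Num.sqrt D)^-1 / sigma.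
  by rewrite invfM [_^-1 * _]mulrC mulrA.
rewrite ler_pM2r ?invr_gt0//; apply: ler_pM => //.
by rewrite ler_pM2l.
Qed.

End remainder.

(** * Exceptional events of the design and of the noise *)

Section mulmx_measurability.
Context d (T : measurableType d) (R : realType).

Lemma measurable_mulmx (p q r : nat) (A : T -> 'M[R]_(p, q)) (B : T -> 'M[R]_(q, r)) :
  (forall i j, measurable_fun [set: T] (fun w => A w i j)) ->
  (forall i j, measurable_fun [set: T] (fun w => B w i j)) ->
  forall i j, measurable_fun [set: T] (fun w => (A w *m B w) i j).
Proof.
move=> mA mB i j; under eq_fun do rewrite mxE.
by apply: measurable_sum => l; exact: measurable_funM.
Qed.

Lemma measurable_trmx (p q : nat) (A : T -> 'M[R]_(p, q)) :
  (forall i j, measurable_fun [set: T] (fun w => A w i j)) ->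
  forall i j, measurable_fun [set: T] (fun w => (A w)^T i j).
Proof. by move=> mA i j; under eq_fun do rewrite mxE; exact: mA. Qed.

Lemma measurable_addmx (p q : nat) (A B : T -> 'M[R]_(p, q)) :
  (forall i j, measurable_fun [set: T] (fun w => A w i j)) ->
  (forall i j, measurable_fun [set: T] (fun w => B w i j)) ->
  forall i j, measurable_fun [set: T] (fun w => (A w + B w) i j).
Proof.
by move=> mA mB i j; under eq_fun do rewrite mxE; exact: measurable_funD.
Qed.

Lemma measurable_scalemx (p q : nat) (r : R) (A : T -> 'M[R]_(p, q)) :
  (forall i j, measurable_fun [set: T] (fun w => A w i j)) ->
  forall i j, measurable_fun [set: T] (fun w => (r *: A w) i j).
Proof.
by move=> mA i j; under eq_fun do rewrite mxE; exact: measurable_funM.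
Qed.

Lemma measurable_submx (p q : nat) (A B : T -> 'M[R]_(p, q)) :
  (forall i j, measurable_fun [set: T] (fun w => A w i j)) ->
  (forall i j, measurable_fun [set: T] (fun w => B w i j)) ->
  forall i j, measurable_fun [set: T] (fun w => (A w - B w) i j).
Proof.
move=> mA mB i j; under eq_fun do rewrite mxE.
apply: measurable_funD; first exact: mA.
under eq_fun do rewrite mxE; apply: measurableT_comp; [exact: oppr_measurable|exact: mB].
Qed.

End mulmx_measurability.

Section gram_deviation.
Context d (T : measurableType d) (R : realType) (P : probability T R).
Variables (N n : nat) (sigma B t0 A : R) (Sigma : 'M[R]_n).
Variables (X : {RV P >-> 'M[R]_(N, n)}).
Hypothesis sigma0 : 0 < sigma.
Hypothesis HX : rowwise_sub_gaussian P sigma Sigma X.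
Hypothesis N0 : (0 < N)%N.
Hypothesis B0 : 0 < B.
Hypothesis t0E : t0 = 3 / (8 * (sigma * B) ^+ 2).
Hypothesis AE : A = 16 * expR 1.

Lemma covariance_sym : Sigma^T = Sigma.
Proof.
apply/matrixP => l l'; rewrite mxE; apply: EFin_inj.
have [_ <-] := design_moment HX (Ordinal N0) l' l.
have [_ <-] := design_moment HX (Ordinal N0) l l'.
by apply: eq_integral => w _; rewrite mulrC.
Qed.

Lemma gram_sym (x : 'M[R]_(N, n)) : (gram x)^T = gram x.
Proof. by rewrite /gram linearZ/= trmx_mul trmxK. Qed.

(** Both sign choices are included, as needed for polarization. *)
Definition polar (f g : 'I_n -> 'cV[R]_n) (q : 'I_n * 'I_n * bool) : 'cV[R]_n :=
  if q.2 then f q.1.1 + g q.1.2 else f q.1.1 - g q.1.2.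

Definition gram_bad (f g : 'I_n -> 'cV[R]_n) (s : R) : set T :=
  \big[setU/set0]_(q : 'I_n * 'I_n * bool)
    [set w | s < `|bform (gram (X w)) (polar f g q) (polar f g q)
                   - bform Sigma (polar f g q) (polar f g q)|].

Lemma measurable_gram_dev (b : 'cV[R]_n) (s : R) :
  measurable [set w | s < `|bform (gram (X w)) b b - bform Sigma b b|].
Proof.
apply: measurable_set_lt => //; apply: measurableT_comp => //.
apply: measurable_funB => //.
under eq_fun do rewrite bform_gram.
apply: measurable_funM => //; apply: measurable_sum => i.
by apply: measurable_funM; exact: measurable_design_apply.
Qed.

Lemma measurable_gram_bad f g s : measurable (gram_bad f g s).
Proof. by apply: bigsetU_measurable => q _; exact: measurable_gram_dev. Qed.

Lemma gram_bad_prob f g s : 0 < s -> s <= A / t0 ->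
  (forall q, sqnorm2 (polar f g q) <= B ^+ 2) ->
  (P (gram_bad f g s) <=
   (4 * n%:R ^+ 2 * expR (- (t0 ^+ 2 / (4 * A) * (N%:R * s ^+ 2))))%:E)%E.
Proof.
move=> s0 sA qB; apply: (le_trans (union_bound (fun q => measurable_gram_dev _ s)
  (fun q => design_concentration sigma0 HX B0 (qB q) t0E AE N0 s0 sA))).
rewrite lee_fin !card_prod !card_ord card_bool !natrM le_eqVlt; apply/orP; left; apply/eqP.
have -> : N%:R * (s ^+ 2 * t0 ^+ 2 / (4 * A)) = t0 ^+ 2 / (4 * A) * (N%:R * s ^+ 2) by ring.
by ring.
Qed.

Lemma gram_good f g s w : ~ gram_bad f g s w ->
  forall i l, `|bform (gram (X w) - Sigma) (f i) (g l)| <= s.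
Proof.
move=> good i l.
have H b : `|bform (gram (X w) - Sigma) (polar f g (i, l, b)) (polar f g (i, l, b))| <= s.
  rewrite leNgt; apply/negP => bad; apply: good.
  by apply: (bigsetU_exists (q := (i, l, b))); rewrite /= -bformBm.
apply: polarization_bound (H true) (H false).
by rewrite linearB/= gram_sym covariance_sym.
Qed.

(** By polarization from the vectors e_l + e_l' and e_l - e_l', of norm at most
    2, and the bound on the variance of a sub-Gaussian variable. *)
Lemma covariance_entry_le l l' : 2 <= B -> `|Sigma l l'| <= t0^-1.
Proof.
move=> B2; rewrite -bform_unitvec.
have tp : 0 < t0 by rewrite t0E divr_gt0// mulr_gt0// exprn_gt0// mulr_gt0.
have H b : sqnorm2 b <= B ^+ 2 -> `|bform Sigma b b| <= t0^-1.
  move=> bB; have := design_variance_le sigma0 HX (Ordinal N0) B0 bB.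
  rewrite -t0E => H1; rewrite ger0_norm; last first.
    rewrite -lee_fin -(design_second_moment HX b (Ordinal N0)).
    by apply: integral_ge0 => w _; rewrite lee_fin sqr_ge0.
  by rewrite -(ler_pM2l tp) divff ?gt_eqF.
have B4 : 2 * (1 + 1) <= B ^+ 2 by nra.
apply: polarization_bound covariance_sym _ _; apply: H.
  by apply: (le_trans (sqnorm2D_le _ _)); rewrite !sqnorm2_unitvec.
by apply: (le_trans (sqnorm2D_le _ _)); rewrite sqnorm2N !sqnorm2_unitvec.
Qed.

End gram_deviation.

Section noise.
Context d (T : measurableType d) (R : realType) (P : probability T R).
Variables (N n : nat) (sigma : R) (X : {RV P >-> 'M[R]_(N, n)})
  (eps : {RV P >-> 'cV[R]_N}).
Hypothesis N0 : (0 < N)%N.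
Hypothesis sigma0 : 0 < sigma.
Hypothesis gauss : isotropic_gaussian P sigma eps.
Hypothesis indep : independent_rv P X eps.

Let column (l : 'I_n) (x : 'M[R]_(N, n)) : 'cV[R]_N := x *m unitvec R l.

Let measurable_column l i :
  measurable_fun [set: 'M[R]_(N, n)] (fun x => column l x i 0).
Proof.
rewrite /column; under eq_fun do rewrite mulmx_unitvec.
exact: measurable_mx_entry.
Qed.

Definition noise_bad (t : R) : set T :=
  \big[setU/set0]_(l < n) [set w | t < `|studentized sigma X eps N0 (column l) w|].

Let measurable_noise_bad1 l t :
  measurable [set w | t < `|studentized sigma X eps N0 (column l) w|].
Proof.
apply: measurable_set_lt => //; apply: measurableT_comp => //.
exact: measurable_studentized.
Qed.

Lemma measurable_noise_bad t : measurable (noise_bad t).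
Proof. exact: bigsetU_measurable. Qed.

Lemma noise_bad_prob t : 0 <= t ->
  (P (noise_bad t) <= (n%:R * (2 * expR (- (t ^+ 2 / 2))))%:E)%E.
Proof.
move=> t0; rewrite -[X in X%:R * _]card_ord; apply: union_bound => // l.
exact: (studentized_tail N0 sigma0 gauss indep (measurable_column l)).
Qed.

Lemma noise_good t V0 w : ~ noise_bad t w ->
  (forall l, gram (X w) l l <= V0) ->
  forall l, `|((X w)^T *m eps w) l 0| <= sigma * Num.sqrt (N%:R * V0) * t.
Proof.
move=> good gV l; have NR : 0 < N%:R :> R by rewrite ltr0n.
have -> : ((X w)^T *m eps w) l 0 = dot (column l (X w)) (eps w).
  by rewrite -[LHS]dot_unitvec -dot_mulmx dotC.
rewrite (studentizedE X eps N0 sigma0) normrM; apply: ler_pM => //.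
  rewrite ger0_norm; last by rewrite mulr_ge0 ?sqrtr_ge0// ltW.
  rewrite ler_pM2l// ler_wsqrtr//.
  by have := gV l; rewrite -bform_unitvec bform_gram_sqnorm2 ler_pdivrMl.
rewrite leNgt; apply/negP => bad; apply: good.
exact: (bigsetU_exists (q := l)).
Qed.

End noise.

(** * Normal approximation for a fixed model *)

(** B bounds the norm of the vectors used in polarization, which are sums and
    differences of basis vectors and of rows of Sigma^-1.  Every sub-Gaussian
    variable involved then has parameter at most sigma_x B, and t0, A, kappa are
    the constants of Bernstein's inequality for this parameter.  V0 bounds the
    diagonal of the Gram matrix.  C_lambda makes the noise, at 2 sqrt(log n)
    standard deviations, at most lambda / 2; C_mu makes kappa C_mu^2 = 3, so that
    4 n^2 exp(- kappa C_mu^2 log n) = 4 / n. *)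
Section nonasymptotic.
Context (R : realType) (k : nat).
Variables (nu sigma_eps sigma_x c B t0 A kappa V0 C_lambda C_mu : R).
Hypotheses (nu0 : 0 <= nu) (nu1 : nu < 1) (sigma_eps0 : 0 < sigma_eps)
  (sigma_x0 : 0 < sigma_x) (c0 : 0 < c).
Hypothesis BE : B = 2 * c^-1 + 2.
Hypothesis t0E : t0 = 3 / (8 * (sigma_x * B) ^+ 2).
Hypothesis AE : A = 16 * expR 1.
Hypothesis kappaE : kappa = t0 ^+ 2 / (4 * A).
Hypothesis V0E : V0 = t0^-1 + 1.
Hypothesis C_lambdaE : C_lambda = 4 * Num.sqrt V0.
Hypothesis C_muE : C_mu = Num.sqrt (3 / kappa).

Let B0 : 0 < B.
Proof. by rewrite BE ltr_wpDl// mulr_ge0// invr_ge0 ltW. Qed.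

Let B2 : 2 <= B.
Proof. by rewrite BE lerDr mulr_ge0// invr_ge0 ltW. Qed.

Let t0_gt0 : 0 < t0.
Proof. by rewrite t0E divr_gt0// mulr_gt0// exprn_gt0// mulr_gt0. Qed.

Let A_gt0 : 0 < A.
Proof. by rewrite AE mulr_gt0// expR_gt0. Qed.

Let kappa_gt0 : 0 < kappa.
Proof. by rewrite kappaE divr_gt0 ?exprn_gt0// mulr_gt0. Qed.

Let V0_gt0 : 0 < V0.
Proof. by rewrite V0E ltr_wpDl// invr_ge0 ltW. Qed.

Let C_lambda_gt0 : 0 < C_lambda.
Proof. by rewrite C_lambdaE mulr_gt0// sqrtr_gt0. Qed.

Let C_mu_gt0 : 0 < C_mu.
Proof. by rewrite C_muE sqrtr_gt0 divr_gt0. Qed.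

Context (N n : nat) (G : sgraph n) (s1 s2 M : R) (beta : 'cV[R]_n)
  (Sigma : 'M[R]_n) (d : measure_display) (T : measurableType d)
  (P : probability T R) (X : {RV P >-> 'M[R]_(N, n)}) (eps : {RV P >-> 'cV[R]_N})
  (betahat : {RV P >-> 'cV[R]_n}) (Thetahat : {mfun 'M[R]_(N, n) >-> 'M[R]_n})
  (j : 'I_n).
Hypotheses (N0 : (0 < N)%N) (n1 : (1 < n)%N) (s10 : 0 < s1) (s20 : 0 < s2).
Hypothesis betaS : param_space G k s1 s2 beta.
Hypothesis HX : rowwise_sub_gaussian P sigma_x Sigma X.
Hypothesis Heps : isotropic_gaussian P sigma_eps eps.
Hypothesis indep : independent_rv P X eps.
Hypothesis eig : forall a, eigenvalue Sigma a -> c <= a.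
Hypothesis HM : forall i, \sum_l `|invmx Sigma i l| <= M.
Hypothesis nus : nu <= s2 / s1.
Let a := Num.sqrt (ln n%:R / N%:R) : R.
Variables (lambda lambda_g mu : R).
Hypothesis lambdaE : lambda = C_lambda * (sigma_eps * a).
Hypothesis lambda_gE :
  lambda_g = lambda * Num.sqrt (nu / (2 * (max_degree G)%:R) ^+ k.+1).
Hypothesis muE : mu = C_mu * a.
Hypothesis betahatP : forall w, is_argmin setT
  (lasso_objective G k lambda_g lambda (X w *m beta + eps w) (X w)) (betahat w).
Hypothesis ThetahatP : is_clime mu Thetahat.

Let Z (w : T) : R :=
  let Th := Thetahat (X w) in
  let betatilde := one_step (X w *m beta + eps w) (X w) (betahat w) Th in
  Num.sqrt N%:R * (betatilde j 0 - beta j 0)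
  / (sigma_eps * Num.sqrt ((Th *m gram (X w) *m Th^T) j j)).

Let row_score (x : 'M[R]_(N, n)) : 'cV[R]_N := x *m (row j (Thetahat x))^T.
Let W : T -> R := studentized sigma_eps X eps N0 row_score.

Let n0 : (0 < n)%N. Proof. exact: ltnW. Qed.

Let NR : 0 < N%:R :> R. Proof. by rewrite ltr0n. Qed.

Let ln_gt0 : 0 < ln n%:R :> R.
Proof. by rewrite ln_gt0// ltr1n. Qed.

Lemma rate_gt0 : 0 < a.
Proof. by rewrite sqrtr_gt0 divr_gt0. Qed.

Lemma rate_sqr : N%:R * a ^+ 2 = ln n%:R.
Proof. by rewrite sqr_sqrtr ?divr_ge0 ?ltW// mulrC divfK// gt_eqF. Qed.

Let lambda_gt0 : 0 < lambda.
Proof. by rewrite lambdaE !mulr_gt0// rate_gt0. Qed.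

Let measurable_Thetahat i l :
  measurable_fun [set: 'M[R]_(N, n)] (fun x => Thetahat x i l).
Proof.
exact: (measurableT_comp (measurable_mx_entry i l) (@measurable_funP _ _ _ _ setT Thetahat)).
Qed.

Let measurable_row_score i :
  measurable_fun [set: 'M[R]_(N, n)] (fun x => row_score x i 0).
Proof.
apply: measurable_mulmx; first exact: measurable_mx_entry.
apply: measurable_trmx => l l'; under eq_fun do rewrite mxE.
exact: measurable_Thetahat.
Qed.

Let measurable_ThetaX i l : measurable_fun [set: T] (fun w => Thetahat (X w) i l).
Proof.
exact: (measurableT_comp (measurable_Thetahat i l) (@measurable_funP _ _ _ _ setT X)).
Qed.

Let measurable_X i l : measurable_fun [set: T] (fun w => X w i l).
Proof. exact: measurable_design_entry. Qed.

Lemma measurable_statistic : measurable_fun [set: T] Z.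
Proof.
have mXT i l : measurable_fun [set: T] (fun w => (X w)^T i l).
  exact: measurable_trmx.
have meps i l : measurable_fun [set: T] (fun w => eps w i l).
  exact: (measurableT_comp (measurable_mx_entry i l) (@measurable_funP _ _ _ _ setT eps)).
have mbh i l : measurable_fun [set: T] (fun w => betahat w i l).
  exact: (measurableT_comp (measurable_mx_entry i l) (@measurable_funP _ _ _ _ setT betahat)).
have mcst (p q : nat) (Q : 'M[R]_(p, q)) i l : measurable_fun [set: T] (fun=> Q i l).
  exact: measurable_cst.
have mXb := measurable_mulmx measurable_X (mcst _ _ beta).
have mXbh := measurable_mulmx measurable_X mbh.
have my := measurable_addmx mXb meps.
have mres := measurable_submx my mXbh.
have mTX := measurable_mulmx measurable_ThetaX mXT.
have mcorr := measurable_mulmx mTX mres.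
have mtilde := measurable_addmx mbh (measurable_scalemx N%:R^-1 mcorr).
have mgram := measurable_scalemx N%:R^-1 (measurable_mulmx mXT measurable_X).
have mTg := measurable_mulmx measurable_ThetaX mgram.
have mD := measurable_mulmx mTg (measurable_trmx measurable_ThetaX).
apply: measurable_funM.
  apply: measurable_funM => //; apply: measurable_funB => //; exact: mtilde.
apply: measurable_fun_invr.
  by move=> w; rewrite mulr_ge0 ?sqrtr_ge0// ltW.
by apply: measurable_funM => //; apply: measurable_fun_sqrtr; exact: mD.
Qed.

Lemma population_coercive b : c * sqnorm2 b <= bform Sigma b b.
Proof. exact: (rayleigh_lower_bound (covariance_sym HX N0) n0 eig). Qed.

Let unit_polar_le q : sqnorm2 (polar (@unitvec R n) (@unitvec R n) q) <= B ^+ 2.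
Proof.
have B4 : 2 * (1 + 1) <= B ^+ 2 by have := B2; nra.
rewrite /polar; case: ifP => _; apply: le_trans B4;
  by rewrite (le_trans (sqnorm2D_le _ _))// ?sqnorm2N !sqnorm2_unitvec.
Qed.

Let theta i : 'cV[R]_n := (row i (invmx Sigma))^T.

Let theta_polar_le q : sqnorm2 (polar theta (@unitvec R n) q) <= B ^+ 2.
Proof.
have th i : sqnorm2 (theta i) <= c ^- 2.
  exact: (precision_row_norm c0 population_coercive).
have Bc : 2 * (c ^- 2 + 1) <= B ^+ 2.
  have : 0 < c^-1 by rewrite invr_gt0.
  rewrite BE -exprVn; move: (c^-1) => x x0.
  have -> : (2 * x + 2) ^+ 2 = 2 * (x ^+ 2 + 1) + (2 * x ^+ 2 + 8 * x + 2) by ring.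
  by rewrite lerDl !addr_ge0// mulr_ge0 ?sqr_ge0// ltW.
rewrite /polar; case: ifP => _; apply: le_trans Bc;
  rewrite (le_trans (sqnorm2D_le _ _))// ?sqnorm2N sqnorm2_unitvec ler_pM2l// lerD2r; exact: th.
Qed.

(** The entries of Sigma are at most 1 / t0, and a row of Sigma^-1 paired with
    the column of Sigma of the same index gives 1. *)
Lemma precision_row_lower : t0 <= M.
Proof.
pose i := Ordinal n0.
have Su : Sigma \in unitmx := coercive_unitmx c0 population_coercive.
have : (invmx Sigma *m Sigma) i i = 1 by rewrite mulVmx// mxE eqxx.
rewrite mxE => H.
have : 1 <= M * t0^-1.
  rewrite -H; apply: (@le_trans _ _ (\sum_l `|invmx Sigma i l| * t0^-1)).
    apply: ler_sum => l _; apply: (le_trans (ler_norm _)).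
    rewrite normrM ler_wpM2l//.
    exact: (covariance_entry_le sigma_x0 HX N0 B0 t0E).
  by rewrite -mulr_suml ler_wpM2r ?invr_ge0 ?HM// ltW.
by rewrite ler_pdivlMr// mul1r.
Qed.

Variables K : R.
Hypothesis K0 : 0 < K.
Hypothesis Ka_range : K * a <= A / t0.
Hypothesis mu_range : C_mu * a <= A / t0.
Hypothesis Ka1 : K * a <= 1.
Hypothesis mu_half : C_mu * a <= 2^-1.

Let bad1 := gram_bad Sigma X (@unitvec R n) (@unitvec R n) (K * a).
Let bad2 t := noise_bad sigma_eps X eps N0 t.
Let bad3 := gram_bad Sigma X theta (@unitvec R n) (C_mu * a).

Let bad1_prob :
  (P bad1 <= (4 * n%:R ^+ 2 * expR (- (kappa * K ^+ 2 * ln n%:R)))%:E)%E.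
Proof.
have Ka0 : 0 < K * a by rewrite mulr_gt0// rate_gt0.
have := gram_bad_prob sigma_x0 HX N0 B0 t0E AE Ka0 Ka_range unit_polar_le.
have -> : N%:R * (K * a) ^+ 2 = K ^+ 2 * ln n%:R by rewrite exprMn mulrCA rate_sqr.
by rewrite -kappaE mulrA.
Qed.

Let bad3_prob : (P bad3 <= (4 / n%:R)%:E)%E.
Proof.
have mua0 : 0 < C_mu * a by rewrite mulr_gt0// rate_gt0.
have := gram_bad_prob sigma_x0 HX N0 B0 t0E AE mua0 mu_range theta_polar_le.
have -> : N%:R * (C_mu * a) ^+ 2 = C_mu ^+ 2 * ln n%:R.
  by rewrite exprMn mulrCA rate_sqr.
rewrite -kappaE mulrA.
have -> : kappa * C_mu ^+ 2 = 3.
  by rewrite C_muE sqr_sqrtr ?divr_ge0 ?ltW// mulrC divfK// gt_eqF.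
move=> H; apply: (le_trans H); rewrite lee_fin expRN expRM_natl lnK ?posrE ?ltr0n//.
rewrite le_eqVlt; apply/orP; left; apply/eqP; field.
by rewrite pnatr_eq0 -lt0n.
Qed.

Let gram_near w : ~ bad1 w -> forall l l', `|gram (X w) l l' - Sigma l l'| <= K * a.
Proof.
move=> good l l'; have := gram_good HX N0 good l l'.
rewrite bform_unitvec; set x := _ l l'.
have -> : x = gram (X w) l l' - Sigma l l' by rewrite /x [LHS]mxE [X in _ + X]mxE.
by [].
Qed.

Let gram_diag w : ~ bad1 w -> forall l, gram (X w) l l <= V0.
Proof.
move=> good l; have := gram_near good l l.
have := covariance_entry_le sigma_x0 HX N0 B0 t0E l l B2.
rewrite V0E !ler_norml => /andP[_ ?] /andP[_ ?]; by have := Ka1; lra.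
Qed.

Let noise_level t w : 0 <= t -> ~ bad1 w -> ~ bad2 (t * Num.sqrt (ln n%:R)) w ->
  forall l, `|((X w)^T *m eps w) l 0| <= N%:R * (t / 4 * lambda).
Proof.
move=> tge0 good1 good2 l.
apply: (le_trans (noise_good sigma_eps0 good2 (gram_diag good1) l)).
have Na : N%:R * a = Num.sqrt N%:R * Num.sqrt (ln n%:R).
  rewrite -sqrtrM ?ler0n// -rate_sqr mulrA -expr2 -exprMn sqrtr_sqr ger0_norm//.
  by rewrite mulr_ge0// ltW// rate_gt0.
have -> : N%:R * (t / 4 * lambda) = t * sigma_eps * Num.sqrt V0 * (N%:R * a).
  by rewrite lambdaE C_lambdaE; field.
rewrite Na sqrtrM ?ler0n// le_eqVlt; apply/orP; left; apply/eqP; ring.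
Qed.

(* What both regimes share: bounds for the Lasso error and feasibility of the
   CLIME program off a bad event. *)
Let cdf_bound (bad : set T) (delta l1 t : R) : measurable bad ->
  (P bad <= delta%:E)%E -> 0 <= l1 ->
  (forall w, ~ bad w -> ~ bad1 w /\ norm1 (betahat w - beta) <= l1 /\
     clime_feasible mu (X w) !=set0) ->
  `|fine (normal_prob 0 1 `]-oo, t]) - fine (P (Z @^-1` `]-oo, t]))| <=
  delta + normal_peak 1 *
    (Num.sqrt N%:R * (mu * l1) * (2 * Num.sqrt V0) / sigma_eps).
Proof.
move=> mbad Pbad l10 good.
have mu0 : 0 < mu by rewrite muE mulr_gt0// rate_gt0.
apply: (cdf_near_gaussian (W := W) (bad := bad)) => //.
- exact: measurable_statistic.
- exact: measurable_studentized.
- move=> D mD; exact: law_studentized.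
- by rewrite divr_ge0 ?(ltW sigma_eps0)// !mulr_ge0 ?sqrtr_ge0// ltW.
move=> w /good[good1 [hl1 feas]].
have [feasTh _] := ThetahatP feas.
have bE : betahat w = beta + (betahat w - beta) by rewrite addrC subrK.
have mu2 : mu <= 2^-1 by rewrite muE.
have := remainder_bound N0 beta (betahat w - beta) (eps w) sigma_eps0 feasTh mu2 (gram_diag good1 j).
rewrite -bE => H; apply: (le_trans H).
rewrite ler_pM2r ?invr_gt0// ler_wpM2r ?mulr_ge0 ?sqrtr_ge0//.
by rewrite ler_wpM2l ?sqrtr_ge0// ler_pM2l.
Qed.

(* The inverse of Sigma is feasible because Sigma^-1 S - I = Sigma^-1 (S - Sigma). *)
Let population_feasible w : ~ bad3 w -> clime_feasible mu (X w) !=set0.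
Proof.
move=> good; exists (invmx Sigma) => i l.
have Su : Sigma \in unitmx := coercive_unitmx c0 population_coercive.
have -> : invmx Sigma *m gram (X w) - 1%:M = invmx Sigma *m (gram (X w) - Sigma).
  by rewrite mulmxBr mulVmx.
have -> : (invmx Sigma *m (gram (X w) - Sigma)) i l =
    bform (gram (X w) - Sigma) (theta i) (unitvec R l).
  rewrite bform_dot -[LHS](mulmx_unitvec _ l i) -mulmxA mxE.
  by apply: eq_bigr => l' _; rewrite !mxE.
by rewrite muE; exact: (gram_good HX N0 good i l).
Qed.

(* For small n a / c, coercivity passes from Sigma to the Gram matrix. *)
Let empirical_feasible w : ~ bad1 w -> 2 * (n%:R * (K * a)) <= c ->
  clime_feasible mu (X w) !=set0.
Proof.
move=> good small; exists (invmx (gram (X w))) => i l.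
have c20 : 0 < c / 2 by rewrite divr_gt0.
have Gu : gram (X w) \in unitmx.
  apply: (coercive_unitmx c20) => b.
  apply: le_trans (restricted_eigenvalue population_coercive (gram_near good) b).
  have Ka0 : 0 <= K * a by rewrite ltW// mulr_gt0// rate_gt0.
  have nb : norm1 b ^+ 2 <= n%:R * sqnorm2 b.
    have := norm1_le_sqrt b; rewrite -ler_sqr ?nnegrE ?norm1_ge0 ?sqrtr_ge0//.
    by rewrite sqr_sqrtr// mulr_ge0 ?sqnorm2_ge0.
  have H1 : K * a * norm1 b ^+ 2 <= K * a * (n%:R * sqnorm2 b) by rewrite ler_wpM2l.
  have H2 : 2 * (n%:R * (K * a)) * sqnorm2 b <= c * sqnorm2 b.
    by rewrite ler_wpM2r ?sqnorm2_ge0.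
  have E : K * a * (n%:R * sqnorm2 b) = n%:R * (K * a) * sqnorm2 b by ring.
  lra.
by rewrite mulVmx// subrr mxE normr0 muE mulr_ge0// ltW// rate_gt0.
Qed.

Let betahat_argmin w : is_argmin setT
  (lasso_objective G k lambda_g lambda (X w *m beta + eps w) (X w))
  (beta + (betahat w - beta)).
Proof. by rewrite [beta + _]addrC subrK. Qed.

(** The regime of large n.  As long as the Gram matrix is close to Sigma, an
    event of probability 2 / n contains the failures of the noise bound
    lambda / 2; another one, of probability 4 / n, contains those of the
    feasibility of Sigma^-1 for CLIME. *)
Lemma sparse_cdf_bound t : 128 * (s2 * (K * a)) <= c ->
  `|fine (normal_prob 0 1 `]-oo, t]) - fine (P (Z @^-1` `]-oo, t]))| <=
  4 * n%:R ^+ 2 * expR (- (kappa * K ^+ 2 * ln n%:R)) + 6 / n%:R +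
  normal_peak 1 * (Num.sqrt N%:R * (mu * (128 / c * (lambda * s2)))
    * (2 * Num.sqrt V0) / sigma_eps).
Proof.
move=> small.
have sln0 : 0 <= 2 * Num.sqrt (ln n%:R) :> R by rewrite mulr_ge0 ?sqrtr_ge0.
have bad2_prob : (P (bad2 (2 * Num.sqrt (ln n%:R))) <= (2 / n%:R)%:E)%E.
  apply: (le_trans (noise_bad_prob N0 sigma_eps0 Heps indep sln0)).
  have -> : (2 * Num.sqrt (ln n%:R)) ^+ 2 / 2 = 2%:R * ln n%:R :> R.
    by rewrite exprMn sqr_sqrtr ?(ltW ln_gt0)//; field.
  rewrite lee_fin expRN expRM_natl lnK ?posrE ?ltr0n//.
  rewrite le_eqVlt; apply/orP; left; apply/eqP; field.
  by rewrite pnatr_eq0 -lt0n.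
have m1 : measurable bad1 by exact: measurable_gram_bad.
have m3 : measurable bad3 by exact: measurable_gram_bad.
have m2 : measurable (bad2 (2 * Num.sqrt (ln n%:R))) by exact: measurable_noise_bad.
apply: (cdf_bound (bad := bad1 `|` (bad3 `|` bad2 (2 * Num.sqrt (ln n%:R))))).
- by do 2 apply: measurableU => //.
- have -> : 6 / n%:R = 4 / n%:R + 2 / n%:R :> R by rewrite -mulrDl; congr (_ / _); ring.
  rewrite !EFinD; apply: (le_trans (measureU2 _ m1 (measurableU _ _ m3 m2))).
  apply: leeD bad1_prob _; apply: (le_trans (measureU2 _ m3 m2)).
  exact: leeD.
- by rewrite !mulr_ge0 ?invr_ge0 ?(ltW c0) ?(ltW lambda_gt0) ?(ltW s20).
move=> w good.
have good1 : ~ bad1 w by move=> b; apply: good; left.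
have good3 : ~ bad3 w by move=> b; apply: good; right; left.
have good2 : ~ bad2 (2 * Num.sqrt (ln n%:R)) w by move=> b; apply: good; right; right.
split=> //; split; last exact: population_feasible.
have Ka0 : 0 <= K * a by rewrite ltW// mulr_gt0// rate_gt0.
apply: (lasso_l1_sparse N0 nu0 lambda_gt0 lambda_gE (betahat_argmin w) c0
  population_coercive (gram_near good1) s10 s20 nus betaS _ Ka0 small).
have two0 : 0 <= 2 :> R by [].
move=> l; apply: (le_trans (noise_level two0 good1 good2 l)).
rewrite le_eqVlt; apply/orP; left; apply/eqP; by field.
Qed.

(** The regime of bounded n: every failure probability is governed by K. *)
Lemma dense_cdf_bound t : 2 * (n%:R * (K * a)) <= c ->
  `|fine (normal_prob 0 1 `]-oo, t]) - fine (P (Z @^-1` `]-oo, t]))| <=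
  4 * n%:R ^+ 2 * expR (- (kappa * K ^+ 2 * ln n%:R)) +
  2 * n%:R * expR (- (K ^+ 2 / 2 * ln n%:R)) +
  normal_peak 1 * (Num.sqrt N%:R *
    (mu * (4 * (K / 4 + 2) / c * n%:R ^+ 2 * lambda))
    * (2 * Num.sqrt V0) / sigma_eps).
Proof.
move=> small.
have sln0 : 0 <= K * Num.sqrt (ln n%:R) :> R by rewrite mulr_ge0 ?sqrtr_ge0// ltW.
have bad2_prob : (P (bad2 (K * Num.sqrt (ln n%:R))) <=
    (2 * n%:R * expR (- (K ^+ 2 / 2 * ln n%:R)))%:E)%E.
  apply: (le_trans (noise_bad_prob N0 sigma_eps0 Heps indep sln0)).
  have -> : (K * Num.sqrt (ln n%:R)) ^+ 2 / 2 = K ^+ 2 / 2 * ln n%:R :> R.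
    by rewrite exprMn sqr_sqrtr ?(ltW ln_gt0)//; field.
  by rewrite lee_fin mulrA [n%:R * 2]mulrC.
have m1 : measurable bad1 by exact: measurable_gram_bad.
have m2 : measurable (bad2 (K * Num.sqrt (ln n%:R))) by exact: measurable_noise_bad.
apply: (cdf_bound (bad := bad1 `|` bad2 (K * Num.sqrt (ln n%:R)))).
- exact: measurableU.
- by rewrite EFinD; apply: (le_trans (measureU2 _ m1 m2)); exact: leeD bad1_prob _.
- rewrite !mulr_ge0 ?invr_ge0 ?(ltW c0) ?(ltW lambda_gt0) ?sqr_ge0//.
  by rewrite addr_ge0// divr_ge0// ltW.
move=> w good.
have good1 : ~ bad1 w by move=> b; apply: good; left.
have good2 : ~ bad2 (K * Num.sqrt (ln n%:R)) w by move=> b; apply: good; right.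
split=> //; split; last exact: empirical_feasible.
have Ka0 : 0 <= K * a by rewrite ltW// mulr_gt0// rate_gt0.
have K40 : 0 <= K / 4 by rewrite divr_ge0// ltW.
apply: (lasso_l1_dense N0 nu0 lambda_gt0 lambda_gE (betahat_argmin w) c0
  population_coercive (gram_near good1) (ltW nu1) K40 n0 _ Ka0 small).
exact: (noise_level (ltW K0) good1 good2).
Qed.

End nonasymptotic.

(** * Choice of the deviation level and passage to the limit *)

Section rates.
Context (R : realType).

Lemma expRN_le_inv (x : R) : 0 < x -> expR (- x) <= x^-1.
Proof.
move=> x0; rewrite expRN lef_pV2 ?posrE ?expR_gt0//.
by apply: le_trans (expR_ge1Dx x); rewrite lerDr.
Qed.

Lemma natX_expRN (n p : nat) (q s : R) : (1 < n)%N -> 0 <= q -> p%:R + q <= s ->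
  n%:R ^+ p * expR (- (s * ln n%:R)) <= expR (- (q * ln 2)).
Proof.
move=> n1 q0 ps.
have nR : 0 < n%:R :> R by rewrite ltr0n ltnW.
have l2 : ln 2 <= ln n%:R :> R by rewrite ler_ln ?posrE// ler_nat.
have l0 : 0 <= ln n%:R :> R by rewrite ln_ge0// ler1n ltnW.
have -> : n%:R ^+ p = expR (p%:R * ln n%:R) :> R by rewrite expRM_natl lnK.
rewrite -expRD ler_expR.
have H1 : (p%:R + q) * ln n%:R <= s * ln n%:R by rewrite ler_wpM2r.
have H2 : q * ln 2 <= q * ln n%:R by rewrite ler_wpM2l.
lra.
Qed.

(** The exponents contain K^2 log n with log n >= log 2, so a large K makes both
    terms small for all n > 1 at once. *)
Lemma uniform_deviation_level (kappa e : R) : 0 < kappa -> 0 < e ->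
  exists2 K : R, 0 < K & forall n : nat, (1 < n)%N ->
    4 * n%:R ^+ 2 * expR (- (kappa * K ^+ 2 * ln n%:R)) <= e / 4 /\
    2 * n%:R * expR (- (K ^+ 2 / 2 * ln n%:R)) <= e / 4.
Proof.
move=> kap0 e0.
have l2 : 0 < ln 2 :> R by rewrite ln_gt0// ltr1n.
(* exp(- q log 2) <= 1 / (q log 2) = e / 16 *)
pose q := 16 / e / ln 2.
have q0 : 0 < q by rewrite !divr_gt0.
have qe : expR (- (q * ln 2)) <= e / 16.
  rewrite /q divfK ?gt_eqF//; apply: le_trans (expRN_le_inv _) _.
    by rewrite divr_gt0.
  by rewrite invf_div.
pose K2 := (2 + q) / kappa + 2 * (1 + q).
have K20 : 0 < K2 by rewrite addr_gt0// ?divr_gt0 ?mulr_gt0// addr_gt0.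
exists (Num.sqrt K2); first by rewrite sqrtr_gt0.
move=> n n1; rewrite sqr_sqrtr ?(ltW K20)//; split.
  have H : 2%:R + q <= kappa * K2.
    rewrite /K2 mulrDr mulrC divfK ?gt_eqF// lerDl.
    by rewrite mulr_ge0 ?(ltW kap0)// mulr_ge0// addr_ge0// ltW.
  have := natX_expRN n1 (ltW q0) H; rewrite -mulrA; lra.
have H : 1%:R + q <= K2 / 2.
  have : 0 <= (2 + q) / kappa by rewrite divr_ge0 ?(ltW kap0)// addr_ge0// ltW.
  by rewrite /K2; lra.
have := natX_expRN n1 (ltW q0) H; rewrite expr1 -mulrA; lra.
Qed.

End rates.

Theorem corollary2 (R : realType) (k : nat) (nu sigma_eps sigma_x c c' : R)
    (nu_ge0 : 0 <= nu) (nu_lt1 : nu < 1)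
    (sigma_eps_gt0 : 0 < sigma_eps) (sigma_x_gt0 : 0 < sigma_x)
    (c_gt0 : 0 < c) (c_le_c' : c <= c') :
  exists C_lambda C_mu : R, [/\ 0 < C_lambda, 0 < C_mu &
  forall (N n : nat -> nat) (G : forall m, sgraph (n m))
    (s1 s2 M : nat -> R) (beta : forall m, 'cV[R]_(n m))
    (Sigma : forall m, 'M[R]_(n m))
    (d : nat -> measure_display) (T : forall m, measurableType (d m))
    (P : forall m, probability (T m) R)
    (X : forall m, {RV (P m) >-> 'M[R]_(N m, n m)})
    (eps : forall m, {RV (P m) >-> 'cV[R]_(N m)})
    (betahat : forall m, {RV (P m) >-> 'cV[R]_(n m)})
    (Thetahat : forall m, {mfun 'M[R]_(N m, n m) >-> 'M[R]_(n m)})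
    (j : forall m, 'I_(n m)),
  let y m w := X m w *m beta m + eps m w in
  let lambda m := C_lambda * (sigma_eps * Num.sqrt (ln (n m)%:R / (N m)%:R)) in
  let lambda_g m :=
    lambda m * Num.sqrt (nu / (2 * (max_degree (G m))%:R) ^+ k.+1) in
  let mu m := C_mu * Num.sqrt (ln (n m)%:R / (N m)%:R) in
  (forall m, (0 < N m)%N) ->
  (forall m, (1 < n m)%N) ->
  (forall m, 0 < s1 m) ->
  (forall m, 0 < s2 m) ->
  (forall m, param_space (G m) k (s1 m) (s2 m) (beta m)) ->
  (forall m, rowwise_sub_gaussian (P m) sigma_x (Sigma m) (X m)) ->
  (forall m, isotropic_gaussian (P m) sigma_eps (eps m)) ->
  (forall m, independent_rv (P m) (X m) (eps m)) ->
  (forall m a, eigenvalue (Sigma m) a -> c <= a <= c') ->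
  (forall m i, \sum_l `|invmx (Sigma m) i l| <= M m) ->
  (forall m, nu <= s2 m / s1 m) ->
  (forall m w, is_argmin setT
     (lasso_objective (G m) k (lambda_g m) (lambda m) (y m w) (X m w))
     (betahat m w)) ->
  (forall m, is_clime (mu m) (Thetahat m)) ->
  s2 m * ln (n m)%:R / Num.sqrt (N m)%:R @[m --> \oo] --> 0 ->
  M m * Num.sqrt (ln (n m)%:R / (N m)%:R) @[m --> \oo] --> 0 ->
  cvg_in_distribution P
    (fun m w =>
       let Th := Thetahat m (X m w) in
       let betatilde := one_step (y m w) (X m w) (betahat m w) Th in
       Num.sqrt (N m)%:R * (betatilde (j m) 0 - beta m (j m) 0)
       / (sigma_eps *
          Num.sqrt ((Th *m gram (X m w) *m Th^T) (j m) (j m))))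
    (normal_prob 0 1 : probability (measurableTypeR R) R)].
Proof.
have [B BE] : exists B, B = 2 * c^-1 + 2 by exists (2 * c^-1 + 2).
have [t0 t0E] : exists t0, t0 = 3 / (8 * (sigma_x * B) ^+ 2).
  by exists (3 / (8 * (sigma_x * B) ^+ 2)).
have [A AE] : exists A : R, A = 16 * expR 1 by exists (16 * expR 1).
have [kappa kappaE] : exists kappa, kappa = t0 ^+ 2 / (4 * A).
  by exists (t0 ^+ 2 / (4 * A)).
have [V0 V0E] : exists V0, V0 = t0^-1 + 1 by exists (t0^-1 + 1).
have [C_lambda C_lambdaE] : exists x, x = 4 * Num.sqrt V0 by exists (4 * Num.sqrt V0).
have [C_mu C_muE] : exists x, x = Num.sqrt (3 / kappa) by exists (Num.sqrt (3 / kappa)).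
have B0 : 0 < B by rewrite BE ltr_wpDl// mulr_ge0// invr_ge0 ltW.
have t0_gt0 : 0 < t0 by rewrite t0E divr_gt0// mulr_gt0// exprn_gt0// mulr_gt0.
have A_gt0 : 0 < A by rewrite AE mulr_gt0// expR_gt0.
have kappa_gt0 : 0 < kappa by rewrite kappaE divr_gt0 ?exprn_gt0// mulr_gt0.
have V0_gt0 : 0 < V0 by rewrite V0E ltr_wpDl// invr_ge0 ltW.
have C_lambda_gt0 : 0 < C_lambda by rewrite C_lambdaE mulr_gt0// sqrtr_gt0.
have C_mu_gt0 : 0 < C_mu by rewrite C_muE sqrtr_gt0 divr_gt0.
exists C_lambda, C_mu; split => //.
move=> N n G s1 s2 M beta Sigma d T P X eps betahat Thetahat j y lambda lambda_g mu.
move=> N0 n1 s10 s20 betaS HX Heps indep eig HM nus betahatP ThetahatP Hs2 HMa t _.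
pose a m := Num.sqrt (ln (n m)%:R / (N m)%:R) : R.
have a_gt0 m : 0 < a m by exact: (rate_gt0 _ (N0 m) (n1 m)).
have eigc m x : eigenvalue (Sigma m) x -> c <= x by move=> /eig/andP[].
(* The rate tends to 0 because the l1 norms of the precision rows cannot. *)
have Mt0 m : t0 <= M m.
  exact: (precision_row_lower sigma_x_gt0 c_gt0 BE t0E (N0 m) (n1 m) (HX m) (@eigc m) (HM m)).
have a_small x : 0 < x -> \forall m \near \oo, a m <= x.
  move=> x0; have tx : 0 < t0 * x by rewrite mulr_gt0.
  apply: filterS (@cvgr_le _ _ _ _ _ _ HMa _ tx) => m Hm.
  rewrite -(ler_pM2l t0_gt0); apply: le_trans Hm.
  by rewrite ler_pM2r ?Mt0.
have r_small x : 0 < x ->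
    \forall m \near \oo, s2 m * ln (n m)%:R / Num.sqrt (N m)%:R <= x.
  by move=> x0; exact: (@cvgr_le _ _ _ _ _ _ Hs2 _ x0).
have rateE m : Num.sqrt (N m)%:R * a m = Num.sqrt (ln (n m)%:R).
  have NR : 0 < (N m)%:R :> R by rewrite ltr0n.
  by rewrite /a -sqrtrM ?ltW// mulrCA divff ?gt_eqF// mulr1.
have ln_le_n m : Num.sqrt (ln (n m)%:R) <= (n m)%:R :> R.
  have nR : 0 < (n m)%:R :> R by rewrite ltr0n ltnW.
  rewrite -[leRHS]ger0_norm; last exact: ltW.
  rewrite -sqrtr_sqr ler_wsqrtr//; apply: (le_trans (ltW (ln_sublinear nR))).
  by rewrite expr2 ler_peMr ?(ltW nR)// ler1n ltnW.
pose Z m (w : T m) : R :=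
  Num.sqrt (N m)%:R *
  (one_step (y m w) (X m w) (betahat m w) (Thetahat m (X m w)) (j m) 0
   - beta m (j m) 0)
  / (sigma_eps * Num.sqrt
      ((Thetahat m (X m w) *m gram (X m w) *m (Thetahat m (X m w))^T) (j m) (j m))).
have mZ m : measurable_fun [set: T m] (Z m).
  exact: (measurable_statistic sigma_eps_gt0 (beta m) (X m) (eps m) (betahat m) (Thetahat m) (j m)).
have mpre m : measurable (Z m @^-1` `]-oo, t]%classic).
  by rewrite -[X in measurable X]setTI; exact: mZ.
have fin_gamma : (normal_prob 0 1 `]-oo, t]%classic : \bar R) \is a fin_num.
  exact: fin_num_measure.
suff : P m (Z m @^-1` `]-oo, t]%classic) @[m --> \oo] -->
    (fine (normal_prob 0 1 `]-oo, t]%classic : \bar R))%:E.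
  by rewrite (fineK fin_gamma).
apply/fine_cvgP; split.
  by apply: nearW => m; exact: fin_num_measure.
apply/cvgrPdist_le => e e0.
have [K K0 Klevel] := uniform_deviation_level kappa_gt0 e0.
(* n0 separates the two regimes: 6 / n <= e / 4 beyond it. *)
have [n0 n0_gt] : exists n0 : nat, 24 / e < n0%:R.
  by exists (Num.truncn (24 / e)).+1; exact: truncnS_gt.
have n0R : 0 < n0%:R :> R by apply: lt_trans n0_gt; rewrite divr_gt0.
have pk : 0 < normal_peak 1 :> R by rewrite normal_peak_gt0// oner_neq0.
have sV0 : 0 < Num.sqrt V0 by rewrite sqrtr_gt0.
have [DA DAE] : exists x, x = C_mu * (128 / c) * C_lambda * (2 * Num.sqrt V0).
  by eexists.
have DA0 : 0 < DA by rewrite DAE !mulr_gt0// invr_gt0.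
have [DB DBE] :
  exists x, x = C_mu * (4 * (K / 4 + 2) / c) * C_lambda * (2 * Num.sqrt V0).
  by eexists.
have DB0 : 0 < DB by rewrite DBE !mulr_gt0 ?invr_gt0// addr_gt0// divr_gt0.
have sl2 : 0 < Num.sqrt (ln 2) :> R by rewrite sqrtr_gt0 ln_gt0// ltr1n.
(* h1 and h2 stay in the range of Bernstein's inequality, h3 bounds the Gram
   diagonal, h4 the defect of CLIME; h5 and h6 serve bounded n, h7 and h8 large
   n. *)
have h1 := a_small (A / t0 / K) ltac:(by rewrite !divr_gt0).
have h2 := a_small (A / t0 / C_mu) ltac:(by rewrite !divr_gt0).
have h3 := a_small K^-1 ltac:(by rewrite invr_gt0).
have h4 := a_small (2^-1 / C_mu) ltac:(by rewrite divr_gt0).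
have h5 := a_small (c / (2 * n0%:R * K)) ltac:(by rewrite divr_gt0// !mulr_gt0).
have h6 := a_small (e / 4 / (normal_peak 1 * DB * n0%:R ^+ 3))
  ltac:(by rewrite !divr_gt0// mulr_gt0 ?exprn_gt0// mulr_gt0).
have h7 := r_small (c * Num.sqrt (ln 2) / (128 * K))
  ltac:(by rewrite divr_gt0 ?mulr_gt0).
have h8 := r_small (e / 4 / (normal_peak 1 * DA))
  ltac:(by rewrite !divr_gt0// mulr_gt0).
apply: filterS (filterI (filterI (filterI h1 h2) (filterI h3 h4))
  (filterI (filterI h5 h6) (filterI h7 h8))) => m [[[{}h1 {}h2] [{}h3 {}h4]] [[{}h5 {}h6] [{}h7 {}h8]]].
have am := a_gt0 m.
have Ka_range : K * a m <= A / t0 by move: h1; rewrite ler_pdivlMr// mulrC.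
have mu_range : C_mu * a m <= A / t0 by move: h2; rewrite ler_pdivlMr// mulrC.
have Ka1 : K * a m <= 1.
  by move: h3; rewrite -[X in _ <= X -> _]mul1r ler_pdivlMr// mulrC.
have mu_half : C_mu * a m <= 2^-1 by move: h4; rewrite ler_pdivlMr// mulrC.
have nm0 : 0 < (n m)%:R :> R by rewrite ltr0n ltnW.
have Nm0 : 0 < (N m)%:R :> R by rewrite ltr0n.
have [K1 K2] := Klevel _ (n1 m).
have sN : 0 < Num.sqrt (N m)%:R :> R by rewrite sqrtr_gt0.
have aE : a m = Num.sqrt (ln (n m)%:R) / Num.sqrt (N m)%:R.
  by rewrite -rateE mulrAC divff ?mul1r// gt_eqF.
have lnm0 : 0 < ln (n m)%:R :> R by rewrite ln_gt0// ltr1n.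
have rE : s2 m * ln (n m)%:R / Num.sqrt (N m)%:R =
    s2 m * (Num.sqrt (ln (n m)%:R) * a m).
  rewrite aE [X in X / _](_ : _ = s2 m * Num.sqrt (ln (n m)%:R) ^+ 2); last first.
    by rewrite sqr_sqrtr ?(ltW lnm0).
  by rewrite expr2 -!mulrA.
have lambdaNE : Num.sqrt (N m)%:R * (mu m * lambda m) =
    C_mu * C_lambda * sigma_eps * (Num.sqrt (ln (n m)%:R) * a m).
  by rewrite -rateE /mu /lambda -/(a m); ring.
have [nbig|nsmall] := leqP n0 (n m).
  have small : 128 * (s2 m * (K * a m)) <= c.
    have ll : Num.sqrt (ln 2) <= Num.sqrt (ln (n m)%:R) :> R.
      by rewrite ler_wsqrtr// ler_ln ?posrE// ler_nat.
    rewrite -(ler_pM2l sl2); move: h7.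
    rewrite rE ler_pdivlMr ?mulr_gt0// [c * _]mulrC; apply: le_trans.
    have := ler_wpM2r (ltW (mulr_gt0 (mulr_gt0 (s20 m) am) (mulr_gt0 (ltr0n R 128) K0))) ll.
    by clear; lra.
  have := sparse_cdf_bound nu_ge0 sigma_eps_gt0 sigma_x_gt0 c_gt0
    BE t0E AE kappaE V0E C_lambdaE C_muE (j m) (N0 m) (n1 m) (s10 m) (s20 m) (betaS m)
    (HX m) (Heps m) (indep m) (@eigc m) (nus m) erefl erefl erefl
    (betahatP m) (ThetahatP m) K0 Ka_range mu_range Ka1 mu_half t small.
  move=> H; apply: (le_trans H).
  have n6 : 6 / (n m)%:R <= e / 4.
    have : 24 / e <= (n m)%:R by rewrite ltW// (lt_le_trans n0_gt)// ler_nat.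
    by rewrite !ler_pdivrMr//; clear; lra.
  have etaE : Num.sqrt (N m)%:R * (mu m * (128 / c * (lambda m * s2 m)))
      * (2 * Num.sqrt V0) / sigma_eps =
      DA * (s2 m * ln (n m)%:R / Num.sqrt (N m)%:R).
    transitivity (Num.sqrt (N m)%:R * (mu m * lambda m) * (128 / c) * s2 m
      * (2 * Num.sqrt V0) / sigma_eps); first by ring.
    by rewrite lambdaNE rE DAE; field; rewrite !gt_eqF.
  rewrite etaE; move: h8; rewrite ler_pdivlMr; last exact: mulr_gt0 pk DA0.
  move: (s2 m * _ / _) => r.
  have -> : r * (normal_peak 1 * DA) = normal_peak 1 * (DA * r) by ring.
  by move: e0 K1 n6; clear; lra.
have nle : (n m)%:R <= n0%:R :> R by rewrite ler_nat ltnW.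
have small : 2 * ((n m)%:R * (K * a m)) <= c.
  move: h5; rewrite ler_pdivlMr ?mulr_gt0//; apply: le_trans.
  have := ler_wpM2r (ltW (mulr_gt0 K0 am)) nle.
  by clear; lra.
have := dense_cdf_bound nu_ge0 nu_lt1 sigma_eps_gt0 sigma_x_gt0 c_gt0
    BE t0E AE kappaE V0E C_lambdaE C_muE (j m) (N0 m) (n1 m)
    (HX m) (Heps m) (indep m) (@eigc m) erefl erefl erefl
    (betahatP m) (ThetahatP m) K0 Ka_range Ka1 mu_half t small.
move=> H; apply: (le_trans H).
have etaE : Num.sqrt (N m)%:R * (mu m * (4 * (K / 4 + 2) / c * (n m)%:R ^+ 2 * lambda m))
    * (2 * Num.sqrt V0) / sigma_eps =
    DB * ((n m)%:R ^+ 2 * Num.sqrt (ln (n m)%:R) * a m).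
  transitivity (Num.sqrt (N m)%:R * (mu m * lambda m) * (4 * (K / 4 + 2) / c) * (n m)%:R ^+ 2
      * (2 * Num.sqrt V0) / sigma_eps); first by ring.
  by rewrite lambdaNE DBE; field; rewrite !gt_eqF.
have n3 : (n m)%:R ^+ 2 * Num.sqrt (ln (n m)%:R) * a m <= n0%:R ^+ 3 * a m.
  rewrite ler_wpM2r ?(ltW am)//.
  apply: (@le_trans _ _ ((n m)%:R ^+ 2 * (n m)%:R)); first by rewrite ler_wpM2l ?sqr_ge0.
  by rewrite -exprSr lerXn2r ?nnegrE// ltW.
have : normal_peak 1 * (DB * ((n m)%:R ^+ 2 * Num.sqrt (ln (n m)%:R) * a m)) <= e / 4.
  have pB : 0 < normal_peak 1 * DB * n0%:R ^+ 3.
    by rewrite mulr_gt0 ?exprn_gt0// mulr_gt0.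
  move: h6; rewrite ler_pdivlMr//; apply: le_trans.
  have -> : a m * (normal_peak 1 * DB * n0%:R ^+ 3) =
    normal_peak 1 * DB * (n0%:R ^+ 3 * a m) by ring.
  rewrite [leLHS]mulrA; apply: ler_wpM2l n3; exact: ltW (mulr_gt0 pk DB0).
by rewrite etaE; move: e0 K1 K2; clear; lra.
Qed.
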